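(* Let $\mathcal V,\mathcal H,\mathcal Q$, $\mathcal A$, $\mathcal B$ be as in the context, and let $f\colon[0,T]\times\mathcal H\to\mathcal H^*$ satisfy the classical Carathéodory condition and the Lipschitz condition $$\|f(t,v_1)-f(t,v_2)\|_{\mathcal H^*}\le L_{\mathcal H}\|v_1-v_2\|_{\mathcal H}\quad\text{for all }v_1,v_2\in\mathcal H,\ t\ge0.$$ Let $u^0\in\mathcal V$, $w^0\in\mathcal H$ be consistent initial data and let $u$ be the solution of $$\ddot u(t)+\mathcal Au(t)+\mathcal B^*\lambda(t)=f(t,u)\ \text{ in }\mathcal V^*,\qquad \mathcal Bu(t)=g(t)\ \text{ in }\mathcal Q^*,\qquad u(0)=u^0,\ \dot u(0)=w^0 .$$ Let $u^1$ satisfy $\|u^1-u(t_1)\|_{\mathcal H}\le\tau^3E_{\rm init}$, and assume $$f(\cdot,u(\cdot))\in C^2([0,T],\mathcal H),\qquad g\in C^4([0,T],\mathcal Q^* ).$$ Let $u^n$ be defined for $n\ge2$ by the Gautschi-type integrator $$u^{n+1}=\mathcal B^-g^{n+1}-(u^{n-1}-\mathcal B^-g^{n-1})+2\cos(\tau\Omega_{\ker})\,(u^n-\mathcal B^-g^n-b^n)+2b^n,\qquad b^n=\mathcal A_{\ker}^{-1}\pi_{\ker}\big[f(t_n,u^n)-\mathcal B^-\ddot g(t_n)\big].$$ Then the integrator is second-order accurate with the error estimate $$\|u^n-u(t_n)\|_{\mathcal H}\le\tau^2\,t_n\,e^{\kappa t_n}\cosh(t_nL^{1/2})\,\big(E_{\rm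 init}+t_nC_{f,g}\big)+\mathcal O(\tau^3),$$ where $$C_{f,g}=\big\|\ddot f(\cdot,u)\big\|_{L^\infty(0,t_n;\mathcal H^* )}+C_{\mathcal V\to\mathcal H}\,C_{\mathcal B^-}\,\big\|g^{(4)}\big\|_{L^\infty(0,t_n;\mathcal Q^* )},$$ $C_{\mathcal V\to\mathcal H}$ is the embedding constant of $\mathcal V\hookrightarrow\mathcal H$, $C_{\mathcal B^-}$ is the continuity constant of $\mathcal B^-$, $\kappa=C_2/\sqrt{\mu_1}$ with $C_2$ the continuity constant of $\mathcal A_2$ and $\mu_1$ the ellipticity constant of $\mathcal A_1$, and $L=\exp(\kappa t_n)L_{\mathcal H}$.
   Context: **Spaces.** $\mathcal V,\mathcal H,\mathcal Q$ are Hilbert spaces with duals $\mathcal V^*,\mathcal H^*,\mathcal Q^*$; $\mathcal V\hookrightarrow\mathcal H\cong\mathcal H^*\hookrightarrow\mathcal V^*$ is a Gelfand triple. **Constraint operator.** $\mathcal B\colon\mathcal V\to\mathcal Q^*$ is linear and continuous, and there is $\beta>0$ with $\inf_{q\in\mathcal Q\setminus\{0\}}\sup_{v\in\mathcal V\setminus\{0\}}\frac{\langle\mathcal Bv,q\rangle}{\|v\|_{\mathcal V}\|q\|_{\mathcal Q}}\ge\beta$. $\mathcal V_{\ker}=\ker\mathcal B$; $\mathcal H_{\ker}$ is the closure of $\mathcal V_{\ker}$ in $\mathcal H$. **Differential operator.** $\mathcal A\colon\mathcal V\to\mathcal V^*$ is linear, continuous and elliptic on $\mathcal V_{\ker}$;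 $\mathcal A=\mathcal A_1+\mathcal A_2$ with $\mathcal A_1$ self-adjoint and elliptic on $\mathcal V_{\ker}$ ($\langle\mathcal A_1v,v\rangle\ge\mu_1\|v\|_{\mathcal V}^2$ for $v\in\mathcal V_{\ker}$) and $\mathcal A_2\in\mathcal L(\mathcal V,\mathcal H^* )$ ($\|\mathcal A_2v\|_{\mathcal H^*}\le C_2\|v\|_{\mathcal V}$). $\mathcal A_{\ker}=\mathcal A|_{\mathcal V_{\ker}}\colon\mathcal V_{\ker}\to\mathcal V_{\ker}^*$ (functionals restricted to $\mathcal V_{\ker}$). **Complement and right inverse.** $\mathcal V_{\rm c}=\{v\in\mathcal V:\langle\mathcal Av,w\rangle=0\ \forall w\in\mathcal V_{\ker}\}$, so $\mathcal V=\mathcal V_{\ker}\oplus\mathcal V_{\rm c}$; $\mathcal B^-\colon\mathcal Q^*\to\mathcal V$ is the continuous right inverse of $\mathcal B$ with image $\mathcal V_{\rm c}$. **Consistency.** $u^0\in\mathcal B^-g(0)+\mathcal V_{\ker}$ and $w^0\in\mathcal B^-\dot g(0)+\mathcal H_{\ker}$. **Projection.** $\pi_{\ker}\colon\mathcal H\to\mathcal H_{\ker}$ is the $\mathcal H$-orthogonal projection. **Operator cosine.** $\Omega_{\ker}=\mathcal A_{\ker}^{1/2}$ is only notation: for $v\in\mathcal V_{\ker}$, $\cos(t\Omega_{\ker})v$ is the value at time $t$ of the solution $y$ of $\ddot y+\mathcal A_{\ker}y=0$ in $\mathcal V_{\ker}^*$, $y(0)=v$, $\dot y(0)=0$; it extends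 to a bounded operator on $\mathcal H_{\ker}$. **Discretization.** $\tau=T/N$ is a constant step size, $t_n=n\tau$ are the discrete time points in $[0,T]$, $g^n=g(t_n)$. The method is a two-step method started with $u^0$ and $u^1$. $\ddot f(\cdot,u)$ denotes the second time derivative of $t\mapsto f(t,u(t))$. *)

(* Defs.v *)
From HB Require Import structures.
From mathcomp Require Import all_boot all_order all_algebra.
From mathcomp Require Import all_classical all_reals all_analysis.

Set Implicit Arguments.
Unset Strict Implicit.
Unset Printing Implicit Defensive.

Import Order.TTheory GRing.Theory Num.Def Num.Theory.
Import numFieldNormedType.Exports.

Local Open Scope classical_set_scope.
Local Open Scope ring_scope.

Section dual_def.
Context {R : realType} {E : normedModType R}.

Definition dual_pred : {pred E -> R^o} :=
  [pred phi : E -> R^o | `[< linear phi /\ continuous phi >]].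

Lemma dual_predP (phi : E -> R^o) :
  reflect (linear phi /\ continuous phi) (phi \in dual_pred).
Proof. by rewrite inE; exact: asboolP. Qed.

Lemma dual_submod_closed : submod_closed dual_pred.
Proof.
split=> [|c phi psi /dual_predP[lphi cphi] /dual_predP[lpsi cpsi]].
  apply/dual_predP; split=> [a x y|]; last exact: cst_continuous.
  by rewrite [LHS](_ : _ = 0)// [RHS](_ : _ = a *: (0 : R^o) + 0)// scaler0 addr0.
apply/dual_predP; split=> [a x y|x].
  rewrite -[LHS]/(c *: phi (a *: x + y) + psi (a *: x + y)).
  rewrite -[RHS]/(a *: (c *: phi x + psi x) + (c *: phi y + psi y)).
  by rewrite lphi lpsi !scalerDr !scalerA mulrC -!addrA; congr (_ + _); rewrite addrCA.
by apply: cvgD; [apply: cvgZr; exact: cphi|exact: cpsi].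
Qed.

HB.instance Definition _ :=
  GRing.isSubmodClosed.Build R (E -> R^o) dual_pred dual_submod_closed.

End dual_def.

Record dual {R : realType} (E : normedModType R) := Dual {
  dual_fun :> E -> R^o ;
  dual_funP : dual_fun \in dual_pred }.

Section dual_lmod.
Context {R : realType} (E : normedModType R).
HB.instance Definition _ := [isSub of dual E for @dual_fun R E].
HB.instance Definition _ := [Choice of dual E by <:].
HB.instance Definition _ := [SubChoice_isSubLmodule of dual E by <:].
End dual_lmod.

Section dual_norm.
Context {R : realType} (E : normedModType R).
Implicit Types (phi psi : dual E) (v : E).

Definition dual_norm phi : R := sup [set `|phi v| | v in [set v | `|v| <= 1]].

Lemma dual_linear phi : linear (phi : E -> R^o).
Proof. by have /dual_predP[] := dual_funP phi. Qed.

Lemma dual_continuous phi : continuous (phi : E -> R^o).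
Proof. by have /dual_predP[] := dual_funP phi. Qed.

HB.instance Definition _ phi :=
  GRing.isLinear.Build R E R^o *:%R (dual_fun phi) (@dual_linear phi).

Let S phi := [set `|phi v| | v in [set v | `|v| <= 1]].

Lemma dual_norm_has_sup phi : has_sup (S phi).
Proof.
split; first by exists `|phi 0|; exists 0 => //=; rewrite normr0.
have /linear_bounded_continuous/linear_boundedP := @dual_continuous phi.
move=> [M [_ hM]]; exists (`|M| + 1) => _ [v /= v1 <-].
apply: le_trans (_ : (`|M| + 1) * `|v| <= _).
  by apply: hM; rewrite (le_lt_trans (ler_norm _))// ltrDl.
by rewrite ler_piMr// addr_ge0.
Qed.

Lemma dual_norm_ge phi v : `|v| <= 1 -> `|phi v| <= dual_norm phi.
Proof.
move=> v1; apply: sup_ubound; last by exists v.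
by have [] := dual_norm_has_sup phi.
Qed.

Lemma dual_norm_le phi M : (forall v, `|v| <= 1 -> `|phi v| <= M) -> dual_norm phi <= M.
Proof.
move=> h; apply: ge_sup; first by have [] := dual_norm_has_sup phi.
by move=> _ [v v1 <-]; exact: h.
Qed.

Lemma dual_norm_ge0 phi : 0 <= dual_norm phi.
Proof. by apply: le_trans (dual_norm_ge phi (_ : `|0| <= 1)) => //; rewrite normr0. Qed.

Lemma dual_pairing_le phi v : `|phi v| <= dual_norm phi * `|v|.
Proof.
have [->|v0] := eqVneq v 0; first by rewrite linear0 !normr0 mulr0.
have nv0 : 0 < `|v| by rewrite normr_gt0.
rewrite -ler_pdivrMr//; have := @dual_norm_ge phi (`|v|^-1 *: v).
rewrite normrZ normfV normr_id mulVf ?gt_eqF// => /(_ (lexx _)).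
by rewrite linearZ/= normrM normfV normr_id mulrC.
Qed.

Lemma dual_normD phi psi : dual_norm (phi + psi) <= dual_norm phi + dual_norm psi.
Proof.
apply: dual_norm_le => v v1.
by rewrite (le_trans (ler_normD _ _))// lerD// dual_norm_ge.
Qed.

Lemma dual_normZ (c : R) phi : dual_norm (c *: phi) = `|c| * dual_norm phi.
Proof.
have hle d psi : dual_norm (d *: psi) <= `|d| * dual_norm psi.
  apply: dual_norm_le => v v1.
  rewrite -[X in `|X|]/(d * psi v) normrM ler_wpM2l//; exact: dual_norm_ge.
apply/eqP; rewrite eq_le hle/=.
have [->|c0] := eqVneq c 0; first by rewrite normr0 mul0r dual_norm_ge0.
rewrite -ler_pdivlMl ?normr_gt0//.
by have := hle c^-1 (c *: phi); rewrite scalerA mulVf// scale1r normfV.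
Qed.

Lemma dual_norm_eq0 phi : dual_norm phi = 0 -> phi = 0.
Proof.
move=> phi0; apply/val_inj/funext => v /=.
by apply/eqP; rewrite -normr_le0; have := dual_pairing_le phi v; rewrite phi0 mul0r.
Qed.

HB.instance Definition _ := Lmodule_isNormed.Build R (dual E)
  dual_normD dual_normZ dual_norm_eq0.

End dual_norm.

Lemma dual_normE (R : realType) (E : normedModType R) (phi : dual E) :
  `|phi| = sup [set `|phi v| | v in [set v : E | `|v| <= 1]].
Proof. by []. Qed.

(* [dot] turns the complete normed space E into a real Hilbert space. *)
Definition hilbert_dot {R : realType} {E : completeNormedModType R}
  (dot : {dot E for (@idfun R)}) : Prop := forall v, dot v v = `|v| ^+ 2.

Section calculus.
Context {R : realType} {E : normedModType R}.
Implicit Types (D : set R) (y : R -> E).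

Definition diff_quot D y (t : R) : set_system E :=
  (s - t)^-1 *: (y s - y t) @[s --> within D t^'].

(* Derivative relative to the interval D: one-sided at its endpoints. *)
Definition derive_on D y (t : R) : E := lim (diff_quot D y t).

Definition derive_onn D k y : R -> E := iter k (derive_on D) y.

Definition C_on D k y : Prop :=
  (forall i t, (i < k)%N -> D t -> cvg (diff_quot D (derive_onn D i y) t)) /\
  (forall i, (i <= k)%N -> {within D, continuous (derive_onn D i y)}).

(* The real number [fine] of an extended norm is meaningful only when the norm
   is finite; below it is applied to functions continuous on `[0, t]. *)
Definition Linfty_norm (t : R) y : R :=
  fine (Lnorm (mrestr lebesgue_measure (measurable_itv `]0, t[)) +oo%E
    (fun s => `|y s|%:E)).

(* Bochner measurability of y on the measurable set D. *)
Definition strongly_measurable D y : Prop :=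
  exists s : nat -> R -> E,
    (forall n, finite_set (range (s n)) /\
       forall x, measurable (s n @^-1` [set x])) /\
    {ae lebesgue_measure, forall t, D t -> s n t @[n --> \oo] --> y t}.

End calculus.

(* f : D x H -> H; the dual of the pivot space H is identified with H. *)
Definition caratheodory {R : realType} {H : normedModType R}
    (D : set R) (f : R -> H -> H) : Prop :=
  (forall x, strongly_measurable D (fun t => f t x)) /\
  {ae lebesgue_measure, forall t, D t -> continuous (f t)}.

Section distributions.
Context {R : realType}.

Definition test_function (T : R) (phi : R -> R) : Prop :=
  (forall k x, derivable (derive1n k phi) x 1) /\
  exists a b, [/\ 0 < a, b < T & forall x, phi x != 0 -> a <= x <= b].

(* Distributions on ]0, T[ with values in Q. *)
Definition is_distribution (T : R) {Q : normedModType R}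
    (lam : (R -> R) -> Q) : Prop :=
  (forall c phi psi, test_function T phi -> test_function T psi ->
     lam (fun x => c * phi x + psi x) = c *: lam phi + lam psi) /\
  (forall a b, 0 < a -> b < T -> exists C m, forall phi M,
     test_function T phi -> (forall x, phi x != 0 -> a <= x <= b) ->
     (forall k x, (k <= m)%N -> `|derive1n k phi x| <= M) ->
     `|lam phi| <= C * M).

End distributions.

Section setting.
Context {R : realType} {V H Q : completeNormedModType R}.
Variable dotH : {dot H for (@idfun R)}.
Variable j : {linear V -> H}.
Variable A : {linear V -> dual V}.
Variable B : {linear V -> dual Q}.

Definition gelfand_triple : Prop :=
  [/\ continuous j, injective j & dense (range j)].

Definition inf_sup (beta : R) : Prop :=
  (beta%:E <= ereal_inf [set ereal_sup [set (B v q / (`|v| * `|q|))%R%:E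
                                       | v in [set v : V | v != 0%R]]
                        | q in [set q : Q | q != 0%R]])%E.

Definition Vker : set V := [set v | B v = 0].

Definition Hker : set H := closure (j @` Vker).

Definition Vc : set V := [set v | forall w, Vker w -> A v w = 0].

Definition elliptic_on_Vker (mu : R) (A' : V -> dual V) : Prop :=
  forall v, Vker v -> mu * `|v| ^+ 2 <= A' v v.

Definition is_right_inverse (Bm : dual Q -> V) : Prop :=
  [/\ continuous Bm, (forall q, B (Bm q) = q) & range Bm = Vc].

Definition is_projection_Hker (pi : H -> H) : Prop :=
  forall x, Hker (pi x) /\ forall z, Hker z -> dotH (x - pi x) z = 0.

(* v = A_ker^-1 h, where h in H acts on V_ker through the inner product. *)
Definition is_Aker_inv (h : H) (v : V) : Prop :=
  Vker v /\ forall w, Vker w -> A v w = dotH h (j w).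

(* y'' + A_ker y = 0, y(0) = v, y'(0) = 0 on [0, +oo[. The equation holds in
   the dual of V_ker: y' takes values in H, embedded in that dual by dotH, and
   is differentiated there. *)
Definition wave_solution (v : V) (y : R -> V) : Prop :=
  let D := [set t : R | 0 <= t] in
  [/\ {within D, continuous y}, forall t, D t -> Vker (y t),
      C_on D 1 (j \o y),
      (y 0 = v /\ derive_on D (j \o y) 0 = 0) &
      forall t w, D t -> Vker w ->
        diff_quot D (fun s => dotH (derive_on D (j \o y) s) (j w) : R^o) t
          --> (- A (y t) w : R^o)].

(* cosK t = cos(t Omega_ker); its values outside H_ker are irrelevant. *)
Definition is_operator_cosine (cosK : R -> H -> H) : Prop :=
  (forall t, 0 <= t ->
    [/\ forall x, Hker x -> Hker (cosK t x),
        forall c x z, Hker x -> Hker z ->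
          cosK t (c *: x + z) = c *: cosK t x + cosK t z &
        exists M, forall x, Hker x -> `|cosK t x| <= M * `|x|]) /\
  (forall v, Vker v -> exists2 y, wave_solution v y &
    forall t, 0 <= t -> cosK t (j v) = j (y t)).

(* u in C([0,T];V) with j u in C^1([0,T];H); the differential equation holds in
   V^* in the sense of distributions on ]0, T[, the multiplier lam being a
   Q-valued distribution. *)
Definition pdae_solution (T : R) (f : R -> H -> H) (g : R -> dual Q)
    (u0 : V) (w0 : H) (u : R -> V) : Prop :=
  [/\ {within `[0, T], continuous u}, C_on `[0, T] 1 (j \o u),
      exists2 lam : (R -> R) -> Q, is_distribution T lam &
        forall phi v, test_function T phi ->
          \int[lebesgue_measure]_(t in `[0, T])
             (dotH (j (u t)) (j v) * derive1n 2 phi t + A (u t) v * phi t)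
          + B v (lam phi)
          = \int[lebesgue_measure]_(t in `[0, T])
              (dotH (f t (j (u t))) (j v) * phi t),
      forall t, t \in `[0, T] -> B (u t) = g t &
      u 0 = u0 /\ derive_on `[0, T] (j \o u) 0 = w0].

Definition consistent (Bm : dual Q -> V) (T : R) (g : R -> dual Q)
    (u0 : V) (w0 : H) : Prop :=
  Vker (u0 - Bm (g 0)) /\ Hker (w0 - j (Bm (derive_on `[0, T] g 0))).

(* u 0, ..., u N are produced by the two-step scheme with step T / N; the
   operator cosine being defined on H_ker only, its argument has to lie there. *)
Definition gautschi (Bm : dual Q -> V) (pi : H -> H) (cosK : R -> H -> H)
    (T : R) (f : R -> H -> H) (g : R -> dual Q) (N : nat) (u : nat -> H) :
    Prop :=
  let tau := T / N%:R in
  let t := fun n : nat => n%:R * tau in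
  let Bg := fun n => j (Bm (g (t n))) in
  exists b : nat -> V, forall n, (1 <= n < N)%N ->
    [/\ is_Aker_inv
          (pi (f (t n) (u n) - j (Bm (derive_onn `[0, T] 2 g (t n))))) (b n),
        Hker (u n - Bg n - j (b n)) &
        u n.+1 = Bg n.+1 - (u n.-1 - Bg n.-1)
                 + 2 *: cosK tau (u n - Bg n - j (b n)) + 2 *: j (b n)].

End setting.

Definition cosh {R : realType} (x : R) : R := (expR x + expR (- x)) / 2.

(* Main.v *)
Require Import Defs.
From HB Require Import structures.
From mathcomp Require Import all_boot all_order all_algebra.
From mathcomp Require Import all_classical all_reals all_analysis.
From mathcomp Require Import ess_sup_inf ring lra.

(* The error e^n = u^n - u(t_n) lies in H_ker and satisfies the perturbed cosine
   recursion e^(n+1) = 2 cos(tau Omega) e^n - e^(n-1) + d^n.  The defect d^n is the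
   value at time tau of a wave started at rest whose right-hand side is a second
   difference of f - B^- g'' plus twice the Lipschitz perturbation
   f(t_n, u^n) - f(t_n, u(t_n)).  A weak solution y of y'' + A_ker y = F has no
   differentiable energy, but its antiderivative z has, and |z'|^2 + <A_1 z, z>
   grows at most like e^(kappa t); this bounds y = z' in H and gives both
   |cos(t Omega)| <= e^(kappa t / 2) on H_ker and the size of d^n.  Solving the
   recursion with Chebyshev polynomials of the second kind in cos(tau Omega), whose
   norms grow linearly in the degree up to e^(kappa t / 2), leaves a discrete
   Gronwall inequality whose majorant is cosh.  The multiplier disappears when the
   equation is tested in V_ker; the du Bois-Reymond lemma then turns the
   distributional equation into a pointwise one. *)

(** The numerical error is only known to lie in [H_ker], so every estimate has to use the norm of
    [H] alone; passing to the antiderivative lowers the energy by one order, so that this norm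
    appears in it as |z'|. The constant [kappa] comes from Young's inequality applied to the [A2]
    term, which the symmetric energy cannot absorb. It is the growth rate of a squared norm, so
    norms grow at rate kappa / 2. The operator cosine is given only through waves, without
    functional calculus. Its addition formula is therefore itself a statement about waves: a
    combination of three of them starts at rest from 0 with zero source, hence vanishes. The same
    combination with nonzero sources is the defect, so one lemma, [two_step], serves both purposes.
    The addition formula is also what makes the Chebyshev operators grow linearly, through U_n -
    U_(n-2) = 2 cos(n tau Omega). The argument gives kappa / 2, a factor 1/12 and sqrt(LH) where the
    statement has larger quantities, and it leaves no third-order remainder. *)

Set Implicit Arguments.
Unset Strict Implicit.
Unset Printing Implicit Defensive.

Import Order.TTheory GRing.Theory Num.Def Num.Theory.
Import numFieldNormedType.Exports.

Local Open Scope classical_set_scope.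
Local Open Scope ring_scope.

(** * Derivatives relative to a set *)

(* The o(s - t) form of [diff_quot D y t --> l]. *)
Definition hderiv {R : realType} {E : normedModType R} (D : set R)
    (y : R -> E) (t : R) (l : E) : Prop :=
  forall e, 0 < e ->
    \forall s \near t, D s -> `|y s - y t - (s - t) *: l| <= e * `|s - t|.

Section hderiv_theory.
Context {R : realType}.
Implicit Types (D : set R) (t : R).

Lemma hderiv_diff_quot (E : normedModType R) D (y : R -> E) t l :
  diff_quot D y t --> l -> hderiv D y t l.
Proof.
move=> /cvgrPdist_le h e e0.
have h2 : \forall s \near t, s != t -> D s -> `|l - (s - t)^-1 *: (y s - y t)| <= e.
  exact: h.
apply: filterS h2 => s hs Ds.
have [->|st] := eqVneq s t; first by rewrite !subrr scale0r subrr !normr0 mulr0.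
have st0 : s - t != 0 by rewrite subr_eq0.
have h3 := hs st Ds.
rewrite -(ler_pdivrMr _ _ (_ : 0 < `|s - t|)) ?normr_gt0//.
apply: le_trans h3; rewrite mulrC -normfV -normrZ scalerBr scalerA mulVf//.
by rewrite scale1r distrC.
Qed.

Lemma hderivS (E : normedModType R) D D' (y : R -> E) t l :
  D' `<=` D -> hderiv D y t l -> hderiv D' y t l.
Proof. by move=> DD h e /h; apply: filterS => s hs /DD. Qed.

Lemma hderiv_eq (E : normedModType R) D (y z : R -> E) t l :
  (forall s, D s -> y s = z s) -> D t -> hderiv D y t l -> hderiv D z t l.
Proof. by move=> yz Dt h e /h; apply: filterS => s hs /[dup] /hs + Ds; rewrite !yz. Qed.

Lemma hderiv_cst (E : normedModType R) D (c : E) t : hderiv D (fun=> c) t 0.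
Proof.
move=> e e0; near=> s => _.
by rewrite subrr scaler0 subrr normr0 mulr_ge0// ltW.
Unshelve. all: by end_near. Qed.

Lemma hderivD (E : normedModType R) D (y z : R -> E) t l m :
  hderiv D y t l -> hderiv D z t m -> hderiv D (fun s => y s + z s) t (l + m).
Proof.
move=> hy hz e e0; have e20 : 0 < e / 2 by rewrite divr_gt0.
near=> s => Ds.
have -> : y s + z s - (y t + z t) - (s - t) *: (l + m)
  = (y s - y t - (s - t) *: l) + (z s - z t - (s - t) *: m).
  by rewrite scalerDr !opprD (addrACA (y s)) [RHS]addrACA.
rewrite (le_trans (ler_normD _ _))// (splitr e) mulrDl lerD//.
  by move: Ds; near: s; exact: hy.
by move: Ds; near: s; exact: hz.
Unshelve. all: by end_near. Qed.

Lemma hderiv_comp_linear (E F : normedModType R) (f : {linear E -> F}) (M : R)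
    D (y : R -> E) t l :
  (forall x, `|f x| <= M * `|x|) -> hderiv D y t l -> hderiv D (f \o y) t (f l).
Proof.
move=> fM hy e e0.
have M0 : 0 < `|M| + 1 by rewrite ltr_pwDr.
have eM : 0 < e / (`|M| + 1) by rewrite divr_gt0.
near=> s => Ds /=; rewrite -linearZ -!linearB.
apply: (le_trans (fM _)); apply: (@le_trans _ _ ((`|M| + 1) * `|y s - y t - (s - t) *: l|)).
  by rewrite ler_wpM2r// (le_trans (ler_norm _))// lerDl.
rewrite mulrC -ler_pdivlMr// mulrAC.
by move: Ds; near: s; exact: hy.
Unshelve. all: by end_near. Qed.

Lemma hderivZ (E : normedModType R) (c : R) D (y : R -> E) t l :
  hderiv D y t l -> hderiv D (fun s => c *: y s) t (c *: l).
Proof.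
apply: (@hderiv_comp_linear _ _ (GRing.scale c) `|c|) => x.
by rewrite normrZ.
Qed.

Lemma hderivN (E : normedModType R) D (y : R -> E) t l :
  hderiv D y t l -> hderiv D (fun s => - y s) t (- l).
Proof.
by move=> /(hderivZ (-1)); rewrite scaleN1r; under eq_fun do rewrite scaleN1r.
Qed.

Lemma hderivB (E : normedModType R) D (y z : R -> E) t l m :
  hderiv D y t l -> hderiv D z t m -> hderiv D (fun s => y s - z s) t (l - m).
Proof. by move=> hy /hderivN; exact: hderivD. Qed.

(** The factor [c] may be negative: c = -1 reverses time, which is how y(t - s) becomes a wave in
    s. *)
Lemma hderiv_affine (E : normedModType R) D D' (y : R -> E) (a c : R) t l :
  (forall s, D' s -> D (a + c * s)) ->
  hderiv D y (a + c * t) l -> hderiv D' (fun s => y (a + c * s)) t (c *: l).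
Proof.
move=> DD hy e e0.
have c0 : 0 < `|c| + 1 by rewrite ltr_pwDr.
have ec : 0 < e / (`|c| + 1) by rewrite divr_gt0.
have cf : (a + c * s) @[s --> t] --> a + c * t.
  by apply: cvgD; [exact: cvg_cst|apply: cvgM; [exact: cvg_cst|exact: cvg_id]].
have := cf _ (hy _ ec); rewrite /= nbhs_simpl /=.
apply: filterS => s /= hs Ds; have := hs (DD _ Ds).
have -> : a + c * s - (a + c * t) = c * (s - t) by ring.
rewrite scalerA (mulrC (s - t)) => /le_trans; apply.
rewrite normrM mulrA ler_wpM2r// mulrAC ler_pdivrMr// ler_pM2l//.
by rewrite lerDl.
Qed.

Lemma hderiv_continuous (E : normedModType R) D (y : R -> E) t l :
  D t -> hderiv D y t l -> y @ within D (nbhs t) --> y t.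
Proof.
move=> Dt hy; apply/cvgrPdist_le => e e0.
have l0 : 0 < `|l| + 1 by rewrite ltr_pwDr.
suff : \forall s \near t, D s -> `|y t - y s| <= e by [].
near=> s => Ds.
have : `|s - t| <= e / (`|l| + 1).
  rewrite distrC; near: s; apply: (@cvgr_dist_le _ _ _ (nbhs t) _ id) => //.
  by rewrite divr_gt0.
rewrite ler_pdivlMr// => /(le_trans _); apply.
rewrite distrC (_ : y s - y t = (y s - y t - (s - t) *: l) + (s - t) *: l); last by rewrite subrK.
rewrite (le_trans (ler_normD _ _))// normrZ mulrDr addrC lerD2l mulrC.
by move: Ds; near: s; exact: hy.
Unshelve. all: by end_near. Qed.

Lemma hderiv_within_continuous (E : normedModType R) D (y l : R -> E) :
  (forall t, D t -> hderiv D y t (l t)) -> {within D, continuous y}.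
Proof.
by move=> hy; apply/subspace_continuousP => t Dt; exact: hderiv_continuous (hy t Dt).
Qed.

Lemma hderiv_is_derive D (y : R -> R) t l :
  nbhs t D -> hderiv D y t l -> is_derive t 1 y l.
Proof.
move=> nD hy.
suff h : ((fun h => h^-1 *: ((y \o shift t) (h *: 1) - y t)) @ 0^') --> l.
  split; first by apply/cvg_ex; exists l.
  exact: cvg_lim h.
apply/cvgrPdist_le => e e0.
suff : \forall h \near 0, h != 0 -> `|l - h^-1 *: ((y \o shift t) (h *: 1) - y t)| <= e by [].
have cf : (h + t) @[h --> (0 : R)] --> t.
  by rewrite -[X in _ --> X]add0r; apply: cvgD; [exact: cvg_id|exact: cvg_cst].
have H : \forall h \near (0 : R), D (h + t) /\
    (D (h + t) -> `|y (h + t) - y t - (h + t - t) *: l| <= e * `|h + t - t|).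
  exact: cf (filterI nD (hy _ e0)).
apply: filterS H => h /= [Dh /(_ Dh)]; rewrite addrK => hle h0.
rewrite /shift /= [h *: 1]mulr1.
rewrite -(ler_pM2l (_ : 0 < `|h|)) ?normr_gt0//.
rewrite -normrM mulrBr [h * (h^-1 *: _)]mulrA divff// mul1r distrC.
by rewrite (mulrC `|h|).
Qed.

Lemma is_derive_hderiv D (y : R -> R) t l : is_derive t 1 y l -> hderiv D y t l.
Proof.
move=> [dy <-] e e0.
have : ((fun h => h^-1 *: ((y \o shift t) (h *: 1) - y t)) @ 0^') --> 'D_1 y t by [].
move=> /cvgrPdist_le /(_ e e0) h2'.
have h2 : \forall h \near 0, h != 0 ->
    `|'D_1 y t - h^-1 *: ((y \o shift t) (h *: 1) - y t)| <= e by [].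
have cf : (s - t) @[s --> t] --> (0 : R).
  by rewrite -[X in _ --> X](subrr t); apply: cvgB; [exact: cvg_id|exact: cvg_cst].
have H : \forall s \near t, s - t != 0 -> `|'D_1 y t -
    (s - t)^-1 *: ((y \o shift t) ((s - t) *: 1) - y t)| <= e by exact: cf h2.
apply: filterS H => s /= hs _.
have [->|st] := eqVneq s t; first by rewrite !subrr scale0r subrr !normr0 mulr0.
have st0 : s - t != 0 by rewrite subr_eq0.
have := hs st0; rewrite /shift /= [(s - t) *: 1]mulr1 subrK.
rewrite -(ler_pM2l (_ : 0 < `|s - t|)) ?normr_gt0//.
rewrite -normrM mulrBr [(s - t) * (_ *: _)]mulrA divff// mul1r distrC.
by rewrite (mulrC `|s - t|).
Qed.

(** Taking a bare function [b] with its linearity as hypotheses lets one product rule serve the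
    inner product, the form [A1] and real multiplication. The increment splits into the remainder of
    [x], the increment of [z] against (s - t) x', and the remainder of [z], each given a third of
    the tolerance. *)
Lemma hderiv_bilinear (E F : normedModType R) (b : E -> F -> R) (C : R)
    (bl : forall x, linear (b x : F -> R^o)) (br : forall z, linear (b ^~ z : E -> R^o))
    (bC : forall x z, `|b x z| <= C * `|x| * `|z|)
    D (x : R -> E) (z : R -> F) t x' z' : D t ->
  hderiv D x t x' -> hderiv D z t z' ->
  hderiv D (fun s => b (x s) (z s)) t (b x' (z t) + b (x t) z').
Proof.
move=> Dt hx hz e e0.
have bDl p q r : b (p + q) r = b p r + b q r.
  by have := br r 1 p q; rewrite !scale1r.
have bDr p q r : b r (p + q) = b r p + b r q.
  by have := bl r 1 p q; rewrite !scale1r.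
have bZl c p r : b (c *: p) r = c * b p r.
  have b0 : b 0 r = 0 by apply/eqP; rewrite -normr_le0 (le_trans (bC _ _))// normr0 mulr0 mul0r.
  by have := br r c p 0; rewrite addr0 b0 addr0.
have bZr c p r : b r (c *: p) = c * b r p.
  have b0 : b r 0 = 0 by apply/eqP; rewrite -normr_le0 (le_trans (bC _ _))// normr0 mulr0.
  by have := bl r c p 0; rewrite addr0 b0 addr0.
have bNl p r : b (- p) r = - b p r by rewrite -scaleN1r bZl mulN1r.
have bNr p r : b r (- p) = - b r p by rewrite -scaleN1r bZr mulN1r.
have [C' C0 {}bC] : exists2 C', 0 < C' & forall x z, `|b x z| <= C' * `|x| * `|z|.
  exists (`|C| + 1); first by rewrite ltr_pwDr.
  move=> p q; apply: (le_trans (bC p q)).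
  by rewrite -!mulrA ler_wpM2r ?mulr_ge0// (le_trans (ler_norm _))// lerDl.
pose K1 := C' * (`|z t| + 1).
have K10 : 0 < K1 by rewrite mulr_gt0// ltr_pwDr.
pose K2 := C' * (`|x'| + 1).
have K20 : 0 < K2 by rewrite mulr_gt0// ltr_pwDr.
pose K3 := C' * (`|x t| + 1).
have K30 : 0 < K3 by rewrite mulr_gt0// ltr_pwDr.
have e3 : 0 < e / 3 by rewrite divr_gt0.
have /cvgrPdist_le cz := hderiv_continuous Dt hz.
have cz1 : \forall s \near t, D s -> `|z t - z s| <= 1 by exact: cz.
have cz2 : \forall s \near t, D s -> `|z t - z s| <= e / 3 / K2.
  by apply: cz; rewrite divr_gt0.
near=> s => Ds.
have -> : b (x s) (z s) - b (x t) (z t) - (s - t) *: (b x' (z t) + b (x t) z')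
  = b (x s - x t - (s - t) *: x') (z s) + (s - t) * b x' (z s - z t)
    + b (x t) (z s - z t - (s - t) *: z').
  by rewrite !bDl !bDr !bNl !bNr !bZl !bZr /GRing.scale /=; ring.
have -> : e * `|s - t| = e / 3 * `|s - t| + e / 3 * `|s - t| + e / 3 * `|s - t| by field.
have hzt : `|z t - z s| <= 1 by move: Ds; near: s; exact: cz1.
have hzs : `|z s| <= `|z t| + 1.
  by rewrite -[z s](subrK (z t)) (le_trans (ler_normD _ _))// addrC lerD2l distrC.
rewrite (le_trans (ler_normD _ _))// lerD//.
  rewrite (le_trans (ler_normD _ _))// lerD//.
  - apply: (le_trans (bC _ _)); rewrite mulrAC.
    apply: (@le_trans _ _ (K1 * `|x s - x t - (s - t) *: x'|)).
      by rewrite ler_wpM2r// ler_pM2l.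
    rewrite mulrC -ler_pdivlMr// mulrAC.
    by move: Ds; near: s; apply: hx; rewrite divr_gt0.
  - rewrite normrM mulrC ler_wpM2r// (le_trans (bC _ _))//.
    apply: (@le_trans _ _ (K2 * `|z s - z t|)).
      by rewrite ler_wpM2r// ler_pM2l// lerDl.
    rewrite mulrC -ler_pdivlMr// distrC.
    by move: Ds; near: s; exact: cz2.
apply: (le_trans (bC _ _)).
apply: (@le_trans _ _ (K3 * `|z s - z t - (s - t) *: z'|)).
  by rewrite ler_wpM2r// ler_pM2l// lerDl.
rewrite mulrC -ler_pdivlMr// mulrAC.
by move: Ds; near: s; apply: hz; rewrite divr_gt0.
Unshelve. all: by end_near. Qed.

Lemma itvoo_nbhs (a b t : R) : a < t < b -> nbhs t `[a, b]%classic.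
Proof.
move=> tab; have : t \in `]a, b[ by rewrite in_itv.
by move=> /near_in_itvoo; apply: filterS => s; exact: subset_itv_oo_cc.
Qed.

Lemma hderiv_le (a b : R) (q p q' p' : R -> R) : a <= b ->
  (forall t, a <= t <= b -> hderiv `[a, b] q t (q' t)) ->
  (forall t, a <= t <= b -> hderiv `[a, b] p t (p' t)) ->
  (forall t, a < t < b -> q' t <= p' t) ->
  q b - q a <= p b - p a.
Proof.
move=> ab hq hp le; pose r := fun s => p s - q s.
have hr t : a <= t <= b -> hderiv `[a, b] r t (p' t - q' t).
  by move=> tab; apply: hderivB; [exact: hp|exact: hq].
suff : r a <= r b by rewrite /r; lra.
have dr t : t \in `]a, b[ -> is_derive t 1 r (p' t - q' t).
  rewrite in_itv/= => /[dup] tab /andP[at_ tb].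
  apply: (@hderiv_is_derive `[a, b]%classic); last by apply: hr; rewrite (ltW at_) (ltW tb).
  exact: itvoo_nbhs tab.
move: ab; rewrite le_eqVlt => /predU1P[->//|ab].
have := @MVT R r (fun t => p' t - q' t) a b ab dr.
move=> [|c]; first by apply: hderiv_within_continuous => t; rewrite /= in_itv/=; exact: hr.
rewrite in_itv/= => /le le0 E; rewrite -subr_ge0 E mulr_ge0// subr_ge0//.
exact: ltW.
Qed.

Lemma hderiv_norm_le (a b : R) (q p q' p' : R -> R) : a <= b ->
  (forall t, a <= t <= b -> hderiv `[a, b] q t (q' t)) ->
  (forall t, a <= t <= b -> hderiv `[a, b] p t (p' t)) ->
  (forall t, a < t < b -> `|q' t| <= p' t) ->
  `|q b - q a| <= p b - p a.
Proof.
move=> ab hq hp le; rewrite ler_norml; apply/andP; split.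
  rewrite lerNl opprB addrC -(opprK (q a)).
  apply: (@hderiv_le a b (fun s => - q s) p (fun s => - q' s) p') => //.
    by move=> t /hq; exact: hderivN.
  by move=> t /le; rewrite ler_norml => /andP[]; rewrite lerNl.
apply: hderiv_le hq hp _ => // t /le; exact/le_trans/ler_norm.
Qed.

End hderiv_theory.

(** * Hilbert spaces *)

Section hilbert.
Context {R : realType} {E : completeNormedModType R}.
Variable dot : {dot E for (@idfun R)}.
Hypothesis hil : hilbert_dot dot.

Lemma dotC u v : dot u v = dot v u.
Proof. by rewrite (@hermC _ _ _ _ dot) expr0 mul1r. Qed.

Lemma dot_linear u : linear (dot u : E -> R^o).
Proof. by move=> c v w; rewrite linearPr. Qed.

Lemma dot_linearl v : linear (dot ^~ v : E -> R^o).
Proof. by move=> c u w; rewrite linearPl. Qed.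

Lemma dotDl u v w : dot (u + v) w = dot u w + dot v w.
Proof. by rewrite linearDl. Qed.

Lemma dotZl c u w : dot (c *: u) w = c * dot u w.
Proof. by rewrite linearZl_LR. Qed.

Lemma dotNl u w : dot (- u) w = - dot u w.
Proof. by rewrite linearNl. Qed.

Lemma dotDr u v w : dot w (u + v) = dot w u + dot w v.
Proof. by rewrite linearDr. Qed.

Lemma dotZr c u w : dot w (c *: u) = c * dot w u.
Proof. by rewrite dotC dotZl dotC. Qed.

Lemma dotNr u w : dot w (- u) = - dot w u.
Proof. by rewrite linearNr. Qed.

Lemma dot_cauchy_schwarz u v : `|dot u v| <= `|u| * `|v|.
Proof.
have [->|u0] := eqVneq u 0; first by rewrite linear0l !normr0 mul0r.
have [->|v0] := eqVneq v 0; first by rewrite linear0r !normr0 mulr0.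
have a0 : 0 < `|u| by rewrite normr_gt0.
have b0 : 0 < `|v| by rewrite normr_gt0.
(* The squared norm of |v| u + s |u| v is 2 |u| |v| (|u| |v| + s dot u v). *)
have h (s : R) : s ^+ 2 = 1 -> 0 <= `|u| * `|v| + s * dot u v.
  move=> s1; have : 0 <= `|(`|v| *: u + (s * `|u|) *: v)| ^+ 2 by rewrite sqr_ge0.
  rewrite -hil !dotDl !dotDr !dotZl !dotZr (dotC v u) !hil => h.
  have e : (s ^+ 2 - 1) * (`|u| * `|v|) ^+ 2 = 0 by rewrite s1 subrr mul0r.
  rewrite -(pmulr_rge0 _ (_ : 0 < `|u| * `|v|)) ?mulr_gt0//.
  by lra.
rewrite ler_norml; apply/andP; split.
  by have := h 1 (expr1n _ _); rewrite mul1r; lra.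
by have := h (-1); rewrite sqrrN expr1n mulN1r => /(_ erefl); lra.
Qed.

(** Used to bound a vector by pairing it with itself: [|u| ^+ 2] is [dot u u], a scalar to which
    mean value estimates apply. *)
Lemma dot_self_le (u : E) (M : R) : `|u| ^+ 2 <= M * `|u| -> 0 <= M -> `|u| <= M.
Proof.
move=> h M0; have [->//|u0] := eqVneq `|u| 0.
by move: h; rewrite expr2 ler_pM2r// lt_neqAle eq_sym u0 normr_ge0.
Qed.

Lemma parallelogram (u v : E) :
  `|u - v| ^+ 2 + `|u + v| ^+ 2 = 2 * `|u| ^+ 2 + 2 * `|v| ^+ 2.
Proof. by rewrite -!hil !dotDl !dotDr !dotNl !dotNr; ring. Qed.

(* The minimizer of [|w|^2 - 2 phi w] represents [phi]. *)
Lemma riesz_representation (phi : {linear E -> R^o}) (M : R) :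
  (forall w, `|phi w| <= M * `|w|) -> exists z, forall w, dot z w = phi w.
Proof.
move=> phiM; pose J w := `|w| ^+ 2 - 2 * phi w.
have Jge w : - M ^+ 2 <= J w.
  have := phiM w; rewrite /J ler_norml => /andP[_ h].
  by have := sqr_ge0 (`|w| - M); lra.
have hinf : has_inf (range J).
  split; first by exists (J 0), 0.
  by exists (- M ^+ 2) => _ [w _ <-].
pose m := inf (range J).
have mJ w : m <= J w by apply: ge_inf; [case: hinf|exists w].
have /choice[w_ hw] (n : nat) : exists w, J w <= m + n.+1%:R^-1.
  have /inf_adherent/(_ hinf)[_ [w _ <-] /ltW h] : 0 < n.+1%:R^-1 :> R by [].
  by exists w.
(* The midpoint of [w_ n] and [w_ k] cannot go below the infimum, so the parallelogram identity
   forces the two points together: the minimizing sequence is Cauchy. *)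
have diff n k : `|w_ n - w_ k| ^+ 2 <= 2 * n.+1%:R^-1 + 2 * k.+1%:R^-1.
  have := parallelogram (w_ n) (w_ k).
  have := mJ (2^-1 *: (w_ n + w_ k)); have := hw n; have := hw k.
  rewrite /J normrZ ger0_norm ?invr_ge0// exprMn.
  have -> : phi (2^-1 *: (w_ n + w_ k)) = 2^-1 * (phi (w_ n) + phi (w_ k)).
    by rewrite linearZ linearD.
  have aux (p q x y m' a b d s : R) : y - 2 * q <= m' + b -> x - 2 * p <= m' + a ->
      m' <= 2^-1 ^+ 2 * s - 2 * (2^-1 * (p + q)) -> d + s = 2 * x + 2 * y ->
      d <= 2 * a + 2 * b by lra.
  exact: aux.
have cw : cvgn w_.
  apply: cauchy_cvg; apply: cauchy_exP => e e0.
  have e2 : 0 < e ^+ 2 / 5 by rewrite divr_gt0// exprn_gt0.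
  have [N _ hN] : \forall n \near \oo, n.+1%:R^-1 <= e ^+ 2 / 5 :> R.
    near=> n; rewrite -[leRHS]invrK lef_pV2 ?posrE ?invr_gt0//.
    apply: le_trans (_ : n%:R <= _); last by rewrite ler_nat.
    near: n; exact: nbhs_infty_ger.
  exists (w_ N); exists N => // k /= Nk; rewrite -ball_normE /=.
  rewrite -ltr_sqr ?nnegrE// ?(ltW e0)//.
  apply: le_lt_trans (diff N k) _.
  have := hN _ (leqnn N); have := hN _ Nk; move=> /= h1 h2.
  have aux (a b c : R) : 0 < c -> a <= c / 5 -> b <= c / 5 -> 2 * b + 2 * a < c by lra.
  by apply: aux h1 h2; rewrite exprn_gt0.
have {}cw : w_ @ \oo --> lim (w_ @ \oo) by [].
set z := lim _ in cw.
have Jz : J z <= m.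
  have cphi : phi (w_ n) @[n --> \oo] --> phi z.
    apply/cvgrPdist_le => e e0; near=> n; rewrite -linearB.
    apply: (le_trans (phiM _)).
    have M1 : 0 < `|M| + 1 by rewrite ltr_pwDr.
    apply: (@le_trans _ _ ((`|M| + 1) * `|z - w_ n|)).
      by rewrite ler_wpM2r// (le_trans (ler_norm _))// lerDl.
    rewrite mulrC -ler_pdivlMr//; near: n.
    by move/cvgrPdist_le : cw; apply; rewrite divr_gt0.
  have cJ : J (w_ n) @[n --> \oo] --> J z.
    apply: cvgB; last by apply: cvgM; [exact: cvg_cst|exact: cphi].
    by apply: cvgM; apply: cvg_norm.
  have cm : (m + n.+1%:R^-1) @[n --> \oo] --> m.
    rewrite -[X in _ --> X]addr0; apply: cvgD; first exact: cvg_cst.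
    exact: cvg_harmonic.
  by apply: (ler_cvg_to cJ cm); near=> n; exact: hw.
exists z => w; apply/eqP; rewrite -subr_eq0; apply/eqP.
set a := dot z w - phi w.
have key (t : R) : 0 <= 2 * t * a + t ^+ 2 * `|w| ^+ 2.
  have := mJ (z + t *: w); move: Jz; rewrite /J -!hil !dotDl !dotDr !dotZl !dotZr.
  have -> : phi (z + t *: w) = phi z + t * phi w by rewrite linearD linearZ.
  rewrite (dotC w z) /a.
  by lra.
(* The quadratic in [t] is nonnegative everywhere; at t = -a / c it equals -a^2 (c + 1) / c^2, which
   forces a = 0. The added 1 keeps [c] positive when w = 0. *)
pose c := `|w| ^+ 2 + 1.
have c0 : 0 < c by rewrite ltr_pwDr// sqr_ge0.
have := key (- a / c).
have -> : 2 * (- a / c) * a + (- a / c) ^+ 2 * `|w| ^+ 2 = - (a ^+ 2 * (c + 1) / c ^+ 2).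
  by rewrite /c; field; rewrite gt_eqF.
have c10 : 0 < c + 1 by rewrite ltr_wpDr.
rewrite oppr_ge0 pmulr_lle0 ?invr_gt0 ?exprn_gt0// (pmulr_lle0 _ c10) => h.
by apply/eqP; rewrite -sqrf_eq0 eq_le h sqr_ge0.
Unshelve. all: by end_near. Qed.

End hilbert.

(** * Antiderivatives of scalar and of Hilbert-valued continuous functions *)

Section antiderivative.
Context {R : realType}.

(** Retraction of the line onto [a, b]: composing with it extends a function continuous on the
    interval to one continuous everywhere and constant beyond the ends. *)
Definition clamp (a b x : R) : R := Num.max a (Num.min x b).

Lemma clamp_itv (a b x : R) : a <= b -> a <= clamp a b x <= b.
Proof. by move=> ab; rewrite /clamp le_max lexx/= ge_max ab ge_min lexx orbT. Qed.

Lemma clamp_id (a b x : R) : a <= x <= b -> clamp a b x = x.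
Proof. by move=> /andP[ax xb]; rewrite /clamp min_l// max_r. Qed.

Lemma continuous_clamp (a b : R) : continuous (clamp a b).
Proof.
move=> x; apply: (@continuous_max _ _ (cst a) (fun x => Num.min x b)).
  exact: cvg_cst.
by apply: continuous_min; [exact: cvg_id|exact: cvg_cst].
Qed.

Lemma continuous_comp_clamp (T : topologicalType) (a b : R) (h : R -> T) : a <= b ->
  {within `[a, b], continuous h} -> continuous (h \o clamp a b).
Proof.
move=> ab /subspace_continuousP ch x.
have Dx : `[a, b]%classic (clamp a b x) by rewrite /= in_itv/= clamp_itv.
apply: (cvg_comp _ _ _ (ch _ Dx)) => P.
have := @continuous_clamp a b x; rewrite /continuous_at => cc.
move=> /(cc _) H.
have {}H : \forall s \near x, `[a, b]%classic (clamp a b s) -> P (clamp a b s) by exact: H.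
by apply: filterS H => s; apply; rewrite /= in_itv/= clamp_itv.
Qed.

Lemma within_antiderivative (a b : R) (h : R -> R) : a <= b ->
  {within `[a, b], continuous h} ->
  exists H : R -> R, forall t, a <= t <= b -> hderiv `[a, b] H t (h t).
Proof.
move=> ab ch; pose k := h \o clamp a b.
have ck : continuous k by exact: continuous_comp_clamp.
(* Starting at a - 1, with integrability up to b + 1, makes both end points interior, so the
   fundamental theorem of calculus applies there too. *)
pose H x := (\int[lebesgue_measure]_(t in `[a - 1, x]) k t)%R.
exists H => t tab; rewrite -(clamp_id tab) -[h _]/(k t) clamp_id//.
apply: is_derive_hderiv; case/andP: (tab) => at_ tb.
have ik : lebesgue_measure.-integrable `[a - 1, b + 1] (EFin \o k).
  apply: continuous_compact_integrable; first exact: segment_compact.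
  exact: continuous_subspaceT.
have tb1 : t < b + 1 by rewrite (le_lt_trans tb)// ltrDl.
have at1 : a - 1 < t by rewrite (lt_le_trans _ at_)// ltrBlDr ltrDl.
have [dH Hk] := continuous_FTC1_closed tb1 ik at1 (ck t).
by split; [exact: dH|rewrite -derive1E; exact: Hk].
Qed.

End antiderivative.

Section hilbert_antiderivative.
Context {R : realType} {E : completeNormedModType R}.
Variable dot : {dot E for (@idfun R)}.
Hypothesis hil : hilbert_dot dot.

Lemma hderiv_dotl D (y : R -> E) t l (w : E) :
  hderiv D y t l -> hderiv D (fun s => dot (y s) w) t (dot l w).
Proof.
have lw : linear (dot ^~ w : E -> R^o) by exact: dot_linearl.
pose f := GRing.isLinear.Build R E R^o *:%R (dot ^~ w) lw.
pose F : {linear E -> R^o} := HB.pack (dot ^~ w : E -> R^o) f.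
apply: (@hderiv_comp_linear _ _ _ F `|w|) => x.
by rewrite mulrC; exact: dot_cauchy_schwarz.
Qed.

(** The integral of [y] is obtained weakly: for each [w], dot (y t) w has a scalar antiderivative
    whose increment from [a] is a bounded functional of [w], represented by z t through Riesz. The
    estimate of the remainder against [w] is uniform up to the factor |w|, which makes [z]
    differentiable in norm. *)
Lemma hilbert_antiderivative (a b : R) (y : R -> E) : a <= b ->
  {within `[a, b], continuous y} ->
  exists z : R -> E, z a = 0 /\
    forall t, a <= t <= b -> hderiv `[a, b] z t (y t).
Proof.
move=> ab cy; have cy' := cy; move/subspace_continuousP : cy' => cy'.
have cw w : {within `[a, b], continuous (fun t => dot (y t) w)}.
  apply/subspace_continuousP => t tab.
  apply/cvgrPdist_le => e e0.
  have w1 : 0 < `|w| + 1 by rewrite ltr_pwDr.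
  move/cvgrPdist_le : (cy' t tab) => /(_ _ (divr_gt0 e0 w1)).
  apply: filterS => s hs.
  rewrite -dotNl -dotDl (le_trans (dot_cauchy_schwarz hil _ _))//.
  apply: (@le_trans _ _ (`|y t - y s| * (`|w| + 1))); first by rewrite ler_wpM2l// lerDl.
  by rewrite -ler_pdivlMr.
have [M hM] : exists M, forall t, a <= t <= b -> `|y t| <= M.
  have [|c cab hc] := @EVT_max R (fun t => `|y t|) a b ab.
    apply/subspace_continuousP => t tab; exact: cvg_norm (cy' t tab).
  by exists `|y c| => t tab; apply: hc; rewrite in_itv.
have /choice[Th hTh] w := within_antiderivative ab (cw w).
have sub c d s : a <= c -> d <= b -> `[c, d]%classic s -> `[a, b]%classic s.
  move=> ac db; rewrite /= !in_itv/= => /andP[cs sd].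
  by rewrite (le_trans ac cs) (le_trans sd db).
have diff c d (q q' p p' : R -> R) : a <= c -> c <= d -> d <= b ->
    (forall t, a <= t <= b -> hderiv `[a, b] q t (q' t)) ->
    (forall t, a <= t <= b -> hderiv `[a, b] p t (p' t)) ->
    (forall t, c <= t <= d -> `|q' t| <= p' t) -> `|q d - q c| <= p d - p c.
  move=> ac cd db hq hp le.
  have ss t : c <= t <= d -> a <= t <= b.
    by move=> /andP[ct td]; rewrite (le_trans ac ct) (le_trans td db).
  apply: (@hderiv_norm_le _ c d q p q' p' cd).
  - by move=> t /ss /hq; apply: hderivS => s; exact: sub.
  - by move=> t /ss /hp; apply: hderivS => s; exact: sub.
  - by move=> t /andP[ct td]; apply: le; rewrite (ltW ct) (ltW td).
have hid (c : R) (t : R) : hderiv `[a, b] (fun s => c * s) t c.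
  apply: is_derive_hderiv.
  have := @is_deriveZ _ _ _ id c t 1 1 (is_derive_id _ _).
  by rewrite [X in is_derive _ _ _ X]mulr1.
have /choice[z hz] (t : R) : exists z, a <= t <= b -> forall w, dot z w = Th w t - Th w a.
  have [tab|] := boolP (a <= t <= b); last by exists 0.
  case/andP: (tab) => at_ tb.
  (* Each [Th w] is chosen independently and fixed only up to a constant; the increment from [a]
     removes the constant, and linearity follows because the defect has derivative zero. *)
  have lphi : linear (fun w => Th w t - Th w a : R^o).
    move=> c u v.
    have := @diff a t (fun s => Th (c *: u + v) s - (c *: Th u s + Th v s))
      (fun s => dot (y s) (c *: u + v) - (c *: dot (y s) u + dot (y s) v))
      (fun s => 0 * s) (fun s => 0) (lexx a) at_ tb.
    rewrite !mul0r subrr normr_le0 => h.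
    have /eqP : Th (c *: u + v) t - (c *: Th u t + Th v t) -
        (Th (c *: u + v) a - (c *: Th u a + Th v a)) == 0.
      apply: h => [s sab|s sab|s sat].
      - by apply: hderivB; [exact: hTh|apply: hderivD; [apply: hderivZ|]; exact: hTh].
      - exact: hid.
      - by rewrite dotDr dotZr subrr normr0.
    by rewrite /GRing.scale /= => h2; lra.
  pose f := GRing.isLinear.Build R E R^o *:%R (fun w => Th w t - Th w a : R^o) lphi.
  pose F : {linear E -> R^o} := HB.pack (fun w => Th w t - Th w a : R^o) f.
  have [|z hz] := @riesz_representation _ _ _ hil F (M * (t - a)); last by exists z.
  move=> w; have := @diff a t (Th w) (fun s => dot (y s) w) (fun s => M * `|w| * s)
    (fun=> M * `|w|) (lexx a) at_ tb (hTh w).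
  rewrite -mulrBr mulrAC; apply=> [s _|s sat]; first exact: hid.
  rewrite (le_trans (dot_cauchy_schwarz hil _ _))// ler_wpM2r// hM//.
  by case/andP: sat => -> /le_trans->.
exists z; split.
  have aab : a <= a <= b by rewrite lexx.
  by apply/eqP; rewrite -normr_eq0 -sqrf_eq0 -hil (hz _ aab) subrr.
move=> t tab e e0.
have Dt : `[a, b]%classic t by rewrite /= in_itv.
move/cvgrPdist_le : (cy' t Dt) => /(_ _ e0) hc.
have {hc}[d /= d0 hd] : nbhs t [set s | `[a, b]%classic s -> `|y t - y s| <= e] by exact: hc.
near=> s => Ds.
have sab : a <= s <= b by move: Ds; rewrite /= in_itv.
have tsd : `|t - s| < d.
  by near: s; exact: (@cvgr_dist_lt _ _ _ (nbhs t) _ id).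
(* The remainder is tested against itself, [w] being frozen while the scalar mean value estimate
   runs between [s] and [t]. *)
set w := z s - z t - _.
apply: dot_self_le; last by rewrite mulr_ge0// ltW.
rewrite -hil {1}/w !dotDl !dotNl dotZl (hz _ sab) (hz _ tab) opprB addrA subrK.
have bnd r : Num.min s t <= r <= Num.max s t -> `|dot (y r) w - dot (y t) w| <= e * `|w|.
  move=> /andP[h1 h2].
  have rt : `|t - r| < d.
    apply: le_lt_trans tsd.
    case: (leP s t) h1 h2 => st h1 h2.
      by rewrite !ger0_norm; lra.
    by rewrite !ler0_norm; lra.
  rewrite -dotNl -dotDl (le_trans (dot_cauchy_schwarz hil _ _))// ler_wpM2r//.
  rewrite distrC; apply: (hd r).
    exact: rt.
  rewrite /= in_itv/=; case/andP: sab tab => ? ? /andP[? ?].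
  by case: (leP s t) h1 h2 => st h1 h2; lra.
have hq r : a <= r <= b -> hderiv `[a, b] (fun r => Th w r - dot (y t) w * r) r
    (dot (y r) w - dot (y t) w).
  by move=> rab; apply: hderivB; [exact: hTh|exact: hid].
case/andP: (sab) (tab) => as_ sb /andP[at_ tb].
apply: (le_trans (ler_norm _)).
case: (leP s t) bnd => st bnd.
- have := @diff s t _ _ _ _ as_ st tb hq (fun r _ => hid (e * `|w|) r) bnd.
  rewrite (ler0_norm (_ : s - t <= 0)) ?subr_le0// => h.
  rewrite (_ : _ - _ = - (Th w t - dot (y t) w * t - (Th w s - dot (y t) w * s))); last by ring.
  rewrite normrN; apply: (le_trans h); rewrite le_eqVlt; apply/orP; left; apply/eqP; ring.
- have := @diff t s _ _ _ _ at_ (ltW st) sb hq (fun r _ => hid (e * `|w|) r) bnd.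
  rewrite (ger0_norm (_ : 0 <= s - t)) ?subr_ge0 ?(ltW st)// => h.
  rewrite (_ : _ - _ = (Th w s - dot (y t) w * s - (Th w t - dot (y t) w * t))); last by ring.
  by apply: (le_trans h); rewrite le_eqVlt; apply/orP; left; apply/eqP; ring.
Unshelve. all: by end_near. Qed.

End hilbert_antiderivative.

(** * Energy estimate for weak waves *)

Section hderiv_scalar.
Context {R : realType}.
Implicit Types (D : set R) (t : R).

Lemma hderiv_comp D (phi y : R -> R) t l m : D t ->
  is_derive (y t) 1 phi m -> hderiv D y t l ->
  hderiv D (fun s => phi (y s)) t (m * l).
Proof.
move=> Dt /(is_derive_hderiv setT) hphi hy e e0.
have l1 : 0 < `|l| + 1 by rewrite ltr_pwDr.
have m1 : 0 < `|m| + 1 by rewrite ltr_pwDr.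
have e1 : 0 < e / 2 / (`|l| + 1) by rewrite !divr_gt0.
have e2 : 0 < e / 2 / (`|m| + 1) by rewrite !divr_gt0.
have cy := hderiv_continuous Dt hy.
have H : \forall s \near t, D s -> setT (y s) -> `|phi (y s) - phi (y t) - (y s - y t) *: m|
    <= e / 2 / (`|l| + 1) * `|y s - y t|.
  exact: (cy _ (hphi _ e1)).
have H1 := hy _ ltr01; have H2 := hy _ e2.
near=> s => Ds.
have h0 : `|phi (y s) - phi (y t) - (y s - y t) * m|
    <= e / 2 / (`|l| + 1) * `|y s - y t| by move: (I); move: Ds; near: s; exact: H.
have h1 : `|y s - y t - (s - t) * l| <= 1 * `|s - t| by move: Ds; near: s; exact: H1.
have h2 : `|y s - y t - (s - t) * l| <= e / 2 / (`|m| + 1) * `|s - t|.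
  by move: Ds; near: s; exact: H2.
rewrite /GRing.scale /=.
rewrite (_ : _ - _ = (phi (y s) - phi (y t) - (y s - y t) * m) +
    m * (y s - y t - (s - t) * l)); last by ring.
rewrite [leRHS](_ : _ = e / 2 * `|s - t| + e / 2 * `|s - t|); last by rewrite -mulrDl -splitr.
rewrite (le_trans (ler_normD _ _))// lerD//.
  apply: (le_trans h0); rewrite mulrAC ler_pdivrMr// -[leRHS]mulrA ler_pM2l ?divr_gt0//.
  rewrite -[y s - y t](subrK ((s - t) * l)) (le_trans (ler_normD _ _))// normrM.
  by rewrite mulrDr mulr1 addrC lerD2l -[leRHS]mul1r.
rewrite normrM; apply: (@le_trans _ _ ((`|m| + 1) * `|y s - y t - (s - t) * l|)).
  by rewrite ler_wpM2r// lerDl.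
by rewrite mulrC -ler_pdivlMr// mulrAC.
Unshelve. all: by end_near. Qed.

Lemma hderivM D (x y : R -> R) t l m : D t ->
  hderiv D x t l -> hderiv D y t m ->
  hderiv D (fun s => x s * y s) t (l * y t + x t * m).
Proof.
move=> Dt; apply: (@hderiv_bilinear _ _ _ (fun a b : R => a * b) 1) => //.
- by move=> a c u v; rewrite /GRing.scale /=; ring.
- by move=> a c u v; rewrite /GRing.scale /=; ring.
- by move=> a b; rewrite mul1r normrM.
Qed.

Lemma hderivX D t n : hderiv D (fun s => s ^+ n.+1) t (n.+1%:R * t ^+ n).
Proof.
apply: is_derive_hderiv; split; first exact: exprn_derivable.
by rewrite exp_derive /= /GRing.scale /= mulr1.
Qed.

Lemma hderiv_id D t : hderiv D id t 1.
Proof. exact: is_derive_hderiv. Qed.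

Lemma hderivMl D (c : R) y t l : hderiv D y t l -> hderiv D (fun s => c * y s) t (c * l).
Proof. exact: hderivZ. Qed.

(** Its use is with F v = B v q: a curve that starts in the kernel of [B] and has its derivative
    there never leaves it. *)
Lemma hderiv_constant (E : normedModType R) (a b t : R) (y : R -> E) (F : E -> R) (C : R) :
  linear (F : E -> R^o) -> (forall x, `|F x| <= C * `|x|) ->
  forall y', (forall t, a <= t <= b -> hderiv `[a, b] y t (y' t)) ->
  (forall t, a <= t <= b -> F (y' t) = 0) -> a <= t <= b -> F (y t) = F (y a).
Proof.
move=> lF FC y' hy Fy' /andP[at_ tb].
pose f := GRing.isLinear.Build R E R^o *:%R F lF.
pose G : {linear E -> R^o} := HB.pack (F : E -> R^o) f.
have sub s : a <= s <= t -> a <= s <= b by move=> /andP[-> /le_trans->].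
have := @hderiv_norm_le _ a t (F \o y) (fun=> 0 : R) (F \o y') (fun=> 0) at_.
rewrite subrr normr_le0 subr_eq0 => h; apply/eqP/h.
- move=> s /sub /hy /(hderiv_comp_linear (f := G) FC).
  apply: hderivS => r; rewrite /= !in_itv/=; exact: sub.
- by move=> s _; exact: hderiv_cst.
- by move=> s /andP[/ltW as_ /ltW st]; rewrite /= Fy' ?normr0// sub// as_.
Qed.

End hderiv_scalar.

Lemma continuous_linear_bounded (R : realType) (E F : normedModType R)
    (f : {linear E -> F}) : continuous f -> exists2 C, 0 <= C & forall x, `|f x| <= C * `|x|.
Proof.
move=> /linear_bounded_continuous/linear_boundedP[M [_ hM]].
exists (`|M| + 1); first by rewrite addr_ge0.
by apply: hM; rewrite (le_lt_trans (ler_norm _))// ltrDl.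
Qed.

Section wave.
Context {R : realType} {V H Q : completeNormedModType R}.
Variables (dotV : {dot V for (@idfun R)}) (dotH : {dot H for (@idfun R)}).
Hypotheses (hilV : hilbert_dot dotV) (hilH : hilbert_dot dotH).
Variables (j : {linear V -> H}) (CVH : R).
Hypothesis hCVH : forall v, `|j v| <= CVH * `|v|.
Variables (B : {linear V -> dual Q}) (A A1 : {linear V -> dual V}) (A2 : {linear V -> H}).
Hypotheses (contB : continuous B) (contA : continuous A).
Hypothesis splitA : forall v w, A v w = A1 v w + dotH (A2 v) (j w).
Hypothesis symA1 : forall v w, Vker B v -> Vker B w -> A1 v w = A1 w v.
Variables (mu1 C2 : R).
Hypotheses (mu10 : 0 < mu1) (ellA1 : elliptic_on_Vker B mu1 A1).
Hypotheses (C20 : 0 <= C2) (hC2 : forall v, `|A2 v| <= C2 * `|v|).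
Let kappa := C2 / Num.sqrt mu1.

(* [y] solves [y'' + A_ker y = F] on [0, tau] in the dual of [V_ker]; [yp] is
   the derivative of [y] in [H]. *)
Definition weak_wave (tau : R) (y : R -> V) (yp F : R -> H) : Prop :=
  [/\ {within `[0, tau], continuous y},
      forall t, 0 <= t <= tau -> Vker B (y t),
      forall t, 0 <= t <= tau -> hderiv `[0, tau] (j \o y) t (yp t) &
      forall t w, 0 <= t <= tau -> Vker B w ->
        hderiv `[0, tau] (fun s => dotH (yp s) (j w)) t
          (- A (y t) w + dotH (F t) (j w))].

Lemma A_bounded : exists2 CA, 0 <= CA & forall v w, `|A v w| <= CA * `|v| * `|w|.
Proof.
have [CA CA0 hA] := continuous_linear_bounded contA.
exists CA => // v w; apply: (le_trans (dual_pairing_le _ _)).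
exact: (ler_wpM2r (normr_ge0 w) (hA v)).
Qed.

Lemma B_bounded : exists2 CB, 0 <= CB & forall v q, `|B v q| <= CB * `|v| * `|q|.
Proof.
have [CB CB0 hB] := continuous_linear_bounded contB.
exists CB => // v w; apply: (le_trans (dual_pairing_le _ _)).
exact: (ler_wpM2r (normr_ge0 w) (hB v)).
Qed.

(** Boundedness of [A1] comes from writing it as [A] minus the [A2] term, both of which are
    bounded. *)
Lemma A1_bounded : exists C, forall v w, `|A1 v w| <= C * `|v| * `|w|.
Proof.
have [CA CA0 hA] := A_bounded.
exists (CA + C2 * CVH) => v w.
have -> : A1 v w = A v w - dotH (A2 v) (j w) by rewrite splitA addrK.
rewrite (le_trans (ler_normB _ _))// !mulrDl lerD//.
apply: (le_trans (dot_cauchy_schwarz hilH _ _)).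
apply: (le_trans (ler_pM _ _ (hC2 v) (hCVH w))) => //.
by rewrite mulrACA mulrA.
Qed.

(* For the antiderivative [z] of [y], the energy [|z'|^2 + <A1 z, z>] is
   differentiable although [y] itself is only a weak solution. *)
Lemma wave_energy (tau : R) (y : R -> V) (yp F : R -> H) (al be : R) :
  0 <= tau -> weak_wave tau y yp F -> yp 0 = 0 -> 0 <= al -> 0 <= be ->
  (forall s, 0 < s < tau -> `|F s| <= al + be * s ^+ 2) ->
  `|j (y tau)| <= expR (kappa / 2 * tau) *
    (`|j (y 0)| + (al * tau ^+ 2 / 2 + be * tau ^+ 4 / 12)).
Proof.
move=> tau0 [cy ky dy wy] yp0 al0 be0 FF.
have [z [z0 hz]] := hilbert_antiderivative hilV tau0 cy.
have [CA CA0 hA] := A_bounded.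
have [CB CB0 hB] := B_bounded.
have [C1 hA1] := A1_bounded.
have t00 : 0 <= (0 : R) <= tau by rewrite lexx.
have Al w : linear (fun v => A v w : R^o).
  by move=> c u v; rewrite linearP.
have Bl q : linear (fun v => B v q : R^o).
  by move=> c u v; rewrite linearP.
have A1l w : linear (fun v => A1 v w : R^o).
  by move=> c u v; rewrite linearP.
have kz t : 0 <= t <= tau -> Vker B (z t).
  move=> t0t; apply/val_inj/funext => q /=.
  rewrite (@hderiv_constant _ _ 0 tau t z (fun v => B v q) (CB * `|q|) _ _ y)//.
  - by rewrite z0 linear0.
  - by move=> x; rewrite mulrAC.
  - by move=> s s0t; rewrite (ky _ s0t).
(* The equation integrated once in time: [p w] is an antiderivative of dot (F t) (j w) and vanishes
   at 0 because [yp 0] and [z 0] do. Hence it is bounded by Phi t |j w|, which involves only the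
   norm of [H]. *)
pose p w t := dotH (yp t) (j w) + A (z t) w.
pose Phi t := al * t + be / 3 * t ^+ 3.
have hPhi D t : hderiv D Phi t (al + be * t ^+ 2).
  rewrite (_ : al + _ = al * 1 + be / 3 * (3%:R * t ^+ 2)); last by field.
  by apply: hderivD; apply: hderivMl; [exact: hderiv_id|exact: hderivX].
have hp w t : Vker B w -> 0 <= t <= tau -> hderiv `[0, tau] (p w) t (dotH (F t) (j w)).
  move=> kw t0t; rewrite (_ : dotH (F t) _ = - A (y t) w + dotH (F t) (j w) + A (y t) w).
    apply: hderivD; first exact: wy.
    pose f := GRing.isLinear.Build R V R^o *:%R (fun v => A v w : R^o) (Al w).
    pose G : {linear V -> R^o} := HB.pack (fun v => A v w : R^o) f.
    apply: (@hderiv_comp_linear _ _ _ G (CA * `|w|)); last exact: hz.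
    by move=> x; rewrite mulrAC; exact: hA.
  by rewrite addrAC addNr add0r.
have Phi0 : Phi 0 = 0 by rewrite /Phi expr0n /= !mulr0 addr0.
have bp w t : Vker B w -> 0 <= t <= tau -> `|p w t| <= Phi t * `|j w|.
  move=> kw /andP[t0 tt].
  have sub s : 0 <= s <= t -> 0 <= s <= tau by move=> /andP[-> /le_trans->].
  have := @hderiv_norm_le _ 0 t (p w) (fun s => `|j w| * Phi s)
    (fun s => dotH (F s) (j w)) (fun s => `|j w| * (al + be * s ^+ 2)) t0.
  have -> : p w 0 = 0 by rewrite /p yp0 z0 linear0l linear0 add0r.
  rewrite Phi0 mulr0 !subr0 mulrC; apply.
  - move=> s s0t; apply: hderivS (hp w s kw (sub _ s0t)) => r; rewrite /= !in_itv/=; exact: sub.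
  - by move=> s s0t; apply: hderivMl; exact: hPhi.
  - move=> s /andP[s0 st]; rewrite (le_trans (dot_cauchy_schwarz hilH _ _))// mulrC ler_wpM2l//.
    by apply: FF; rewrite s0 (lt_le_trans st).
pose N t := dotH (j (y t)) (j (y t)) + A1 (z t) (z t).
(* With w = y t, the velocity term 2 dot (yp t) (j (y t)) is 2 p minus 2 A z y. By symmetry of [A1]
   its share cancels against the derivative of A1 z z, and only the [A2] term is left. *)
pose N' t := 2 * p (y t) t - 2 * dotH (A2 (z t)) (j (y t)).
have hN t : 0 <= t <= tau -> hderiv `[0, tau] N t (N' t).
  move=> t0t.
  have Dt : `[0, tau]%classic t by rewrite /= in_itv.
  have -> : N' t = (dotH (yp t) (j (y t)) + dotH (j (y t)) (yp t)) +
      (A1 (y t) (z t) + A1 (z t) (y t)).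
    rewrite /N' /p splitA (symA1 (ky _ t0t) (kz _ t0t)) (dotC _ (j (y t)) (yp t)).
    by ring.
  apply: hderivD.
    apply: (@hderiv_bilinear _ _ _ (fun u v => dotH u v) 1 (dot_linear dotH) (dot_linearl dotH) _
      _ (j \o y) (j \o y)) => //; [|exact: dy|exact: dy].
    by move=> u v; rewrite mul1r; exact: dot_cauchy_schwarz.
  apply: (@hderiv_bilinear _ _ _ (fun u v => A1 u v) C1 _ A1l hA1 _ z z) => //; [|exact: hz|exact: hz].
  by move=> u c v w; rewrite linearP.
have Nge t : 0 <= t <= tau -> mu1 * `|z t| ^+ 2 + `|j (y t)| ^+ 2 <= N t.
  by move=> t0t; rewrite /N hilH addrC lerD2l ellA1//; exact: kz.
have k0 : 0 <= kappa by rewrite divr_ge0// sqrtr_ge0.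
have N'le t : 0 <= t <= tau -> N' t <= 2 * (Phi t * `|j (y t)|) + kappa * N t.
  move=> t0t; rewrite /N' lerD//.
    by rewrite ler_wpM2l// (le_trans (ler_norm _))// bp//; exact: ky.
  rewrite -mulrN; apply: (@le_trans _ _ (2 * (C2 * `|z t| * `|j (y t)|))).
    rewrite ler_wpM2l// (le_trans (ler_norm _))// normrN.
    rewrite (le_trans (dot_cauchy_schwarz hilH _ _))// ler_wpM2r//.
  have smu : 0 < Num.sqrt mu1 by rewrite sqrtr_gt0.
  (* Young's inequality for sqrt(mu1) |z| and |j y|, whose squares sum to at most [N], is what fixes
     kappa = C2 / sqrt(mu1). *)
  have -> : 2 * (C2 * `|z t| * `|j (y t)|) =
      kappa * (2 * (Num.sqrt mu1 * `|z t|) * `|j (y t)|).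
    by rewrite /kappa; field; rewrite gt_eqF.
  rewrite ler_wpM2l// (le_trans _ (Nge t t0t))//.
  rewrite -[X in X * `|z t| ^+ 2](sqr_sqrtr (ltW mu10)) -exprMn.
  have := sqr_ge0 (Num.sqrt mu1 * `|z t| - `|j (y t)|).
  by lra.
have yN t : 0 <= t <= tau -> `|j (y t)| ^+ 2 <= N t.
  move=> t0t; apply: le_trans (Nge t t0t); rewrite lerDr.
  by rewrite mulr_ge0 ?(ltW mu10)// sqr_ge0.
have PhiE t : 0 <= t -> 0 <= Phi t.
  by move=> t0; rewrite addr_ge0// ?mulr_ge0// ?divr_ge0// exprn_ge0.
apply/ler_addgt0Pr => e e0.
(* [N] may vanish, and the square root is not differentiable at 0, so [N] is shifted by e'^2; the
   choice of [e'] turns the shift into [e] once the integrating factor is removed. *)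
pose e' := e / expR (kappa / 2 * tau).
have e'0 : 0 < e' by rewrite divr_gt0// expR_gt0.
pose q t := Num.sqrt (N t + e' ^+ 2).
have Npos t : 0 <= t <= tau -> 0 < N t + e' ^+ 2.
  by move=> t0t; rewrite ltr_wpDl ?exprn_gt0// (le_trans (sqr_ge0 _) (yN t t0t)).
have yq t : 0 <= t <= tau -> `|j (y t)| <= q t.
  move=> t0t; rewrite -ler_sqr ?nnegrE ?sqrtr_ge0// sqr_sqrtr ?(ltW (Npos t t0t))//.
  by rewrite (le_trans (yN t t0t))// lerDl sqr_ge0.
(* Integrating factor at half the rate: N' <= 2 Phi q + kappa q^2 means q' <= Phi + (kappa / 2)
   q. *)
pose G t := expR (- (kappa / 2) * t) * q t.
pose G' t := - (kappa / 2) * expR (- (kappa / 2) * t) * q t +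
  expR (- (kappa / 2) * t) * ((2 * q t)^-1 * N' t).
have hG t : 0 <= t <= tau -> hderiv `[0, tau] G t (G' t).
  move=> t0t; have Dt : `[0, tau]%classic t by rewrite /= in_itv.
  apply: hderivM => //.
    rewrite (_ : - (kappa / 2) * expR _ =
      expR (- (kappa / 2) * t) * (- (kappa / 2) * 1)); last by ring.
    apply: (@hderiv_comp _ _ expR (fun t => - (kappa / 2) * t)) => //.
    by apply: hderivMl; exact: hderiv_id.
  apply: (@hderiv_comp _ _ Num.sqrt (fun t => N t + e' ^+ 2)) => //.
    exact: is_derive1_sqrt (Npos t t0t).
  by rewrite -[N' t]addr0; apply: hderivD; [exact: hN|exact: hderiv_cst].
(* The second integral of al + be s^2; the factors 1/2 and 1/12 originate here. *)
pose Psi t := al / 2 * t ^+ 2 + be / 12 * t ^+ 4.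
have hPsi D t : hderiv D Psi t (Phi t).
  rewrite (_ : Phi t = al / 2 * (2%:R * t ^+ 1) + be / 12 * (4%:R * t ^+ 3)).
    by apply: hderivD; apply: hderivMl; exact: hderivX.
  by rewrite /Phi; field.
have := @hderiv_le _ 0 tau G Psi G' Phi tau0 hG (fun t _ => hPsi _ t).
have Psi0 : Psi 0 = 0 by rewrite /Psi !expr0n /= !mulr0 addr0.
rewrite Psi0 subr0.
have le t : 0 < t < tau -> G' t <= Phi t.
  move=> /andP[/ltW t0 /ltW tt]; have t0t : 0 <= t <= tau by rewrite t0.
  have q0 : 0 < q t by rewrite sqrtr_gt0 Npos.
  have E0 := expR_gt0 (- (kappa / 2) * t).
  have E1 : expR (- (kappa / 2) * t) <= 1.
    by rewrite expR_le1 mulNr oppr_le0 mulr_ge0// divr_ge0.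
  apply: (@le_trans _ _ (expR (- (kappa / 2) * t) * Phi t)); last first.
    by rewrite ler_piMl// PhiE.
  have -> : G' t = expR (- (kappa / 2) * t) * (- (kappa / 2) * q t + (2 * q t)^-1 * N' t).
    by rewrite /G'; ring.
  rewrite ler_pM2l// -lerBrDl -ler_pdivlMl ?invr_gt0 ?mulr_gt0// invrK.
  apply: (le_trans (N'le t t0t)).
  have q2 : q t ^+ 2 = N t + e' ^+ 2 by rewrite sqr_sqrtr ?(ltW (Npos t t0t)).
  have -> : 2 * q t * (Phi t - - (kappa / 2) * q t) = 2 * (Phi t * q t) + kappa * q t ^+ 2.
    by field.
  rewrite q2 lerD// ?ler_wpM2l ?PhiE ?yq//.
  by rewrite lerDl sqr_ge0.
move=> /(_ le) hfin.
have q00 : q 0 <= `|j (y 0)| + e'.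
  rewrite /q /N z0 linear0 addr0 hilH -ler_sqr ?nnegrE ?sqrtr_ge0 ?addr_ge0 ?(ltW e'0)//.
  rewrite sqr_sqrtr ?addr_ge0 ?sqr_ge0//.
  by rewrite sqrrD lerD2r lerDl mulrn_wge0// mulr_ge0// ltW.
have Gtau : expR (- (kappa / 2) * tau) * `|j (y tau)| <= `|j (y 0)| + e' + Psi tau.
  have : expR (- (kappa / 2) * tau) * `|j (y tau)| <= G tau.
    by rewrite ler_pM2l ?expR_gt0// yq// tau0 lexx.
  move: hfin; rewrite {2}/G mulr0 expR0 mul1r; lra.
move: Gtau; rewrite mulNr expRN ler_pdivrMl ?expR_gt0// => /le_trans; apply.
rewrite le_eqVlt; apply/orP; left; apply/eqP.
by rewrite /e' /Psi; field; rewrite gt_eqF// expR_gt0.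
Qed.

End wave.

(** * The operator cosine *)

Lemma continuous_within_affine (R : realType) (T : topologicalType) (D D' : set R)
    (y : R -> T) (a c : R) :
  (forall s, D' s -> D (a + c * s)) -> {within D, continuous y} ->
  {within D', continuous (fun s => y (a + c * s))}.
Proof.
move=> DD /subspace_continuousP cy; apply/subspace_continuousP => t D't.
apply: (cvg_comp _ _ _ (cy _ (DD _ D't))) => P nP.
have cf : (a + c * s) @[s --> t] --> a + c * t.
  by apply: cvgD; [exact: cvg_cst|apply: cvgM; [exact: cvg_cst|exact: cvg_id]].
have H : \forall s \near t, D (a + c * s) -> P (a + c * s) by exact: (cf _ nP).
have {}H : \forall s \near t, D' s -> P (a + c * s) by apply: filterS H => s h /DD.
exact: H.
Qed.

Section kernel_spaces.
Context {R : realType} {V H Q : completeNormedModType R}.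
Variables (j : {linear V -> H}) (B : {linear V -> dual Q}).

Lemma Vker_linear c v w : Vker B v -> Vker B w -> Vker B (c *: v + w).
Proof. by rewrite /Vker /= linearP => -> ->; rewrite scaler0 addr0. Qed.

Lemma Vker0 : Vker B 0.
Proof. by rewrite /Vker /= linear0. Qed.

Lemma VkerB v w : Vker B v -> Vker B w -> Vker B (v - w).
Proof. by move=> kv kw; rewrite -scaleN1r addrC; exact: Vker_linear. Qed.

Lemma HkerP x :
  Hker j B x <-> forall e, 0 < e -> exists2 v, Vker B v & `|x - j v| < e.
Proof.
split=> [hx e e0|h U].
  have [_ [[v kv <-] hv]] := hx _ (nbhsx_ballx x e e0).
  by exists v => //; move: hv; rewrite -ball_normE.
move=> /nbhs_ballP[e /= e0 he]; have [v kv hv] := h e e0.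
exists (j v); split; first by exists v.
by apply: he; rewrite -ball_normE.
Qed.

Lemma Hker_j v : Vker B v -> Hker j B (j v).
Proof. by move=> kv; apply: subset_closure; exists v. Qed.

Lemma Hker_linear c x z : Hker j B x -> Hker j B z -> Hker j B (c *: x + z).
Proof.
move=> /HkerP hx /HkerP hz; apply/HkerP => e e0.
have c1 : 0 < `|c| + 1 by rewrite ltr_pwDr.
have [|v kv hv] := hx (e / 2 / (`|c| + 1)); first by rewrite !divr_gt0.
have [|w kw hw] := hz (e / 2); first by rewrite divr_gt0.
exists (c *: v + w); first exact: Vker_linear.
rewrite linearP opprD addrACA -scalerBr (splitr e).
rewrite (le_lt_trans (ler_normD _ _))// ler_ltD// normrZ.
apply: (@le_trans _ _ ((`|c| + 1) * `|x - j v|)); first by rewrite ler_wpM2r// lerDl.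
by rewrite mulrC -ler_pdivlMr// ltW.
Qed.

Lemma HkerD x z : Hker j B x -> Hker j B z -> Hker j B (x + z).
Proof. by move=> hx hz; rewrite -[x]scale1r; exact: Hker_linear. Qed.

Lemma Hker0 : Hker j B 0.
Proof. by rewrite -(linear0 j); apply: Hker_j; exact: Vker0. Qed.

Lemma HkerZ c x : Hker j B x -> Hker j B (c *: x).
Proof. by move=> hx; rewrite -[_ *: _]addr0; apply: Hker_linear => //; exact: Hker0. Qed.

Lemma HkerB x z : Hker j B x -> Hker j B z -> Hker j B (x - z).
Proof. by move=> hx hz; rewrite -scaleN1r addrC; exact: Hker_linear. Qed.

(** The bound [M] supplies the continuity for passing to the closure; the constant obtained is [c],
    valid on the dense subspace. With c = 0 the lemma extends operator identities from [V_ker] to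
    [H_ker]. Additivity is asked on [H_ker] alone, where [cosK] is meaningful. *)
Lemma Hker_dense_bound (G : H -> H) (M c : R) : 0 <= c ->
  (forall x z, Hker j B x -> Hker j B z -> G (x + z) = G x + G z) ->
  (forall x, Hker j B x -> `|G x| <= M * `|x|) ->
  (forall v, Vker B v -> `|G (j v)| <= c * `|j v|) ->
  forall x, Hker j B x -> `|G x| <= c * `|x|.
Proof.
move=> c0 GD GM Gc x hx; apply/ler_addgt0Pr => e e0.
pose K := `|M| + c + 1.
have K0 : 0 < K by rewrite /K ltr_wpDl// addr_ge0.
have [|v kv hv] := (HkerP x).1 hx (e / K); first by rewrite divr_gt0.
have hjv := Hker_j kv.
rewrite -{1}(subrK (j v) x) GD//; last exact: HkerB.
apply: (le_trans (ler_normD _ _)).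
have h1 : `|G (x - j v)| <= `|M| * `|x - j v|.
  by apply: (le_trans (GM _ (HkerB hx hjv))); rewrite ler_wpM2r// ler_norm.
have h2 := Gc v kv.
have h3 : `|j v| <= `|x| + `|x - j v|.
  by rewrite -{1}(subKr x (j v)) (le_trans (ler_normB _ _)).
have h4 : K * `|x - j v| <= e by rewrite mulrC -ler_pdivlMr// ltW.
have h5 : c * `|j v| <= c * (`|x| + `|x - j v|) by rewrite ler_wpM2l.
have := normr_ge0 (x - j v); rewrite /K in h4; lra.
Qed.

End kernel_spaces.

Section cosine.
Context {R : realType} {V H Q : completeNormedModType R}.
Variables (dotV : {dot V for (@idfun R)}) (dotH : {dot H for (@idfun R)}).
Hypotheses (hilV : hilbert_dot dotV) (hilH : hilbert_dot dotH).
Variables (j : {linear V -> H}) (CVH : R).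
Hypothesis hCVH : forall v, `|j v| <= CVH * `|v|.
Variables (B : {linear V -> dual Q}) (A A1 : {linear V -> dual V}) (A2 : {linear V -> H}).
Hypotheses (contB : continuous B) (contA : continuous A).
Hypothesis splitA : forall v w, A v w = A1 v w + dotH (A2 v) (j w).
Hypothesis symA1 : forall v w, Vker B v -> Vker B w -> A1 v w = A1 w v.
Variables (mu1 C2 : R).
Hypotheses (mu10 : 0 < mu1) (ellA1 : elliptic_on_Vker B mu1 A1).
Hypotheses (C20 : 0 <= C2) (hC2 : forall v, `|A2 v| <= C2 * `|v|).
Let kappa := C2 / Num.sqrt mu1.
Variable cosK : R -> H -> H.
Hypothesis hcosK : is_operator_cosine dotH j A B cosK.

Local Notation weak_wave := (weak_wave dotH j B A).
Local Notation Vker := (Vker B).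
Local Notation Hker := (Hker j B).

Lemma weak_waveP tau y yp F z zp G a :
  weak_wave tau y yp F -> weak_wave tau z zp G ->
  weak_wave tau (fun s => a *: y s + z s) (fun s => a *: yp s + zp s)
    (fun s => a *: F s + G s).
Proof.
move=> [cy ky dy wy] [cz kz dz wz]; split.
- move/subspace_continuousP : cy => cy; move/subspace_continuousP : cz => cz.
  apply/subspace_continuousP => t t0; apply: cvgD; last exact: cz.
  by apply: cvgZr; exact: cy.
- by move=> t t0; apply: Vker_linear; [exact: ky|exact: kz].
- move=> t t0; have := hderivD (hderivZ a (dy t t0)) (dz t t0).
  by apply: hderiv_eq => [s _|]; rewrite /= ?linearP// in_itv.
- move=> t w t0 kw.
  have Dt : `[0, tau]%classic t by rewrite /= in_itv.
  have := hderivD (hderivMl a (wy t w t0 kw)) (wz t w t0 kw).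
  have -> : - A (a *: y t + z t) w + dotH (a *: F t + G t) (j w) =
      a * (- A (y t) w + dotH (F t) (j w)) + (- A (z t) w + dotH (G t) (j w)).
    rewrite dotDl dotZl linearP.
    rewrite -[(a *: A (y t) + A (z t)) w]/(a * A (y t) w + A (z t) w).
    by ring.
  by move=> h; apply: (hderiv_eq _ Dt h) => s _; rewrite dotDl dotZl.
Qed.

(** A stationary wave: A b and the source cancel on [V_ker]. It accounts for the terms [b^n] of the
    scheme. *)
Lemma weak_wave_cst tau b h : is_Aker_inv dotH j A B h b ->
  weak_wave tau (fun=> b) (fun=> 0) (fun=> h).
Proof.
move=> [kb hb]; split => //.
- by apply: continuous_subspaceT => x; exact: cvg_cst.
- by move=> t _; exact: hderiv_cst.
- by move=> t w _ kw; rewrite hb// addNr; exact: hderiv_cst.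
Qed.

(** A second time derivative picks up the factor c^2, so the equation survives shifts (c = 1) and
    reflections (c = -1) of time. *)
Lemma weak_wave_affine T' tau t c y yp F : c ^+ 2 = 1 ->
  (forall s, 0 <= s <= tau -> 0 <= t + c * s <= T') ->
  weak_wave T' y yp F ->
  weak_wave tau (fun s => y (t + c * s)) (fun s => c *: yp (t + c * s))
    (fun s => F (t + c * s)).
Proof.
move=> c1 st [cy ky dy wy].
have st' s : `[0, tau]%classic s -> `[0, T']%classic (t + c * s).
  by rewrite /= !in_itv/=; exact: st.
split.
- exact: continuous_within_affine cy.
- by move=> s /st; exact: ky.
- by move=> s /st /dy; exact: (hderiv_affine st').
- move=> s w s0 kw; have sT := st s s0.
  have Ds : `[0, tau]%classic s by rewrite /= in_itv.
  have h := hderivMl c (hderiv_affine st' (wy _ w sT kw)).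
  have -> : - A (y (t + c * s)) w + dotH (F (t + c * s)) (j w) =
      c * (c *: (- A (y (t + c * s)) w + dotH (F (t + c * s)) (j w))).
    by rewrite /GRing.scale /= mulrA -expr2 c1 mul1r.
  by apply: (hderiv_eq _ Ds h) => r _; rewrite dotZl.
Qed.

Lemma cosK_wave v : Vker v -> exists y yp,
  [/\ forall tau, weak_wave tau y yp (fun=> 0), y 0 = v, yp 0 = 0 &
      forall t, 0 <= t -> cosK t (j v) = j (y t)].
Proof.
move=> kv; have [_ /(_ v kv)[y [cy ky [C1 C1'] [y0 yp0] wy] cosy]] := hcosK.
exists y, (derive_on [set t | 0 <= t] (j \o y)).
have sub tau : `[0, tau]%classic `<=` [set t : R | 0 <= t].
  by move=> t; rewrite /= in_itv/= => /andP[].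
split => // tau; split.
- exact: continuous_subspaceW (sub tau) cy.
- by move=> t /andP[t0 _]; exact: ky.
- move=> t /andP[t0 _]; apply: (hderivS (sub tau)); apply: hderiv_diff_quot.
  exact: (C1 0%N).
- move=> t w /andP[t0 _] kw; rewrite linear0l addr0.
  by apply: (hderivS (sub tau)); apply: hderiv_diff_quot; exact: wy.
Qed.

Lemma cosK_bound t x : 0 <= t -> Hker x -> `|cosK t x| <= expR (kappa / 2 * t) * `|x|.
Proof.
move=> t0; have [/(_ t t0)[ck cl [M cM]] _] := hcosK.
apply: (Hker_dense_bound (M := M)) => //.
  by move=> y z hy hz; have := cl 1 y z hy hz; rewrite !scale1r.
move=> v kv; have [y [yp [wy y0 yp0 cosy]]] := cosK_wave kv.
rewrite cosy// -y0.
have := @wave_energy _ _ _ _ dotV dotH hilV hilH j CVH hCVH B A A1 A2 contB contA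
  splitA symA1 mu1 C2 mu10 ellA1 C20 hC2 t y yp (fun=> 0) 0 0 t0 (wy t) yp0
  (lexx 0) (lexx 0).
rewrite !mul0r !addr0; apply => s _; by rewrite normr0 mul0r addr0.
Qed.

Lemma cosK_Hker t x : 0 <= t -> Hker x -> Hker (cosK t x).
Proof. by move=> t0; have [/(_ t t0)[ck _ _] _] := hcosK; exact: ck. Qed.

Lemma cosK_linear t c x z : 0 <= t -> Hker x -> Hker z ->
  cosK t (c *: x + z) = c *: cosK t x + cosK t z.
Proof. by move=> t0; have [/(_ t t0)[_ cl _] _] := hcosK; exact: cl. Qed.

Lemma cosKD t x z : 0 <= t -> Hker x -> Hker z ->
  cosK t (x + z) = cosK t x + cosK t z.
Proof. by move=> t0 hx hz; have := cosK_linear 1 t0 hx hz; rewrite !scale1r. Qed.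

Lemma cosK0r t : 0 <= t -> cosK t 0 = 0.
Proof.
move=> t0; have h0 := Hker0 j B.
by apply: (@addrI _ (cosK t 0)); rewrite -cosKD// !addr0.
Qed.

Lemma cosKZ t c x : 0 <= t -> Hker x -> cosK t (c *: x) = c *: cosK t x.
Proof.
move=> t0 hx; have h0 := Hker0 j B.
by rewrite -[c *: x]addr0 cosK_linear// cosK0r// addr0.
Qed.

(** The vector in the norm is [j] of the value at [tau] of W(s) = 2 cos(s Omega)(y t - b) + 2 b -
    y(t + s) - y(t - s). W(0) = 0 and the velocities of the last two terms cancel at s = 0, so only
    the source 2 h' - r(t + s) - r(t - s) drives W, and the energy estimate applies. *)
Lemma two_step T' tau t y yp r b h' al be : 0 <= tau -> tau <= t -> t + tau <= T' ->
  weak_wave T' y yp r -> is_Aker_inv dotH j A B h' b -> 0 <= al -> 0 <= be ->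
  (forall s, 0 < s < tau ->
     `|2 *: h' - r (t + s) - r (t - s)| <= al + be * s ^+ 2) ->
  `|2 *: cosK tau (j (y t - b)) + 2 *: j b - j (y (t + tau)) - j (y (t - tau))| <=
    expR (kappa / 2 * tau) * (al * tau ^+ 2 / 2 + be * tau ^+ 4 / 12).
Proof.
move=> tau0 taut tT wy hb al0 be0 hr.
have ky : Vker (y t - b).
  apply: VkerB; last by case: hb.
  by case: wy => _ + _ _; apply; lra.
have [c [cp [wc c0 cp0 ->//]]] := cosK_wave ky.
have wp := @weak_wave_affine T' tau t 1 y yp r (expr1n _ _) _ wy.
have wm := @weak_wave_affine T' tau t (-1) y yp r _ _ wy.
have {}wp : weak_wave tau (fun s => y (t + 1 * s)) (fun s => 1 *: yp (t + 1 * s))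
    (fun s => r (t + 1 * s)) by apply: wp => s; lra.
have {}wm : weak_wave tau (fun s => y (t + -1 * s)) (fun s => -1 *: yp (t + -1 * s))
    (fun s => r (t + -1 * s)).
  by apply: wm => [|s]; [rewrite sqrrN expr1n|lra].
(* [weak_waveP] combines two waves as a y + z; the zero wave closes the chain of four. *)
have w0 : weak_wave tau (fun=> 0) (fun=> 0) (fun=> 0).
  apply: weak_wave_cst; split; first exact: Vker0.
  by move=> w _; rewrite linear0l linear0.
have W := weak_waveP 2 (wc tau) (weak_waveP 2 (weak_wave_cst tau hb)
  (weak_waveP (-1) wp (weak_waveP (-1) wm w0))).
have := @wave_energy _ _ _ _ dotV dotH hilV hilH j CVH hCVH B A A1 A2 contB contA
  splitA symA1 mu1 C2 mu10 ellA1 C20 hC2 tau _ _ _ al be tau0 W _ al0 be0 _.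
rewrite /= !mulr0 !addr0 c0 cp0 !scaler0 !scaleN1r !scale1r !mul1r !mulN1r !add0r subrr.
have -> : 2 *: (y t - b) + (2 *: b + (- y t - y t)) = 0.
  by rewrite scalerBr addrA subrK -opprD scaler_nat mulr2n subrr.
rewrite linear0 normr0 add0r => /(_ erefl) h.
have -> : 2 *: j (c tau) + 2 *: j b - j (y (t + tau)) - j (y (t - tau)) =
    j (2 *: c tau + (2 *: b + (- y (t + tau) - y (t - tau)))).
  by rewrite !linearD !linearN !linearZ /= !addrA.
apply: h => s s0.
rewrite mul1r mulN1r add0r addr0 !scaleN1r !addrA.
exact: hr.
Qed.

Lemma cosK_zero x : Hker x -> cosK 0 x = x.
Proof.
move=> hx; apply/eqP; rewrite -subr_eq0 -normr_le0.
suff : `|cosK 0 x - x| <= 0 * `|x| by rewrite mul0r.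
apply: (@Hker_dense_bound _ _ _ _ j B (fun x => cosK 0 x - x)
  (expR (kappa / 2 * 0) + 1) 0) => //.
- by move=> y z hy hz; rewrite cosKD// opprD addrACA.
- move=> y hy; rewrite (le_trans (ler_normB _ _))// mulrDl mul1r lerD2r.
  exact: cosK_bound.
- move=> v kv; have [y [yp [_ y0 _ cosy]]] := cosK_wave kv.
  by rewrite cosy// y0 subrr normr0 mul0r.
Qed.

(** The addition formula for cosines: [two_step] for the wave that defines cos(t Omega) v, with [b]
    and all sources zero, then density. *)
Lemma cosK_cosK tau t x : 0 <= tau -> tau <= t -> Hker x ->
  2 *: cosK tau (cosK t x) = cosK (t + tau) x + cosK (t - tau) x.
Proof.
move=> tau0 taut hx; apply/eqP; rewrite -subr_eq0 -normr_le0.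
have t0 : 0 <= t by exact: le_trans taut.
have tp0 : 0 <= t + tau by rewrite addr_ge0.
have tm0 : 0 <= t - tau by rewrite subr_ge0.
rewrite -[0](mul0r `|x|); apply: (@Hker_dense_bound _ _ _ _ j B
  (fun x => 2 *: cosK tau (cosK t x) - (cosK (t + tau) x + cosK (t - tau) x))
  (2 * (expR (kappa / 2 * tau) * expR (kappa / 2 * t)) +
   (expR (kappa / 2 * (t + tau)) + expR (kappa / 2 * (t - tau)))) 0) => //.
- move=> y z hy hz; rewrite !cosKD//; try exact: cosK_Hker.
  by rewrite scalerDr [X in _ - X]addrACA opprD addrACA.
- move=> y hy; rewrite (le_trans (ler_normB _ _))// mulrDl lerD//.
    rewrite normrZ ger0_norm// -mulrA ler_wpM2l// -mulrA.
    apply: (le_trans (cosK_bound tau0 (cosK_Hker t0 hy))).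
    by rewrite ler_wpM2l ?expR_ge0// cosK_bound.
  by rewrite (le_trans (ler_normD _ _))// mulrDl lerD// cosK_bound.
- move=> v kv; have [y [yp [wy y0 yp0 cosy]]] := cosK_wave kv.
  rewrite !cosy//.
  have A0 : is_Aker_inv dotH j A B 0 0.
    by split; [exact: Vker0|move=> w _; rewrite linear0l linear0].
  have := @two_step (t + tau) tau t y yp (fun=> 0) 0 0 0 0 tau0 taut (lexx _)
    (wy _) A0 (lexx _) (lexx _).
  rewrite (subr0 (y t)) (linear0 j) !scaler0 addr0 !mul0r addr0 mulr0 opprD addrA.
  apply => s _.
  by rewrite !subr0 normr0 mul0r addr0.
Qed.

Definition cheb (tau : R) (x : H) (m : nat) : H * H :=
  iter m (fun p => (p.2, 2 *: cosK tau p.2 - p.1)) (0, x).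

(* [chebU tau x m] is [U_(m-1) (cos (tau Omega)) x] for the Chebyshev
   polynomials of the second kind. *)
Definition chebU (tau : R) (x : H) (m : nat) : H := (cheb tau x m).1.

Lemma chebU0 tau x : chebU tau x 0 = 0. Proof. by []. Qed.

Lemma chebU1 tau x : chebU tau x 1 = x. Proof. by []. Qed.

Lemma chebUSS tau x m :
  chebU tau x m.+2 = 2 *: cosK tau (chebU tau x m.+1) - chebU tau x m.
Proof. by []. Qed.

Lemma chebU_Hker tau x m : 0 <= tau -> Hker x -> Hker (chebU tau x m).
Proof.
move=> tau0 hx; suff : Hker (chebU tau x m) /\ Hker (chebU tau x m.+1) by case.
elim: m => [|m [h1 h2]]; first by split; [exact: Hker0|].
split => //; rewrite chebUSS; apply: HkerB => //.
by apply: HkerZ; exact: cosK_Hker.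
Qed.

(** This is U_(m+1) - U_(m-1) = 2 T_(m+1), where T_k(cos(tau Omega)) = cos(k tau Omega). Bounding
    the defining recursion term by term would allow growth exponential in [m] at fixed m tau; here
    two degrees cost only one additional cosine. *)
Lemma chebU_cosK tau x m : 0 <= tau -> Hker x ->
  chebU tau x m.+2 = chebU tau x m + 2 *: cosK (m.+1%:R * tau) x.
Proof.
move=> tau0 hx.
suff : chebU tau x m.+2 = chebU tau x m + 2 *: cosK (m.+1%:R * tau) x /\
    chebU tau x m.+3 = chebU tau x m.+1 + 2 *: cosK (m.+2%:R * tau) x by case.
have h2 k : 2 *: cosK tau (cosK (k.+1%:R * tau) x)
    = cosK (k.+2%:R * tau) x + cosK (k%:R * tau) x.
  rewrite cosK_cosK//; last by rewrite ler_peMl// ler1n.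
  by congr (cosK _ _ + cosK _ _); rewrite !mulrS; ring.
have hU k : Hker (chebU tau x k) by exact: chebU_Hker.
have hC k : Hker (cosK (k%:R * tau) x) by apply: cosK_Hker => //; rewrite mulr_ge0.
elim: m => [|m [h3 h4]].
  split; first by rewrite chebUSS chebU1 chebU0 subr0 add0r mul1r.
  have -> : chebU tau x 3 = 2 *: cosK tau (2 *: cosK (1%:R * tau) x) - x.
    by rewrite chebUSS chebU1 chebUSS chebU0 subr0 chebU1 mul1r.
  rewrite cosKZ// h2 chebU1 mul0r cosK_zero// scalerDr -addrA addrC; congr (_ + _).
  by rewrite scaler_nat mulr2n addrK.
split => //; rewrite chebUSS h4 cosKD//; last exact: HkerZ.
rewrite cosKZ// scalerDr h2 {1}h3 chebUSS scalerDr opprD -!addrA; congr (_ + _).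
by rewrite (addrCA (2 *: cosK (m.+1%:R * tau) x)) subrr addr0 addrC.
Qed.

(** Induction in steps of two, with m + 3 = (m + 1) + 2. The exponent stops at m tau because the
    polynomial is U_m, a sum of cosines at times up to m tau. *)
Lemma chebU_bound tau x m : 0 <= tau -> Hker x ->
  `|chebU tau x m.+1| <= m.+1%:R * expR (kappa / 2 * (m%:R * tau)) * `|x|.
Proof.
move=> tau0 hx.
have k0 : 0 <= kappa / 2 by rewrite !divr_ge0// sqrtr_ge0.
have hT k : `|2 *: cosK (k%:R * tau) x| <= 2 * (expR (kappa / 2 * (k%:R * tau)) * `|x|).
  by rewrite normrZ ger0_norm// ler_wpM2l// cosK_bound// mulr_ge0.
elim/ltn_ind: m => -[|[|m]] IH.
- by rewrite chebU1 mul0r mulr0 expR0 !mul1r.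
- by rewrite chebU_cosK// chebU0 add0r -mulrA.
- rewrite chebU_cosK// (le_trans (ler_normD _ _))//.
  apply: (le_trans (lerD (IH m (ltnW (ltnSn _))) (hT m.+2))).
  have -> : m.+3%:R = m.+1%:R + 2 :> R by rewrite -natrD addn2.
  rewrite (mulrDl m.+1%:R 2) (mulrDl (m.+1%:R * _) (2 * _)) mulrA lerD2r ler_wpM2r// ler_wpM2l// ler_expR.
  apply: ler_wpM2l => //; apply: ler_wpM2r => //.
  by rewrite ler_nat (leq_trans (leqnSn m)).
Qed.

End cosine.

(** * A smooth step function *)

Section smooth.
Context {R : realType}.
Implicit Types f g : R -> R.

(** Smoothness graded by order, so that closure under products goes by induction on the order;
    smooth means [ndiff n] for all [n]. *)
Fixpoint ndiff n f : Prop :=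
  if n is n'.+1 then (forall x, derivable f x 1) /\ ndiff n' (derive1 f) else True.

Lemma ndiff_derive f f' n : (forall x : R, is_derive x 1 f (f' x)) ->
  ndiff n f' -> ndiff n.+1 f.
Proof.
move=> df; have -> : f' = derive1 f.
  by apply/funext => x; rewrite derive1E; apply/esym/derive_val.
by move=> nf'; split => // x; have [] := df x.
Qed.

Lemma ndiffW n f : ndiff n.+1 f -> ndiff n f.
Proof. by elim: n f => //= n IH f [df [df' nf]]; split => //; exact: IH. Qed.

Lemma ndiff_is_derive n f (x : R) : ndiff n.+1 f -> is_derive x 1 f (derive1 f x).
Proof. by move=> [df _]; rewrite derive1E; exact/derivableP. Qed.

Lemma derivable_ndiff f : (forall n, ndiff n f) ->
  forall k x, derivable (derive1n k f) x 1.
Proof.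
move=> nf k; elim: k f nf => [|k IH] f nf x; first by have [] := nf 1%N.
rewrite /derive1n iterSr; apply: IH => n.
by have [] := nf n.+1.
Qed.

Lemma is_deriveDf f g (x l m : R) : is_derive x 1 f l -> is_derive x 1 g m ->
  is_derive x 1 (fun t => f t + g t) (l + m).
Proof. exact: is_deriveD. Qed.

Lemma is_deriveMf f g (x l m : R) : is_derive x 1 f l -> is_derive x 1 g m ->
  is_derive x 1 (fun t => f t * g t) (l * g x + f x * m).
Proof.
move=> df dg; apply: (hderiv_is_derive (D := setT)); first exact: filterT.
by apply: hderivM => //; exact: is_derive_hderiv.
Qed.

Lemma is_derive_affine f (x a c l : R) : is_derive (a + c * x) 1 f l ->
  is_derive x 1 (fun t => f (a + c * t)) (c * l).
Proof.
move=> df; apply: (hderiv_is_derive (D := setT)); first exact: filterT.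
by apply: (hderiv_affine (D := setT)) => //; exact: is_derive_hderiv.
Qed.

Lemma ndiff_cst n (c : R) : ndiff n (fun=> c).
Proof.
elim: n c => // n IH c; apply: ndiff_derive (IH 0) => x; exact: is_derive_cst.
Qed.

Lemma ndiffD n f g : ndiff n f -> ndiff n g -> ndiff n (fun t => f t + g t).
Proof.
elim: n f g => // n IH f g nf ng.
apply: (@ndiff_derive _ (fun x => derive1 f x + derive1 g x)) => [x|]; last first.
  by apply: IH; [case: nf|case: ng].
exact: is_deriveDf (ndiff_is_derive _ nf) (ndiff_is_derive _ ng).
Qed.

Lemma ndiffM n f g : ndiff n f -> ndiff n g -> ndiff n (fun t => f t * g t).
Proof.
elim: n f g => // n IH f g nf ng.
apply: (@ndiff_derive (fun t => f t * g t)
  (fun x => derive1 f x * g x + f x * derive1 g x) n) => [x|].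
  exact: is_deriveMf (ndiff_is_derive _ nf) (ndiff_is_derive _ ng).
by apply: ndiffD; apply: IH => //; [case: nf|exact: ndiffW|exact: ndiffW|case: ng].
Qed.

Lemma ndiff_affine n f a c : ndiff n f -> ndiff n (fun t => f (a + c * t)).
Proof.
elim: n f => // n IH f nf.
apply: (@ndiff_derive _ (fun x => c * derive1 f (a + c * x))) => [x|].
  exact: is_derive_affine (ndiff_is_derive _ nf).
by apply: ndiffM; [exact: ndiff_cst|apply: IH; case: nf].
Qed.

(* The family [x^-n exp(-1/x)] extended by 0 to the left is closed, up to linear
   combinations, under differentiation. *)
Definition flat (n : nat) (x : R) : R :=
  if 0 < x then x^-1 ^+ n * expR (- x^-1) else 0.

Lemma flat_ge0 n x : 0 <= flat n x.
Proof.
by rewrite /flat; case: ifP => // x0; rewrite mulr_ge0 ?expR_ge0// exprn_ge0// invr_ge0 ltW.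
Qed.

Lemma flat_gt0 n x : 0 < x -> 0 < flat n x.
Proof. by move=> x0; rewrite /flat x0 mulr_gt0 ?expR_gt0// exprn_gt0// invr_gt0. Qed.

Lemma flat_le0 n x : x <= 0 -> flat n x = 0.
Proof. by rewrite leNgt /flat => /negbTE ->. Qed.

(** From e^y >= y^(n+2) / (n+2)! at y = 1/x. The quadratic decay at 0 is what gives every [flat n]
    the derivative 0 there. *)
Lemma flat_bound n x : flat n x <= n.+2`!%:R * x ^+ 2.
Proof.
rewrite /flat; case: ifP => [x0|_]; last by rewrite mulr_ge0// sqr_ge0.
have y0 : 0 < x^-1 by rewrite invr_gt0.
set y := x^-1 in y0 *.
have f0 : 0 < n.+2`!%:R :> R by rewrite ltr0n fact_gt0.
have h : y ^+ n.+2 <= n.+2`!%:R * expR y.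
  rewrite -ler_pdivrMl// mulrC (le_trans _ (expR_ge1Dxn n.+1 (ltW y0)))//.
  by rewrite lerDr.
have -> : y ^+ n = y ^+ n.+2 * x ^+ 2.
  by rewrite -addn2 exprD -mulrA -exprMn mulVf ?gt_eqF// expr1n mulr1.
by rewrite expRN ler_pdivrMr ?expR_gt0// [leRHS]mulrAC ler_wpM2r// sqr_ge0.
Qed.

Lemma flat_derive n (x : R) : is_derive x 1 (flat n) (flat n.+2 x - n%:R * flat n.+1 x).
Proof.
have [x0|x0|<-] := ltgtP 0 x.
- apply: (hderiv_is_derive (D := [set t | 0 < t])).
    exact: (open_nbhs_nbhs (conj (@open_gt _ 0) x0)).
  have xn0 : x != 0 by rewrite gt_eqF.
  have h1 : is_derive x 1 (@GRing.inv R) (- x ^- 2 *: 1) by exact: is_deriveV.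
  have h2 : is_derive x^-1 1 (fun y => y ^+ n * expR (- y))
      (n%:R * x^-1 ^+ n.-1 * expR (- x^-1) + x^-1 ^+ n * (expR (- x^-1) * -1)).
    apply: is_deriveMf.
      split; first exact: exprn_derivable.
      by rewrite exp_derive /GRing.scale /= mulr1.
  have := hderiv_comp (D := [set t | 0 < t]) x0 h2 (is_derive_hderiv _ h1).
  rewrite (_ : _ * _ = flat n.+2 x - n%:R * flat n.+1 x).
    by move=> h; apply: (hderiv_eq _ x0 h) => s s0; rewrite /flat s0.
  rewrite /flat x0.
  rewrite /GRing.scale /= -exprVn; set E := expR _; set y := x^-1. clearbody E y.
  by case: n h2 => [|n] h2; rewrite /= !exprS; ring.
- apply: (hderiv_is_derive (D := [set t | t < 0])).
    exact: (open_nbhs_nbhs (conj (@open_lt _ 0) x0)).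
  rewrite !flat_le0 ?(ltW x0)// mulr0 subr0.
  apply: (hderiv_eq _ _ (hderiv_cst _ (0 : R) x)) => // s s0.
  by rewrite flat_le0// ltW.
- apply: (hderiv_is_derive (D := setT)); first exact: filterT.
  rewrite !flat_le0// mulr0 subr0 => e e0.
  have f0 : 0 < n.+2`!%:R :> R by rewrite ltr0n fact_gt0.
  near=> s => _; rewrite (flat_le0 n (lexx 0)) !subr0 scaler0 subr0.
  rewrite ger0_norm ?flat_ge0// (le_trans (flat_bound n s))//.
  rewrite -(real_normK (num_real s)) expr2 mulrA ler_wpM2r//.
  rewrite mulrC -ler_pdivlMr// -[s]subr0 distrC.
  near: s; apply: (@cvgr_dist_le _ _ _ (nbhs (0 : R)) _ id) => //.
  by rewrite divr_gt0.
Unshelve. all: by end_near. Qed.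

Lemma ndiff_flat k n : ndiff k (flat n).
Proof.
elim: k n => // k IH n; apply: ndiff_derive (flat_derive n) _.
have -> : (fun x => flat n.+2 x - n%:R * flat n.+1 x) =
    (fun x => flat n.+2 x + (- n%:R) * flat n.+1 x).
  by apply/funext => x; rewrite mulNr.
by apply: ndiffD => //; apply: ndiffM => //; exact: ndiff_cst.
Qed.

Definition smooth_bump (x : R) : R := flat 0 (1 + 1 * x) * flat 0 (1 + -1 * x).

Lemma ndiff_bump n : ndiff n smooth_bump.
Proof. by apply: ndiffM; apply: ndiff_affine; exact: ndiff_flat. Qed.

Lemma bump_ge0 x : 0 <= smooth_bump x.
Proof. by rewrite mulr_ge0// flat_ge0. Qed.

Lemma bump_gt0 x : -1 < x < 1 -> 0 < smooth_bump x.
Proof. by move=> x1; rewrite mulr_gt0// flat_gt0//; lra. Qed.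

Lemma bump_eq0 x : 1 <= `|x| -> smooth_bump x = 0.
Proof.
rewrite ler_normr => /orP[|] x1; rewrite /smooth_bump; last by rewrite flat_le0 ?mul0r//; lra.
by rewrite [X in _ * X]flat_le0 ?mulr0//; lra.
Qed.

Lemma continuous_bump : continuous smooth_bump.
Proof.
move=> x; apply: differentiable_continuous; apply/derivable1_diffP.
by have [] := ndiff_bump 1.
Qed.

(** An antiderivative of the bump. Differences of its rescaled translates have compact support and
    an explicit derivative made of two bumps; these are the test functions of the du Bois-Reymond
    argument. *)
Lemma smooth_step : exists S : R -> R,
  [/\ forall x : R, is_derive x 1 S (smooth_bump x), S (-1) < S 1,
      forall x, x <= -1 -> S x = S (-1) & forall x, 1 <= x -> S x = S 1].
Proof.
(* The interval [-2, 2] is wider than the support of the bump, so [clamp] acts only where the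
   antiderivative is already constant. *)
have [|H hH] := @within_antiderivative R (-2) 2 smooth_bump _ (continuous_subspaceT continuous_bump).
  by lra.
have cst a b : -2 <= a -> a <= b -> b <= 2 -> (forall x, a < x < b -> smooth_bump x = 0) ->
    H b = H a.
  move=> a2 ab b2 h0.
  have sub s : a <= s <= b -> -2 <= s <= 2 by lra.
  have := @hderiv_norm_le _ a b H (fun=> 0) smooth_bump (fun=> 0) ab.
  rewrite subrr normr_le0 subr_eq0 => h; apply/eqP/h.
  - move=> t /sub /hH; apply: hderivS => s; rewrite /= !in_itv/=; exact: sub.
  - by move=> t _; exact: hderiv_cst.
  - by move=> t /h0 ->; rewrite normr0.
have Hl x : -2 <= x <= -1 -> H x = H (-1).
  move=> /andP[x2 x1]; apply/esym/cst => // [|y y1]; first by lra.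
  by apply: bump_eq0; rewrite ler_normr; apply/orP; right; lra.
have Hr x : 1 <= x <= 2 -> H x = H 1.
  move=> /andP[x1 x2]; apply: cst => // y y1.
  by apply: bump_eq0; rewrite ler_normr; apply/orP; left; lra.
have H11 : H (-1) < H 1.
  have dH (t : R) : -2 < t < 2 -> is_derive t 1 H (smooth_bump t).
    move=> t2; apply: (@hderiv_is_derive _ `[-2, 2]%classic); first exact: itvoo_nbhs.
    by apply: hH; lra.
  have := @gtr0_derive1_lt_cc R H (-1) 1.
  apply => //; rewrite ?in_itv/=; try lra.
  - move=> x; rewrite in_itv/= => x1.
    have x2 : -2 < x < 2 by lra.
    by have [] := dH x x2.
  - move=> x; rewrite in_itv/= => x1; rewrite derive1E.
    have x2 : -2 < x < 2 by lra.
    have dx := dH x x2; rewrite derive_val; exact: bump_gt0.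
  - apply: (@hderiv_within_continuous _ _ _ _ smooth_bump) => t; rewrite /= in_itv/= => t1.
    apply: (hderivS (D := `[-2, 2]%classic)); last by apply: hH; lra.
    by move=> s; rewrite /= !in_itv/=; lra.
have Scl x : -2 <= x <= 2 -> H (clamp (-2) 2 x) = H x by move=> /clamp_id ->.
have SL x : x <= -1 -> H (clamp (-2) 2 x) = H (-1).
  move=> x1; have [x2|x2] := leP (-2) x; first by rewrite Scl ?Hl//; lra.
  rewrite /clamp min_l; last by lra.
  by rewrite max_l ?Hl//; lra.
have SR x : 1 <= x -> H (clamp (-2) 2 x) = H 1.
  move=> x1; have [x2|x2] := leP x 2; first by rewrite Scl ?Hr//; lra.
  rewrite /clamp min_r ?(ltW x2)//.
  by rewrite max_r ?Hr//; lra.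
exists (fun x => H (clamp (-2) 2 x)); split.
- move=> x; have [xl|xl] := ltP x (-1).
    apply: (hderiv_is_derive (D := [set t | t < -1])).
      exact: (open_nbhs_nbhs (conj (@open_lt _ (-1)) xl)).
    rewrite bump_eq0; last by rewrite ler_normr; apply/orP; right; lra.
    apply: (hderiv_eq _ _ (hderiv_cst _ (H (-1)) x)) => // s s0.
    by rewrite SL// ltW.
  have [xr|xr] := ltP 1 x.
    apply: (hderiv_is_derive (D := [set t | 1 < t])).
      exact: (open_nbhs_nbhs (conj (@open_gt _ 1) xr)).
    rewrite bump_eq0; last by rewrite ler_normr; apply/orP; left; lra.
    apply: (hderiv_eq _ _ (hderiv_cst _ (H 1) x)) => // s s0.
    by rewrite SR// ltW.
  have x2 : -2 <= x <= 2 by lra.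
  apply: (@hderiv_is_derive _ `[-2, 2]%classic); first by apply: itvoo_nbhs; lra.
  apply: (hderiv_eq _ _ (hH x x2)); last by rewrite /= in_itv.
  by move=> s; rewrite /= in_itv/= => s2; rewrite Scl.
- by rewrite SL// SR.
- by move=> x x1; rewrite !SL.
- by move=> x x1; rewrite !SR.
Qed.

End smooth.

(** * The du Bois-Reymond lemma *)

Section du_bois_reymond.
Context {R : realType}.
Local Notation mu := (@lebesgue_measure R).
Variable T : R.
Hypothesis T0 : 0 < T.

Let I := `[0, T]%classic : set R.
Local Notation cont h := {within I, continuous (h : R -> R)}.

Lemma contD f g : cont f -> cont g -> cont (fun t => f t + g t).
Proof.
move=> /subspace_continuousP cf /subspace_continuousP cg.
by apply/subspace_continuousP => t It; apply: cvgD; [exact: cf|exact: cg].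
Qed.

Lemma contM f g : cont f -> cont g -> cont (fun t => f t * g t).
Proof.
move=> /subspace_continuousP cf /subspace_continuousP cg.
by apply/subspace_continuousP => t It; apply: cvgM; [exact: cf|exact: cg].
Qed.

Lemma contN f : cont f -> cont (fun t => - f t).
Proof.
move=> /subspace_continuousP cf.
by apply/subspace_continuousP => t It; apply: cvgN; exact: cf.
Qed.

Lemma contB f g : cont f -> cont g -> cont (fun t => f t - g t).
Proof. by move=> cf cg; apply: contD => //; exact: contN. Qed.

Lemma cont_cst (c : R) : cont (fun=> c).
Proof. by apply: continuous_subspaceT => x; exact: cvg_cst. Qed.

Lemma cont_derivable (f : R -> R) : (forall x : R, derivable f x 1) -> cont f.
Proof.
move=> df; apply: continuous_subspaceT => x.
by apply: differentiable_continuous; apply/derivable1_diffP.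
Qed.

Lemma cont_integrable f : cont f -> mu.-integrable I (EFin \o f).
Proof. by move=> cf; apply: continuous_compact_integrable => //; exact: segment_compact. Qed.

Let measurable_I : measurable I. Proof. exact: measurable_itv. Qed.

Lemma Rint_hderiv F f : (forall t, 0 <= t <= T -> hderiv I F t (f t)) -> cont f ->
  (\int[mu]_(t in I) f t)%R = F T - F 0.
Proof.
move=> hF cf.
have dF t : t \in `]0, T[ -> is_derive t 1 F (f t).
  rewrite in_itv/= => t0; apply: (hderiv_is_derive (D := I)); first exact: itvoo_nbhs.
  by apply: hF; case/andP: t0 => /ltW -> /ltW ->.
have cF : cont F by apply: hderiv_within_continuous => t; rewrite /I /= in_itv/=; exact: hF.
have [_ F0 FT] := (continuous_within_itvP F T0).1 cF.
rewrite /Rintegral (@continuous_FTC2 _ f F 0 T T0)//.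
  by split => // t /dF [].
by move=> t /dF dt; rewrite derive1E; exact: derive_val.
Qed.

Lemma test_hderiv phi k t : test_function T phi ->
  hderiv I (derive1n k phi) t (derive1n k.+1 phi t).
Proof.
move=> [dphi _]; apply: is_derive_hderiv; rewrite /derive1n iterS derive1E.
by apply/derivableP; exact: dphi.
Qed.

Lemma test_cont phi k : test_function T phi -> cont (derive1n k phi).
Proof. by move=> [dphi _]; apply: cont_derivable; exact: dphi. Qed.

(** The function vanishes on the open half-lines left of [a] and right of [b], which contain 0 and
    T, and derivatives of a locally zero function are zero. *)
Lemma test_ends phi k : test_function T phi ->
  derive1n k phi 0 = 0 /\ derive1n k phi T = 0.
Proof.
move=> [dphi [a [b [a0 bT supp]]]].
suff : (forall t, t < a -> derive1n k phi t = 0) /\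
       (forall t, b < t -> derive1n k phi t = 0) by move=> [h1 h2]; rewrite h1 ?h2.
elim: k => [|k [IH1 IH2]].
  split=> t ht; apply/eqP/negPn/negP => /supp /andP[]; rewrite leNgt.
    by rewrite ht.
  by move=> _; rewrite leNgt ht.
split=> t ht; rewrite /derive1n iterS derive1E.
- suff h : is_derive t 1 (derive1n k phi) 0 by exact: derive_val.
  apply: (hderiv_is_derive (D := [set t | t < a])).
    exact: (open_nbhs_nbhs (conj (@open_lt _ a) ht)).
  by apply: (hderiv_eq _ _ (hderiv_cst _ (0 : R) t)) => // s /= sa; rewrite IH1.
- suff h : is_derive t 1 (derive1n k phi) 0 by exact: derive_val.
  apply: (hderiv_is_derive (D := [set t | b < t])).
    exact: (open_nbhs_nbhs (conj (@open_gt _ b) ht)).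
  by apply: (hderiv_eq _ _ (hderiv_cst _ (0 : R) t)) => // s /= sa; rewrite IH2.
Qed.

(** If k b < k a, take a test function that steps up at [a] and down at [b]. Its derivative, a bump
    at [a] minus a bump at [b], has zero integral, so the mean [m] may be subtracted from [k]; then
    k - m is positive on the first bump and negative on the second, and the integral cannot
    vanish. *)
Lemma du_bois_reymond k : cont k ->
  (forall phi, test_function T phi -> (\int[mu]_(t in I) (k t * derive1n 1 phi t))%R = 0) ->
  forall a b, 0 < a < T -> 0 < b < T -> k a = k b.
Proof.
move=> ck kphi.
suff le a b : 0 < a < T -> 0 < b < T -> k a <= k b.
  by move=> a b a0 b0; apply/eqP; rewrite eq_le !le.
move=> a0 b0; rewrite leNgt; apply/negP => kba.
(* [k a] lies 2 d above [m] and [k b] lies 2 d below it, so a variation of [k] by at most [d] leaves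
   the margin [d]. *)
pose d := (k a - k b) / 4; pose m := (k a + k b) / 2.
have d0 : 0 < d by rewrite divr_gt0// subr_gt0.
have [S [dS S1 SL SR]] := @smooth_step R.
have near_k c : 0 < c < T -> exists2 e, 0 < e &
    forall t, `|t - c| < e -> 0 < t < T /\ `|k t - k c| <= d.
  move=> c0; have Ic : I c by rewrite /I /= in_itv/= !ltW//; case/andP: c0.
  have nI : \forall t \near c, 0 < t < T.
    have : c \in `]0, T[ by rewrite in_itv.
    by move=> /near_in_itvoo; apply: filterS => t; rewrite in_itv.
  move/subspace_continuousP : ck => /(_ c Ic) /cvgrPdist_le /(_ _ d0) h.
  have {}h : \forall t \near c, I t -> `|k c - k t| <= d by exact: h.
  have [e /= e0 he] := filterI nI h.
  exists e => // t tc; have [t0 ht] : 0 < t < T /\ (I t -> `|k c - k t| <= d).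
    by apply: he; rewrite /= distrC.
  split => //; rewrite distrC; apply: ht; rewrite /I /= in_itv/=.
  by case/andP: t0 => /ltW -> /ltW ->.
have [ea ea0 hea] := near_k a a0.
have [eb eb0 heb] := near_k b b0.
pose e := Num.min ea eb / 2.
have e0 : 0 < e by rewrite divr_gt0// lt_min ea0.
have eea : e < ea by rewrite /e; case: (leP ea eb); lra.
have eeb : e < eb by rewrite /e; case: (leP ea eb); lra.
pose Sc c t := S (- c / e + e^-1 * t).
have ScE c t : - c / e + e^-1 * t = (t - c) / e by ring.
have dSc (c t : R) : is_derive t 1 (Sc c) (e^-1 * smooth_bump ((t - c) / e)).
  by rewrite -ScE; apply: is_derive_affine; exact: dS.
have nS n : ndiff n S.
  case: n => // n; apply: ndiff_derive dS _; exact: ndiff_bump.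
pose phi t := Sc a t + (-1) * Sc b t.
have dphi (t : R) : is_derive t 1 phi (e^-1 * (smooth_bump ((t - a) / e) - smooth_bump ((t - b) / e))).
  have hc : is_derive t 1 (fun=> -1 : R) 0 by exact: is_derive_cst.
  have h := is_deriveDf (dSc a t) (is_deriveMf hc (dSc b t)).
  by apply: is_derive_eq h _; ring.
have phi1 : derive1n 1 phi =
    (fun t => e^-1 * (smooth_bump ((t - a) / e) - smooth_bump ((t - b) / e))).
  by apply/funext => t; rewrite /derive1n /= derive1E; apply: derive_val.
have bump_out c t : e <= `|t - c| -> smooth_bump ((t - c) / e) = 0.
  move=> h; apply: bump_eq0; rewrite normrM normfV (gtr0_norm e0).
  by rewrite ler_pdivlMr// mul1r.
have ra t : `|t - a| <= e -> 0 < t < T by move=> h; apply: (hea t _).1; exact: le_lt_trans eea.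
have rb t : `|t - b| <= e -> 0 < t < T by move=> h; apply: (heb t _).1; exact: le_lt_trans eeb.
have a1 := ra (a - e); have a2 := ra (a + e).
have b1 := rb (b - e); have b2 := rb (b + e).
have {}a1 : 0 < a - e < T by apply: a1; rewrite addrAC subrr add0r normrN gtr0_norm.
have {}b1 : 0 < b - e < T by apply: b1; rewrite addrAC subrr add0r normrN gtr0_norm.
have {}a2 : 0 < a + e < T by apply: a2; rewrite addrAC subrr add0r gtr0_norm.
have {}b2 : 0 < b + e < T by apply: b2; rewrite addrAC subrr add0r gtr0_norm.
have ScL c t : t <= c - e -> Sc c t = S (-1).
  by move=> h; rewrite /Sc ScE SL// ler_pdivrMr//; lra.
have ScR c t : c + e <= t -> Sc c t = S 1.
  by move=> h; rewrite /Sc ScE SR// ler_pdivlMr//; lra.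
have tphi : test_function T phi.
  split.
    apply: derivable_ndiff => n; apply: ndiffD; first exact: ndiff_affine.
    by apply: ndiffM; [exact: ndiff_cst|exact: ndiff_affine].
  exists (Num.min (a - e) (b - e)), (Num.max (a + e) (b + e)); split.
  - by rewrite lt_min; case/andP: a1 => ->; case/andP: b1 => ->.
  - by rewrite gt_max; case/andP: a2 => _ ->; case/andP: b2 => _ ->.
  move=> t; apply: contraR; rewrite negb_and -!ltNge => /orP[|].
    rewrite lt_min => /andP[/ltW ta /ltW tb].
    by rewrite /phi !ScL// mulN1r subrr.
  rewrite gt_max => /andP[/ltW ta /ltW tb].
  by rewrite /phi !ScR// mulN1r subrr.
have cbump c : cont (fun t => smooth_bump ((t - c) / e)).
  have -> : (fun t => smooth_bump ((t - c) / e)) =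
      (fun t => smooth_bump (- c / e + e^-1 * t)).
    by apply/funext => t; rewrite ScE.
  by apply: cont_derivable; have [] := ndiff_affine (- c / e) e^-1 (@ndiff_bump R 1).
have cphi1 : cont (derive1n 1 phi) by exact: test_cont.
have i1 : (\int[mu]_(t in I) derive1n 1 phi t)%R = 0.
  rewrite (@Rint_hderiv phi)//; last by move=> t _; exact: (test_hderiv 0).
  by have [] := test_ends 0 tphi; rewrite /derive1n /= => -> ->; rewrite subrr.
have i2 : (\int[mu]_(t in I) ((k t - m) * derive1n 1 phi t))%R = 0.
  have j1 : (\int[mu]_(t in I) (m * derive1n 1 phi t))%R = 0.
    rewrite RintegralZl; [|exact: measurable_I|exact: cont_integrable].
    by rewrite i1 mulr0.
  under eq_Rintegral do rewrite mulrBl.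
  rewrite RintegralB; [|exact: measurable_I|exact: cont_integrable (contM ck cphi1)
    |by apply: cont_integrable; apply: contM => //; exact: cont_cst].
  by rewrite kphi// j1 subr0.
(* With both steps upwards, d psi' bounds (k - m) phi' from below and has positive integral. The two
   bumps are compared one by one, so no disjointness is used. *)
pose psi t := Sc a t + Sc b t.
pose psi' t := e^-1 * smooth_bump ((t - a) / e) + e^-1 * smooth_bump ((t - b) / e).
have cpsi' : cont psi'.
  by apply: contD; apply: contM; by [exact: cont_cst|exact: cbump].
have i3 : (\int[mu]_(t in I) (d * psi' t))%R = d * (2 * (S 1 - S (-1))).
  rewrite RintegralZl; [|exact: measurable_I|exact: cont_integrable].
  congr (_ * _); rewrite (@Rint_hderiv psi)//; last first.
    by move=> t _; apply: is_derive_hderiv; exact: is_deriveDf.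
  have aT : Sc a T = S 1 by apply: ScR; lra.
  have bT : Sc b T = S 1 by apply: ScR; lra.
  have aO : Sc a 0 = S (-1) by apply: ScL; lra.
  have bO : Sc b 0 = S (-1) by apply: ScL; lra.
  by rewrite /psi aT bT aO bO; ring.
have : (\int[mu]_(t in I) (d * psi' t))%R <= (\int[mu]_(t in I) ((k t - m) * derive1n 1 phi t))%R.
  apply: le_Rintegral => //.
  - by apply: cont_integrable; apply: contM => //; exact: cont_cst.
  - by apply: cont_integrable; apply: contM => //; apply: contB => //; exact: cont_cst.
  move=> t It; rewrite phi1 /psi'.
  have ha : d * smooth_bump ((t - a) / e) <= (k t - m) * smooth_bump ((t - a) / e).
    have [h|h] := leP e `|t - a|; first by rewrite bump_out// !mulr0.
    have := (hea t (lt_trans h eea)).2; rewrite ler_norml => /andP[h1 h2].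
    by rewrite ler_wpM2r ?bump_ge0//; move: h1; rewrite /d /m; lra.
  have hb : d * smooth_bump ((t - b) / e) <= - (k t - m) * smooth_bump ((t - b) / e).
    have [h|h] := leP e `|t - b|; first by rewrite bump_out// !mulr0.
    have := (heb t (lt_trans h eeb)).2; rewrite ler_norml => /andP[h1 h2].
    by rewrite ler_wpM2r ?bump_ge0//; move: h2; rewrite /d /m; lra.
  rewrite -mulrDr mulrCA [leRHS]mulrCA ler_pM2l ?invr_gt0//.
  by rewrite mulrDr mulrBr; lra.
rewrite i2 i3 leNgt => /negP; apply.
by rewrite mulr_gt0// mulr_gt0// subr_gt0.
Qed.

Lemma du_bois_reymond_closed k : cont k ->
  (forall phi, test_function T phi -> (\int[mu]_(t in I) (k t * derive1n 1 phi t))%R = 0) ->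
  exists c, forall t, 0 <= t <= T -> k t = c.
Proof.
move=> ck kphi; exists (k (T / 2)).
have hT : 0 < T / 2 < T by move: T0; lra.
have key t : 0 < t < T -> k t = k (T / 2).
  by move=> t0; exact: du_bois_reymond ck kphi _ _ t0 hT.
have [_ k0 kT] := (continuous_within_itvP k T0).1 ck.
move=> t /andP[]; rewrite le_eqVlt => /predU1P[<- _|t0].
  have h : k @ 0^'+ --> k (T / 2).
    apply: cvg_near_cst; near=> s; apply: key; apply/andP; split; near: s.
      exact: nbhs_right_gt.
    exact: nbhs_right_lt.
  exact: (cvg_unique _ k0 h).
rewrite le_eqVlt => /predU1P[->|tT]; last by rewrite key// t0.
have h : k @ T^'- --> k (T / 2).
  apply: cvg_near_cst; near=> s; apply: key; apply/andP; split; near: s.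
    exact: nbhs_left_gt.
  exact: nbhs_left_lt.
exact: (cvg_unique _ kT h).
Unshelve. all: by end_near. Qed.

(** Let [Th] be an antiderivative of r - s. Integrating each term by parts turns the distributional
    identity into the orthogonality of p' - Th to all phi', so p' - Th is constant on the closed
    interval and p' inherits the derivative of [Th], one-sided at the ends. *)
Lemma weak_second_derivative (p p' r s : R -> R) :
  (forall t, 0 <= t <= T -> hderiv I p t (p' t)) -> cont p' -> cont r -> cont s ->
  (forall phi, test_function T phi ->
    (\int[mu]_(t in I) (p t * derive1n 2 phi t + s t * phi t))%R =
    (\int[mu]_(t in I) (r t * phi t))%R) ->
  forall t, 0 <= t <= T -> hderiv I p' t (r t - s t).
Proof.
move=> hp cp' cr cs hphi.
pose q t := r t - s t.
have cq : cont q by exact: contB.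
have [Th hTh] := within_antiderivative (ltW T0) cq.
have cp : cont p by apply: hderiv_within_continuous => t; rewrite /I /= in_itv/=; exact: hp.
have cTh : cont Th by apply: hderiv_within_continuous => t; rewrite /I /= in_itv/=; exact: hTh.
have [|phi tphi|c hc] := @du_bois_reymond_closed (fun t => p' t - Th t).
- exact: contB.
- have c0 : cont phi by have := test_cont (k := 0) tphi.
  have c1 := test_cont (k := 1) tphi; have c2 := test_cont (k := 2) tphi.
  pose F t := p t * derive1n 1 phi t - Th t * phi t.
  pose F' t := (p' t * derive1n 1 phi t + p t * derive1n 2 phi t) -
     (q t * phi t + Th t * derive1n 1 phi t).
  have hF t : 0 <= t <= T -> hderiv I F t (F' t).
    move=> t0; have It : I t by rewrite /I /= in_itv.
    apply: hderivB; apply: hderivM => //.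
    + exact: hp.
    + exact: test_hderiv.
    + exact: hTh.
    + exact: (test_hderiv 0).
  have cF' : cont F'.
    by apply: contB; apply: contD; exact: contM.
  have := Rint_hderiv hF cF'.
  have [e10 e1T] := test_ends 1 tphi; have [e00 e0T] := test_ends 0 tphi.
  rewrite /F e10 e1T -[phi 0]/(derive1n 0 phi 0) -[phi T]/(derive1n 0 phi T) e00 e0T.
  rewrite !mulr0 !subr0 => i0.
  have i1 := hphi phi tphi.
  pose F1 t := (p' t - Th t) * derive1n 1 phi t.
  pose F2 t := p t * derive1n 2 phi t + s t * phi t.
  pose F3 t := r t * phi t.
  have cF1 : cont F1 by apply: contM => //; exact: contB.
  have cF2 : cont F2 by apply: contD; exact: contM.
  have cF3 : cont F3 by exact: contM.
  have i2 : (\int[mu]_(t in I) (F1 t + (F2 t - F3 t)))%R = 0.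
    by rewrite -i0; apply: eq_Rintegral => t _; rewrite /F' /F1 /F2 /F3 /q; ring.
  have i3 : (\int[mu]_(t in I) (F2 t - F3 t))%R = 0.
    rewrite RintegralB; [|exact: measurable_I|exact: cont_integrable cF2|exact: cont_integrable cF3].
    by rewrite /F2 /F3 i1 subrr.
  move: i2; rewrite RintegralD; [|exact: measurable_I|exact: cont_integrable cF1
    |exact: cont_integrable (contB cF2 cF3)].
  by rewrite i3 addr0.
move=> t t0; have It : I t by rewrite /I /= in_itv.
have := hderivD (hTh t t0) (hderiv_cst I c t); rewrite addr0.
apply: hderiv_eq => // x; rewrite /I /= in_itv/= => /hc <-.
by rewrite addrC subrK.
Qed.

End du_bois_reymond.

(** * Essential suprema, second differences and a discrete Gronwall lemma *)

Section linfty.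
Context {R : realType} {E : normedModType R}.
Local Notation mu := (@lebesgue_measure R).

Lemma Linfty_norm_ge0 (t : R) (y : R -> E) : 0 <= Linfty_norm t y.
Proof. by apply: fine_ge0; exact: Lnorm_ge0. Qed.

Lemma Linfty_norm0 (t : R) (y : R -> E) : (forall s, `|y s| = 0) -> Linfty_norm t y = 0.
Proof.
move=> y0; rewrite /Linfty_norm (_ : (fun s => _) = cst 0%E).
  by rewrite Lnorm0.
by apply/funext => s; rewrite y0.
Qed.

Lemma continuous_norm_bounded (a b : R) (y : R -> E) : a <= b ->
  {within `[a, b], continuous y} -> exists M, forall t, a <= t <= b -> `|y t| <= M.
Proof.
move=> ab /subspace_continuousP cy.
have [|c cab hc] := @EVT_max R (fun t => `|y t|) a b ab.
  by apply/subspace_continuousP => t tab; exact: cvg_norm (cy t tab).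
by exists `|y c| => t tab; apply: hc; rewrite in_itv.
Qed.

(** A continuous function that exceeds its essential supremum at [s] exceeds it on an interval
    around [s], of positive measure. Taking [s] in the open interval keeps that neighbourhood inside
    ]0, t[. *)
Lemma Linfty_norm_ge (T t s : R) (y : R -> E) : 0 < s < t -> t <= T ->
  {within `[0, T], continuous y} -> `|y s| <= Linfty_norm t y.
Proof.
move=> st tT cy.
have t0 : 0 < t by case/andP: st; exact: lt_trans.
have T0 : 0 <= T by rewrite (le_trans (ltW t0)).
have [M hM] := continuous_norm_bounded T0 cy.
set nu := mrestr mu (measurable_itv `]0, t[).
have nuT : (0 < nu [set: R])%E.
  rewrite /nu /mrestr setTI lebesgue_measure_itv /= lte_fin t0 -EFinD lte_fin subr0.
  exact: t0.
rewrite /Linfty_norm -/nu.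
have -> : Lnorm nu +oo (fun s => `|y s|%:E) = ess_sup nu (abse \o (fun s => `|y s|%:E)).
  by rewrite unlock nuT.
set f := abse \o _.
have fE x : f x = `|y x|%:E by rewrite /f /= normr_id.
have leM : (ess_sup nu f <= M%:E)%E.
  (* [y] is bounded only on [0, T], but the complement of ]0, t[ is null for the restricted
     measure. *)
  apply/ess_supP; exists (~` `]0, t[%classic); split.
  - exact: measurableC.
  - have h : mu (~` `]0, t[%classic `&` `]0, t[%classic) = 0%E.
      by rewrite setICl measure0.
    exact: h.
  - move=> x /= hx; apply: contra_not hx => x0t; rewrite fE lee_fin hM//.
    move: x0t; rewrite in_itv/= => /andP[/ltW -> /ltW/le_trans->//].
have ge0 : (0 <= ess_sup nu f)%E.
  by apply: ess_sup_gee => //; apply: nearW => x; rewrite fE lee_fin.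
(* Finiteness matters because [fine] sends an infinite value to 0. *)
have fin : ess_sup nu f \is a fin_num.
  by rewrite ge0_fin_numE// (le_lt_trans leM)// ltry.
rewrite leNgt; apply/negP => lt.
have [B [mB nuB subB]] := ess_sup_ge nu f.
have Is : `[0, T]%classic s.
  by rewrite /= in_itv/=; case/andP: st => /ltW -> /ltW/le_trans->.
have n1 : \forall x \near s, x \in `]0, t[.
  by apply: near_in_itvoo; rewrite in_itv.
have n2 : \forall x \near s, `[0, T]%classic x -> fine (ess_sup nu f) < `|y x|.
  move/subspace_continuousP : cy => /(_ s Is) /cvg_norm /cvgr_gt /(_ _ lt).
  exact.
have [d /= d0 hd] := filterI n1 n2.
have sub : `](s - d), (s + d)[%classic `<=` B `&` `]0, t[%classic.
  move=> x; rewrite /= in_itv/= => xs.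
  have [xt hx] : (x \in `]0, t[) /\ (`[0, T]%classic x -> fine (ess_sup nu f) < `|y x|).
    by apply: hd => /=; rewrite ltr_norml; lra.
  split => //; apply: subB => /= h.
  move: h; rewrite fE -(fineK fin) lee_fin leNgt hx//.
  by move: xt; rewrite /= !in_itv/= => /andP[/ltW -> /ltW/le_trans->].
pose J : set R := `](s - d), (s + d)[%classic.
pose K : set R := B `&` `]0, t[%classic.
have z : mu K = 0%E by exact: nuB.
have : (mu J <= mu K)%E.
  by apply: le_measure => //; rewrite inE; [exact: measurable_itv|
    apply: measurableI => //; exact: measurable_itv].
rewrite z /J lebesgue_measure_itv /= lte_fin.
have -> : s - d < s + d by lra.
by rewrite -EFinD lee_fin leNgt => /negP; apply; lra.
Qed.

End linfty.

Section second_difference.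
Context {R : realType} {E : completeNormedModType R}.
Variable dot : {dot E for (@idfun R)}.
Hypothesis hil : hilbert_dot dot.

(** Pairing with the second difference [x] itself leaves a scalar function [q]: its first derivative
    vanishes at 0 and its second is at most 2 M |x|, so two integrations give M s^2 |x|. *)
Lemma second_difference_le (T t tau M : R) (r r1 r2 : R -> E) :
  tau <= t -> t + tau <= T ->
  (forall x, 0 <= x <= T -> hderiv `[0, T] r x (r1 x)) ->
  (forall x, 0 <= x <= T -> hderiv `[0, T] r1 x (r2 x)) ->
  0 <= M -> (forall x, 0 < x < t + tau -> `|r2 x| <= M) ->
  forall s, 0 <= s <= tau -> `|r (t + s) + r (t - s) - 2 *: r t| <= M * s ^+ 2.
Proof.
move=> taut tT hr hr1 M0 hM s /andP[s0 st].
set x := _ - _; apply: (dot_self_le _ (mulr_ge0 M0 (sqr_ge0 s))).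
pose q a := dot (r (t + 1 * a) + r (t + -1 * a)) x.
pose q1 a := dot (1 *: r1 (t + 1 * a) + -1 *: r1 (t + -1 * a)) x.
pose q2 a := dot (1 *: (1 *: r2 (t + 1 * a)) + -1 *: (-1 *: r2 (t + -1 * a))) x.
have I1 b a : b <= tau -> `[0, b]%classic a -> `[0, T]%classic (t + 1 * a).
  by move=> ?; rewrite /= !in_itv/=; lra.
have I2 b a : b <= tau -> `[0, b]%classic a -> `[0, T]%classic (t + -1 * a).
  by move=> ?; rewrite /= !in_itv/=; lra.
have hq b a : b <= tau -> 0 <= a <= b -> hderiv `[0, b] q a (q1 a).
  move=> bt a0; apply: (hderiv_dotl hil); apply: hderivD.
    by apply: (hderiv_affine (I1 b ^~ bt)); apply: hr; lra.
  by apply: (hderiv_affine (I2 b ^~ bt)); apply: hr; lra.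
have hq1 b a : b <= tau -> 0 <= a <= b -> hderiv `[0, b] q1 a (q2 a).
  move=> bt a0; apply: (hderiv_dotl hil); apply: hderivD; apply: hderivZ.
    by apply: (hderiv_affine (I1 b ^~ bt)); apply: hr1; lra.
  by apply: (hderiv_affine (I2 b ^~ bt)); apply: hr1; lra.
have bq1 b : 0 <= b <= tau -> `|q1 b| <= 2 * M * `|x| * b.
  move=> /andP[b0 bt].
  have := @hderiv_norm_le _ 0 b q1 (fun a => (2 * M * `|x|) * a) q2 (fun=> (2 * M * `|x|) * 1) b0.
  have -> : q1 0 = 0 by rewrite /q1 !mulr0 addr0 scaleN1r scale1r subrr linear0l.
  rewrite mulr0 !subr0; apply => [a|a _|a a0].
  - exact: hq1.
  - by apply: hderivMl; exact: hderiv_id.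
  - apply: (le_trans (dot_cauchy_schwarz hil _ _)); rewrite mulr1 ler_wpM2r//.
    rewrite !scale1r !scaleN1r opprK (le_trans (ler_normD _ _))// mulr_natl mulr2n.
    by rewrite lerD// hM//; lra.
have := @hderiv_norm_le _ 0 s q (fun a => (M * `|x|) * a ^+ 2) q1
  (fun a => (M * `|x|) * (2%:R * a ^+ 1)) s0.
rewrite expr0n mulr0 subr0 => h.
have {h} : `|q s - q 0| <= M * `|x| * s ^+ 2.
  apply: h => [a|a _|a a0]; first exact: hq.
    by apply: hderivMl; exact: hderivX.
  have := bq1 a; rewrite expr1 => h1.
  have h2 : 0 <= a <= tau by lra.
  by apply: (le_trans (h1 h2)); rewrite le_eqVlt; apply/orP; left; apply/eqP; ring.
have -> : q s - q 0 = `|x| ^+ 2.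
  have e : r (t + 1 * s) + r (t + -1 * s) - (r (t + 1 * 0) + r (t + -1 * 0)) = x.
    by rewrite /x mul1r mulN1r !mulr0 !addr0 scaler_nat mulr2n.
  by rewrite -hil -{1}e (dotDl dot) (dotNl dot).
by rewrite ger0_norm ?sqr_ge0// mulrAC.
Qed.

End second_difference.

Section gronwall.
Context {R : realType}.
Implicit Types x y th : R.

Lemma cosh_ge1 x : 1 <= cosh x.
Proof.
rewrite /cosh ler_pdivlMr// mul1r.
have e0 := expR_gt0 x; have h : expR x * expR (- x) = 1 by rewrite -expRD subrr expR0.
have := sqr_ge0 (expR x - 1); have f0 := expR_gt0 (- x).
have h2 : 0 <= expR (- x) * (expR x - 1) ^+ 2 by rewrite mulr_ge0 ?sqr_ge0// ltW.
have h3 : expR (- x) * (expR x - 1) ^+ 2 =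
   (expR x * expR (- x)) * expR x - 2 * (expR x * expR (- x)) + expR (- x) by ring.
by rewrite h3 h in h2; lra.
Qed.

Lemma sinh_ge x : 0 <= x -> 2 * x <= expR x - expR (- x).
Proof.
move=> x0.
have := @hderiv_le R 0 x (fun t => 2 * t) (fun t => expR t - expR (-1 * t))
  (fun=> 2 * 1) (fun t => expR t * 1 - expR (-1 * t) * (-1 * 1)) x0.
rewrite !mulr0 expR0 subrr !subr0 -[- x]mulN1r; apply => [t _|t t0|t _].
- by apply: hderivMl; exact: hderiv_id.
- have It : `[0, x]%classic t by rewrite /= in_itv.
  apply: hderivB.
    by apply: (@hderiv_comp _ _ expR id) => //; exact: hderiv_id.
  apply: (@hderiv_comp _ _ expR (fun t => -1 * t)) => //.
  by apply: hderivMl; exact: hderiv_id.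
- by have := cosh_ge1 t; rewrite /cosh ler_pdivlMr// !mulr1 mulN1r mulrN1 opprK mul1r.
Qed.

(** cosh x - 1 = 2 sinh^2 (x / 2), and sinh y >= y. *)
Lemma cosh_ge_quadratic x : 0 <= x -> 1 + x ^+ 2 / 2 <= cosh x.
Proof.
move=> x0; have h := @sinh_ge (x / 2) (divr_ge0 x0 (ler0n _ 2)).
have eh : expR (x / 2) * expR (- (x / 2)) = 1 by rewrite -expRD subrr expR0.
have e1 : expR x = expR (x / 2) ^+ 2 by rewrite expr2 -expRD -splitr.
have e2 : expR (- x) = expR (- (x / 2)) ^+ 2.
  by rewrite expr2 -expRD -opprD -splitr.
have h2 : x ^+ 2 <= (expR (x / 2) - expR (- (x / 2))) ^+ 2.
  rewrite ler_sqr ?nnegrE//; lra.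
rewrite /cosh e1 e2; have h3 : (expR (x / 2) - expR (- (x / 2))) ^+ 2 =
  expR (x / 2) ^+ 2 + expR (- (x / 2)) ^+ 2 - 2 * (expR (x / 2) * expR (- (x / 2))) by ring.
by rewrite h3 eh in h2; lra.
Qed.

Lemma coshD x y : cosh (x + y) + cosh (x - y) = 2 * cosh y * cosh x.
Proof.
rewrite /cosh !opprD opprK !expRD.
by field.
Qed.

(** cosh y - cosh x = 2 sinh a sinh b, where [a] and [b] are the half sum and the half
    difference. *)
Lemma ler_cosh x y : 0 <= x -> x <= y -> cosh x <= cosh y.
Proof.
move=> x0 xy.
have E0 (z : R) := expR_gt0 z.
have -> : cosh y = cosh ((y + x) / 2 + (y - x) / 2) by congr cosh; lra.
have -> : cosh x = cosh ((y + x) / 2 - (y - x) / 2) by congr cosh; lra.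
set a := (y + x) / 2; set b := (y - x) / 2.
have a0 : 0 <= a by rewrite /a; lra.
have b0 : 0 <= b by rewrite /b; lra.
have ha := sinh_ge a0; have hb := sinh_ge b0.
have h : 0 <= (expR a - expR (- a)) * (expR b - expR (- b)) by rewrite mulr_ge0//; lra.
rewrite /cosh !opprD opprK !expRD; lra.
Qed.

(** The second difference of cosh(k th) is (2 cosh th - 2) cosh(k th), which is at least th^2 cosh(k
    th), so the sum telescopes; the leftover first difference at 0 has the favourable sign. *)
Lemma cosh_sum_le th n : 0 <= th ->
  \sum_(1 <= k < n.+1) th ^+ 2 * cosh (k%:R * th) <=
  cosh (n.+1%:R * th) - cosh (n%:R * th).
Proof.
move=> th0; elim: n => [|n IH].
  rewrite big_geq// mul0r subr_ge0 {1}/cosh oppr0 expR0.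
  by apply: le_trans (cosh_ge1 _); lra.
rewrite big_nat_recr//=; have h := coshD (n.+1%:R * th) th.
have h1 := cosh_ge_quadratic th0; have h2 := cosh_ge1 (n.+1%:R * th).
have e1 : n.+1%:R * th + th = n.+2%:R * th by rewrite !mulrS; ring.
have e2 : n.+1%:R * th - th = n%:R * th by rewrite !mulrS; ring.
rewrite e1 e2 in h.
have h3 : (1 + th ^+ 2 / 2) * cosh (n.+1%:R * th) <= cosh th * cosh (n.+1%:R * th).
  by rewrite ler_wpM2r// (le_trans _ h2).
by move: IH h h3; lra.
Qed.

(** The weight n - k counts the partial sums containing the k-th term, so adding up the differences
    of [cosh_sum_le] telescopes a second time. *)
Lemma cosh_weighted_sum_le th n : 0 <= th ->
  \sum_(1 <= k < n) (n - k)%:R * (th ^+ 2 * cosh (k%:R * th)) <= cosh (n%:R * th) - 1.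
Proof.
move=> th0; elim: n => [|n IH].
  by rewrite big_geq// subr_ge0 cosh_ge1.
have [->|n0] := posnP n; first by rewrite big_geq// subr_ge0 cosh_ge1.
have -> : \sum_(1 <= k < n.+1) (n.+1 - k)%:R * (th ^+ 2 * cosh (k%:R * th)) =
  \sum_(1 <= k < n) (n - k)%:R * (th ^+ 2 * cosh (k%:R * th)) +
  \sum_(1 <= k < n.+1) th ^+ 2 * cosh (k%:R * th).
  rewrite big_nat_recr//= [in RHS]big_nat_recr//= addrA; congr (_ + _); last first.
    by rewrite subSnn mul1r.
  rewrite -big_split /=; apply: eq_big_nat => k /andP[k1 kn].
  by rewrite subSn 1?ltnW// mulrS mulrDl mul1r addrC.
by have := cosh_sum_le n th0; move: IH; lra.
Qed.

(** The weights n - k reflect the linear growth of the Chebyshev operators. The polynomial prefactor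
    is nondecreasing, so it can be frozen at [n] and taken out of the sum; [cosh_weighted_sum_le]
    absorbs what remains. *)
Lemma discrete_gronwall (N : nat) (a : nat -> R) (th c1 c2 : R) :
  0 <= th -> 0 <= c1 -> 0 <= c2 ->
  (forall n, (1 <= n <= N)%N ->
    a n <= n%:R * c1 + \sum_(1 <= k < n) (n - k)%:R * (th ^+ 2 * a k + c2)) ->
  forall n, (1 <= n <= N)%N ->
    a n <= (n%:R * c1 + n%:R ^+ 2 * c2) * cosh (n%:R * th).
Proof.
move=> th0 c10 c20 ha; elim/ltn_ind => n IH nN.
pose M m : R := m%:R * c1 + m%:R ^+ 2 * c2.
have M0 m : 0 <= M m by rewrite addr_ge0// mulr_ge0// ?sqr_ge0.
have MM k : (k < n)%N -> M k <= M n.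
  move=> kn; have h : (k%:R : R) <= n%:R by rewrite ler_nat ltnW.
  by rewrite lerD // ler_wpM2r // ler_sqr ?nnegrE.
apply: (le_trans (ha n nN)).
have h1 : \sum_(1 <= k < n) (n - k)%:R * (th ^+ 2 * a k + c2) <=
    n%:R ^+ 2 * c2 + M n * \sum_(1 <= k < n) (n - k)%:R * (th ^+ 2 * cosh (k%:R * th)).
  have -> : \sum_(1 <= k < n) (n - k)%:R * (th ^+ 2 * a k + c2) =
      \sum_(1 <= k < n) (n - k)%:R * c2 + \sum_(1 <= k < n) (n - k)%:R * (th ^+ 2 * a k).
    by rewrite -big_split /=; apply: eq_big_nat => k _; ring.
  rewrite lerD//.
    apply: (@le_trans _ _ (\sum_(1 <= k < n) n%:R * c2)).
      by rewrite ler_sum_nat// => k _; rewrite ler_wpM2r// ler_nat leq_subr.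
    rewrite big_const_nat iter_addr_0 -[leLHS]mulr_natl mulrA ler_wpM2r// expr2 ler_wpM2r//.
    by rewrite ler_nat leq_subr.
  rewrite big_distrr /= ler_sum_nat// => k /andP[k1 kn].
  rewrite [leRHS]mulrCA ler_wpM2l// mulrCA ler_wpM2l ?sqr_ge0//.
  have h2 : a k <= M k * cosh (k%:R * th).
    apply: IH => //; case/andP: nN => _ nN; rewrite k1 /=.
    by rewrite (leq_trans (ltnW kn)).
  by apply: (le_trans h2); rewrite ler_wpM2r ?MM// (le_trans _ (cosh_ge1 _)).
have h2 := ler_wpM2l (M0 n) (cosh_weighted_sum_le n th0).
by move: h1 h2; rewrite -/(M n) /M; lra.
Qed.

End gronwall.

(** * Exact and numerical solution *)

Lemma within_continuous_comp_bounded (R : realType) (E F : normedModType R)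
    (h : {linear E -> F}) (C : R) (D : set R) (y : R -> E) :
  (forall x, `|h x| <= C * `|x|) -> {within D, continuous y} ->
  {within D, continuous (h \o y)}.
Proof.
move=> hC cy; have ch : continuous h.
  apply: bounded_linear_continuous; apply/linear_boundedP.
  exists C; split; first exact: num_real.
  by move=> M CM x; apply: (le_trans (hC x)); rewrite ler_wpM2r// ltW.
move/subspace_continuousP : cy => cy; apply/subspace_continuousP => t Dt.
by apply: (cvg_comp _ _ (cy t Dt)); exact: ch.
Qed.

Lemma C_on_hderiv (R : realType) (E : normedModType R) (D : set R) k (y : R -> E) i t :
  C_on D k y -> (i < k)%N -> D t ->
  hderiv D (derive_onn D i y) t (derive_onn D i.+1 y t).
Proof. by move=> [C1 _] ik Dt; apply: hderiv_diff_quot; exact: C1. Qed.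

Section exact_solution.
Context {R : realType} {V H Q : completeNormedModType R}.
Variable dotH : {dot H for (@idfun R)}.
Hypothesis hilH : hilbert_dot dotH.
Variables (j : {linear V -> H}) (CVH : R).
Hypothesis hCVH : forall v, `|j v| <= CVH * `|v|.
Variables (B : {linear V -> dual Q}) (A : {linear V -> dual V}).
Hypothesis contA : continuous A.
Variables (Bm : {linear dual Q -> V}) (CBm : R).
Hypotheses (invB : is_right_inverse A B Bm) (hCBm : forall q, `|Bm q| <= CBm * `|q|).
Variables (T : R) (f : R -> H -> H) (g : R -> dual Q) (u0 : V) (w0 : H) (u : R -> V).
Hypothesis T0 : 0 < T.
Hypothesis solu : pdae_solution dotH j A B T f g u0 w0 u.
Hypotheses (C2f : C_on `[0, T] 2 (fun t => f t (j (u t)))) (C4g : C_on `[0, T] 4 g).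

Let I := `[0, T]%classic : set R.

Definition dotl (w : H) : {linear H -> R^o} :=
  HB.pack (dotH ^~ w : H -> R^o)
    (GRing.isLinear.Build R H R^o *:%R (dotH ^~ w) (dot_linearl dotH w)).

Lemma dotl_bounded w x : `|dotl w x| <= `|w| * `|x|.
Proof. by rewrite mulrC; exact: dot_cauchy_schwarz. Qed.

Definition forcing (t : R) : H :=
  f t (j (u t)) - j (Bm (derive_onn I 2 g t)).

(** Subtracting B^- g moves the solution into [V_ker]. The image of B^- is [V_c], so A (B^- g)
    vanishes on [V_ker] and [g] survives only through its second derivative in [forcing]. *)
Lemma exact_weak_wave : weak_wave dotH j B A T (fun t => u t - Bm (g t))
  (fun t => derive_on I (j \o u) t - j (Bm (derive_onn I 1 g t))) forcing.
Proof.
have [cBm Bright rBm] := invB.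
have [cu [C1u C1u'] [lam _ hlam] Bu _] := solu.
have bj : forall v, `|j v| <= CVH * `|v| := hCVH.
have cg : {within I, continuous g} by exact: (C4g.2 0%N).
have dg i t : (i < 4)%N -> 0 <= t <= T ->
    hderiv I (Bm \o derive_onn I i g) t (Bm (derive_onn I i.+1 g t)).
  move=> i4 t0; apply: (hderiv_comp_linear hCBm); apply: (C_on_hderiv C4g i4).
  by rewrite /= in_itv.
have djg i t : (i < 4)%N -> 0 <= t <= T ->
    hderiv I (j \o (Bm \o derive_onn I i g)) t (j (Bm (derive_onn I i.+1 g t))).
  by move=> i4 t0; apply: (hderiv_comp_linear bj); exact: dg.
have du t : 0 <= t <= T -> hderiv I (j \o u) t (derive_on I (j \o u) t).
  by move=> t0; apply: hderiv_diff_quot; apply: (C1u 0%N) => //; rewrite /= in_itv.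
split.
- move/subspace_continuousP : (cu) => cu'.
  move/subspace_continuousP : (within_continuous_comp_bounded hCBm cg) => cBg.
  apply/subspace_continuousP => t It; apply: cvgB; [exact: cu'|exact: cBg].
- move=> t t0; rewrite /Vker /= linearB Bright Bu ?subrr//.
- move=> t t0; have It : I t by rewrite /I /= in_itv.
  have := hderivB (du t t0) (djg 0%N t isT t0) => h.
  by apply: (hderiv_eq _ It h) => s _; rewrite /= linearB.
- move=> t w t0 kw; have It : I t by rewrite /I /= in_itv.
  have Aw : linear (fun v => A v w : R^o) by move=> c x z; rewrite linearP.
  pose Aw' : {linear V -> R^o} := HB.pack (fun v => A v w : R^o)
    (GRing.isLinear.Build R V R^o *:%R (fun v => A v w : R^o) Aw).
  have [CA CA0 hA] := A_bounded contA.
  have bAw x : `|Aw' x| <= CA * `|w| * `|x| by rewrite mulrAC; exact: hA.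
  have cp' : {within I, continuous (dotl (j w) \o derive_on I (j \o u))}.
    exact: within_continuous_comp_bounded (dotl_bounded (j w)) (C1u' 1%N isT).
  have cr : {within I, continuous (dotl (j w) \o (fun t => f t (j (u t))))}.
    exact: within_continuous_comp_bounded (dotl_bounded (j w)) (C2f.2 0%N isT).
  have cs : {within I, continuous (Aw' \o u)}.
    exact: within_continuous_comp_bounded bAw cu.
  have := @weak_second_derivative R T T0 (fun t => dotH (j (u t)) (j w))
    (dotl (j w) \o derive_on I (j \o u)) (dotl (j w) \o (fun t => f t (j (u t))))
    (Aw' \o u) _ cp' cr cs _ t t0.
  have hp x : 0 <= x <= T -> hderiv I (fun t => dotH (j (u t)) (j w)) x
      (dotH (derive_on I (j \o u) x) (j w)).
    by move=> x0; exact: (hderiv_dotl hilH _ (du x x0)).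
  move=> /(_ hp) h.
  have {}h : hderiv I (dotl (j w) \o derive_on I (j \o u)) t
      (dotH (f t (j (u t))) (j w) - A (u t) w).
    apply: h => phi tphi; have := hlam phi w tphi.
    by have -> : B w = 0 by []; rewrite [X in _ + X](_ : _ = 0) ?addr0.
  have h2 := hderiv_dotl hilH (j w) (djg 1%N t isT t0).
  have -> : - A (u t - Bm (g t)) w + dotH (forcing t) (j w) =
      dotH (f t (j (u t))) (j w) - A (u t) w - dotH (j (Bm (derive_onn I 2 g t))) (j w).
    have Bmg : A (Bm (g t)) w = 0.
      have : Vc A B (Bm (g t)) by rewrite -rBm; exists (g t).
      exact.
    rewrite /forcing dotDl dotNl linearB.
    rewrite -[(A (u t) - A (Bm (g t))) w]/(A (u t) w - A (Bm (g t)) w) Bmg subr0.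
    by ring.
  by apply: (hderiv_eq _ It (hderivB h h2)) => s _; rewrite dotDl dotNl.
Qed.

Lemma forcing_derivative i t : (i < 2)%N -> 0 <= t <= T ->
  hderiv I (fun t => derive_onn I i (fun t => f t (j (u t))) t
      - j (Bm (derive_onn I i.+2 g t))) t
    (derive_onn I i.+1 (fun t => f t (j (u t))) t
      - j (Bm (derive_onn I i.+3 g t))).
Proof.
move=> i2 t0; have It : I t by rewrite /I /= in_itv.
apply: hderivB; first exact: (C_on_hderiv C2f).
apply: (hderiv_comp_linear (f := j) (y := Bm \o derive_onn I i.+2 g) hCVH).
by apply: (hderiv_comp_linear hCBm); exact: (C_on_hderiv C4g).
Qed.

End exact_solution.

Section numerical_solution.
Context {R : realType} {V H Q : completeNormedModType R}.
Variables (dotV : {dot V for (@idfun R)}) (dotH : {dot H for (@idfun R)}).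
Hypotheses (hilV : hilbert_dot dotV) (hilH : hilbert_dot dotH).
Variables (j : {linear V -> H}) (CVH : R).
Hypothesis hCVH : forall v, `|j v| <= CVH * `|v|.
Variables (B : {linear V -> dual Q}) (A A1 : {linear V -> dual V}) (A2 : {linear V -> H}).
Hypotheses (contB : continuous B) (contA : continuous A).
Hypothesis splitA : forall v w, A v w = A1 v w + dotH (A2 v) (j w).
Hypothesis symA1 : forall v w, Vker B v -> Vker B w -> A1 v w = A1 w v.
Variables (mu1 C2 : R).
Hypotheses (mu10 : 0 < mu1) (ellA1 : elliptic_on_Vker B mu1 A1).
Hypotheses (C20 : 0 <= C2) (hC2 : forall v, `|A2 v| <= C2 * `|v|).
Let kappa := C2 / Num.sqrt mu1.
Variable cosK : R -> H -> H.
Hypothesis hcosK : is_operator_cosine dotH j A B cosK.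
Local Notation Hker := (Hker j B).
Local Notation chebU := (chebU cosK).

Lemma cosK_sum t m (F : nat -> H) : 0 <= t -> (forall k, (k < m)%N -> Hker (F k)) ->
  Hker (\sum_(0 <= k < m) F k) /\
  cosK t (\sum_(0 <= k < m) F k) = \sum_(0 <= k < m) cosK t (F k).
Proof.
move=> t0; elim: m => [|m IH] hF.
  by rewrite !big_geq//; split; [exact: Hker0|exact: (cosK0r hcosK)].
have [|h1 h2] := IH; first by move=> k km; apply: hF; rewrite ltnS ltnW.
rewrite !big_nat_recr//=; split; first by apply: HkerD => //; exact: hF.
by rewrite (cosKD hcosK)// ?h2//; exact: hF.
Qed.

(** Discrete variation of constants: the defect [de k] is propagated by U_(n-k-1). The starting
    error [e 1] counts as the defect at index 0. *)
Lemma cheb_solution (N : nat) (tau : R) (e de : nat -> H) : 0 <= tau ->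
  e 0%N = 0 -> de 0%N = e 1%N ->
  (forall n, (1 <= n < N)%N -> [/\ Hker (e n), Hker (de n) &
     e n.+1 = 2 *: cosK tau (e n) - e n.-1 + de n]) ->
  forall n, (n <= N)%N -> e n = \sum_(0 <= k < n) chebU tau (de k) (n - k).
Proof.
move=> tau0 e0 de0 hrec.
have S0 : e 0%N = \sum_(0 <= k < 0) chebU tau (de k) (0 - k) by rewrite big_geq.
have S1 : e 1%N = \sum_(0 <= k < 1) chebU tau (de k) (1 - k).
  by rewrite big_nat1 subn0 chebU1 de0.
suff key n : (n < N)%N -> e n = \sum_(0 <= k < n) chebU tau (de k) (n - k) /\
    e n.+1 = \sum_(0 <= k < n.+1) chebU tau (de k) (n.+1 - k).
  by case=> [//|n nN]; have [] := key n nN.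
elim: n => [//|n IH] nN; have [h1 h2] := IH (ltnW nN); split => //.
have [_ _ ->] := hrec n.+1 nN.
have hde k : (k < N)%N -> Hker (de k).
  case: k => [|k] kN; last by have [] := hrec k.+1 kN.
  by rewrite de0; have [] := hrec 1%N (leq_ltn_trans (ltn0Sn _) nN).
rewrite [RHS]big_nat_recr//= subSnn chebU1; congr (_ + _).
have -> : \sum_(0 <= k < n.+1) chebU tau (de k) (n.+2 - k) =
    \sum_(0 <= k < n.+1) (2 *: cosK tau (chebU tau (de k) (n.+1 - k)) -
      chebU tau (de k) (n - k)).
  apply: eq_big_nat => k /andP[_ kn].
  by rewrite (subSn (ltnW kn)) subSn// chebUSS.
rewrite sumrB -scaler_sumr.
have [|_ <-] := @cosK_sum tau n.+1 (fun k => chebU tau (de k) (n.+1 - k)) tau0.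
  move=> k kn; apply: (chebU_Hker hcosK) => //; apply: hde.
  exact: ltn_trans kn nN.
(* The second sum runs one index further than the formula for [e n]; its last term is [chebU _ _ 0],
   which is 0. *)
rewrite -h2 [in RHS]big_nat_recr//= subnn chebU0 addr0.
by rewrite -h1.
Qed.

End numerical_solution.

(** * Error bound *)

(** Turns identities between vectors into identities between reals, which [ring] decides. *)
Lemma dot_ext (R : realType) (H : completeNormedModType R) (dot : {dot H for (@idfun R)})
    (hil : hilbert_dot dot) (x z : H) : (forall w, dot x w = dot z w) -> x = z.
Proof.
move=> h; apply/eqP; rewrite -subr_eq0 -normr_eq0 -sqrf_eq0 -hil.
by rewrite dotDl dotNl h subrr.
Qed.

Section gautschi_error.
Context {R : realType} {V H Q : completeNormedModType R}.
Variables (dotV : {dot V for (@idfun R)}) (dotH : {dot H for (@idfun R)}).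
Hypotheses (hilV : hilbert_dot dotV) (hilH : hilbert_dot dotH).
Variables (j : {linear V -> H}) (CVH : R).
Hypothesis hCVH : forall v, `|j v| <= CVH * `|v|.
Variables (B : {linear V -> dual Q}) (A A1 : {linear V -> dual V}) (A2 : {linear V -> H}).
Hypotheses (contB : continuous B) (contA : continuous A).
Hypothesis splitA : forall v w, A v w = A1 v w + dotH (A2 v) (j w).
Hypothesis symA1 : forall v w, Vker B v -> Vker B w -> A1 v w = A1 w v.
Variables (mu1 C2 : R).
Hypotheses (mu10 : 0 < mu1) (ellA1 : elliptic_on_Vker B mu1 A1).
Hypotheses (C20 : 0 <= C2) (hC2 : forall v, `|A2 v| <= C2 * `|v|).
Let kappa := C2 / Num.sqrt mu1.
Variables (Bm : {linear dual Q -> V}) (CBm : R).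
Hypotheses (invB : is_right_inverse A B Bm) (hCBm : forall q, `|Bm q| <= CBm * `|q|).
Variables (pi : H -> H) (cosK : R -> H -> H).
Hypotheses (projpi : is_projection_Hker dotH j B pi).
Hypothesis hcosK : is_operator_cosine dotH j A B cosK.
Variables (T LH : R) (f : R -> H -> H) (g : R -> dual Q) (u0 : V) (w0 : H) (u : R -> V).
Hypotheses (T0 : 0 < T) (LH0 : 0 <= LH).
Hypothesis lipf : forall t x z, t \in `[0, T] -> `|f t x - f t z| <= LH * `|x - z|.
Hypothesis solu : pdae_solution dotH j A B T f g u0 w0 u.
Hypotheses (C2f : C_on `[0, T] 2 (fun t => f t (j (u t)))) (C4g : C_on `[0, T] 4 g).

(** [M] bounds the second derivative of the reduced source f - B^- g''. Keeping it abstract allows a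
    bound over [0, T] for the order statement and essential suprema for the explicit estimate. *)
Lemma gautschi_error (N n : nat) (un : nat -> H) (Einit M : R) :
  let tau := T / N%:R in
  let tn := n%:R * tau in
  (0 < N)%N -> un 0%N = j u0 ->
  `|un 1%N - j (u tau)| <= tau ^+ 3 * Einit ->
  gautschi dotH j A B Bm pi cosK T f g N un -> (n <= N)%N -> 0 <= M ->
  (forall s, 0 < s < tn ->
    `|derive_onn `[0, T] 2 (fun t => f t (j (u t))) s
      - j (Bm (derive_onn `[0, T] 4 g s))| <= M) ->
  `|un n - j (u tn)| <=
    tau ^+ 2 * tn * expR (kappa * tn) * cosh (tn * Num.sqrt (expR (kappa * tn) * LH))
    * (Einit + tn * M).
Proof.
move=> tau tn N0 un0 un1 [b hb] nN M0 hM.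
have N0' : 0 < N%:R :> R by rewrite ltr0n.
have tau0 : 0 < tau by rewrite divr_gt0.
have tau00 := ltW tau0.
have k0 : 0 <= kappa by rewrite divr_ge0// sqrtr_ge0.
have E0 : 0 <= Einit.
  by rewrite -(pmulr_rge0 _ (_ : 0 < tau ^+ 3)) ?exprn_gt0// (le_trans _ un1).
have tS k : k.+1%:R * tau = k%:R * tau + tau by rewrite mulrS; ring.
have tkT k : (k <= N)%N -> k%:R * tau <= T.
  by move=> kN; rewrite /tau mulrA ler_pdivrMr// mulrC ler_wpM2l ?(ltW T0)// ler_nat.
have tk0 k : 0 <= k%:R * tau by rewrite mulr_ge0.
pose y t := u t - Bm (g t).
have WY := exact_weak_wave hilH hCVH contA invB hCBm T0 solu C2f C4g.
have ky t : 0 <= t <= T -> Vker B (y t) by case: WY => _ + _ _; exact.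
pose e k := un k - j (u (k%:R * tau)).
have e0 : e 0%N = 0.
  by rewrite /e mul0r un0; have [_ _ _ _ [-> _]] := solu; rewrite subrr.
pose de k := if k is 0%N then e 1%N else
  2 *: cosK tau (j (y (k%:R * tau) - b k)) + 2 *: j (b k)
    - j (y (k%:R * tau + tau)) - j (y (k%:R * tau - tau)).
have kb k : (1 <= k < N)%N -> Vker B (b k) by move=> /hb[[]].
have y_in k : (1 <= k < N)%N -> [/\ 0 <= k%:R * tau <= T, 0 <= k%:R * tau + tau <= T
    & 0 <= k%:R * tau - tau <= T].
  case: k => // k /andP[_ kN].
  have h1 := tkT k.+1 (ltnW kN); have h2 := tkT k.+2 kN; have h3 := tk0 k.
  by move: h1 h2; rewrite !tS => h1 h2; split; lra.
(* The error is the difference of two arguments of the cosine: the numerical one lies in [H_ker] by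
   definition of the scheme, the exact one in the image of [V_ker]. *)
have ek k : e k = (un k - j (Bm (g (k%:R * tau))) - j (b k)) - j (y (k%:R * tau) - b k).
  rewrite /e /y !(linearB j) /=.
  by rewrite opprB addrA subrK opprB addrA subrK.
have hek k : (1 <= k < N)%N -> Hker j B (e k).
  move=> k1; have [_ hk _] := hb k k1; rewrite ek; apply: HkerB => //.
  apply: Hker_j; apply: VkerB; last exact: kb.
  by apply: ky; have [] := y_in k k1.
have hde k : (1 <= k < N)%N -> Hker j B (de k).
  case: k => // k k1; have [yi1 yi2 yi3] := y_in _ k1.
  apply: HkerB; last by apply: Hker_j; exact: ky.
  apply: HkerB; last by apply: Hker_j; exact: ky.
  apply: HkerD; last by apply: HkerZ; apply: Hker_j; exact: kb.
  apply: HkerZ; apply: (cosK_Hker hcosK) => //; apply: Hker_j.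
  by apply: VkerB; [exact: ky|exact: kb].
have rec k : (1 <= k < N)%N -> [/\ Hker j B (e k), Hker j B (de k) &
     e k.+1 = 2 *: cosK tau (e k) - e k.-1 + de k].
  move=> k1; split; [exact: hek|exact: hde|].
  have [_ hk unS] := hb k k1; have [yi1 yi2 yi3] := y_in _ k1.
  have kyb : Hker j B (j (y (k%:R * tau) - b k)).
    by apply: Hker_j; apply: VkerB; [exact: ky|exact: kb].
  have hsum : un k - j (Bm (g (k%:R * tau))) - j (b k) = e k + j (y (k%:R * tau) - b k).
    by rewrite ek subrK.
  have {}unS := unS; rewrite hsum (cosKD hcosK tau00 (hek k k1) kyb) in unS.
  case: k k1 unS {hk yi1 yi2 yi3 kyb hsum} => // k k1 unS.
  rewrite {1}/e unS /de [k.+1.-1]/= {3}/e /y !tS addrK !(linearB j).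
  move: (cosK _ _) (cosK _ _) => X Y.
  apply: (dot_ext hilH) => w; rewrite !(dotDl, dotNl, dotZl) -/tau.
  by ring.
have bde k : (1 <= k < n)%N -> `|de k| <= expR (kappa / 2 * tau) *
    (LH * `|e k| * tau ^+ 2 + M * tau ^+ 4 / 12).
  move=> /andP[k1 kn].
  have k1N : (1 <= k < N)%N by rewrite k1 (leq_trans kn).
  have [yi1 yi2 yi3] := y_in _ k1N.
  case: k k1 kn k1N yi1 yi2 yi3 => // k k1 kn k1N yi1 yi2 yi3.
  set t := k.+1%:R * tau in yi1 yi2 yi3 *.
  have tn_ge : t + tau <= tn by rewrite /t /tn -tS ler_wpM2r// ler_nat.
  have [Ab _ _] := hb k.+1 k1N.
  pose h' := f t (un k.+1) - j (Bm (derive_onn `[0, T] 2 g t)).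
  (* [h'] and its projection have the same pairings with [j w], so [b] is also A_ker^-1 of the
     unprojected [h'], which can be compared with the exact forcing. *)
  have Ab' : is_Aker_inv dotH j A B h' (b k.+1).
    case: Ab => kbk hbk; split => // w kw; rewrite hbk//.
    have [_ /(_ (j w) (Hker_j kw))] := projpi h'.
    by rewrite dotDl dotNl => /eqP; rewrite subr_eq0 => /eqP <-.
  pose r := forcing j Bm T f g u.
  have r' s : 0 <= s <= T -> _ := fun s0 => forcing_derivative hCVH hCBm C2f C4g (isT : (0 < 2)%N) s0.
  have r'' s : 0 <= s <= T -> _ := fun s0 => forcing_derivative hCVH hCBm C2f C4g (isT : (1 < 2)%N) s0.
  have taut : tau <= t by lra.
  have tT : t + tau <= T by lra.
  have := @two_step _ _ _ _ dotV dotH hilV hilH j CVH hCVH B A A1 A2 contB contA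
    splitA symA1 mu1 C2 mu10 ellA1 C20 hC2 cosK hcosK T tau t y _ _ (b k.+1) h'
    (2 * (LH * `|e k.+1|)) M tau00 taut tT WY Ab'.
  rewrite (_ : 2 * (LH * `|e k.+1|) * tau ^+ 2 / 2 = LH * `|e k.+1| * tau ^+ 2); last by field.
  apply => //; first by rewrite !mulr_ge0.
  move=> s /andP[/ltW s0 /ltW st].
  have sd := @second_difference_le _ _ dotH hilH T t tau M _ _ _ taut tT r' r'' M0 _ s.
  (* The source 2 h' - r(t + s) - r(t - s) is 2 (h' - r t), controlled by the Lipschitz condition,
     minus the second difference of [r]; hence al = 2 LH |e| and be = M. *)
  have recenter (p q z1 z2 : H) : 2 *: p - z1 - z2 = 2 *: (p - q) - (z1 + z2 - 2 *: q).
    by rewrite scalerBr opprB addrA subrK opprD addrA.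
  rewrite (recenter _ (r t)).
  rewrite (le_trans (ler_normB _ _))// lerD//.
    rewrite normrZ ger0_norm// ler_wpM2l// /h' /r /forcing opprD opprK addrACA addNr addr0.
    by apply: lipf; rewrite in_itv.
  apply: sd; last by rewrite s0.
  by move=> x x0; apply: hM; lra.
have de0 : de 0%N = e 1%N by [].
have esum := cheb_solution hcosK tau00 e0 de0 rec.
have [n0|n0] := posnP n.
  rewrite -[un n - _]/(e n) {1}n0 e0 normr0.
  apply: mulr_ge0; last by rewrite addr_ge0// mulr_ge0//; exact: tk0.
  apply: mulr_ge0; last exact: le_trans ler01 (cosh_ge1 _).
  by apply: mulr_ge0; [apply: mulr_ge0; [exact: sqr_ge0|exact: tk0]|exact: expR_ge0].
have e1E : `|e 1%N| <= tau ^+ 3 * Einit by rewrite /e mul1r.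
have be m : (1 <= m <= n)%N -> `|e m| <=
    m%:R * (expR (kappa / 2 * (m.-1%:R * tau)) * (tau ^+ 3 * Einit)) +
    \sum_(1 <= k < m) (m - k)%:R * (expR (kappa / 2 * ((m - k)%:R * tau)) *
      (LH * `|e k| * tau ^+ 2 + M * tau ^+ 4 / 12)).
  move=> /andP[m1 mn]; have mN := leq_trans mn nN.
  have [->|m2] := eqVneq m 1%N.
    by rewrite big_geq// addr0 mul1r mul0r mulr0 expR0 mul1r.
  have {m2}m2 : (1 < m)%N by rewrite ltn_neqAle eq_sym m2.
  have he1 : Hker j B (e 1%N) by apply: hek; rewrite (leq_trans m2).
  have bU x k : (k < m)%N -> Hker j B x -> `|chebU cosK tau x (m - k)| <=
      (m - k)%:R * expR (kappa / 2 * ((m - k).-1%:R * tau)) * `|x|.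
    move=> km hx; rewrite -(prednK (_ : 0 < m - k)%N) ?subn_gt0//.
    exact: (chebU_bound hilV hilH hCVH contB contA splitA symA1 mu10 ellA1 C20 hC2 hcosK).
  rewrite esum// (le_trans (ler_norm_sum _ _ _))// big_ltn// subn0 lerD//.
    apply: (le_trans (_ : _ <= m%:R * expR (kappa / 2 * (m.-1%:R * tau)) * `|e 1%N|)).
      by have := bU (e 1%N) 0%N m1 he1; rewrite subn0.
    by rewrite -mulrA ler_wpM2l// ler_wpM2l ?expR_ge0.
  rewrite ler_sum_nat// => k /andP[k1 km].
  have k1n : (1 <= k < n)%N by rewrite k1 (leq_trans km).
  have k1N : (1 <= k < N)%N by rewrite k1 (leq_trans km).
  apply: (le_trans (bU _ _ km (hde k k1N))).
  rewrite -mulrA ler_wpM2l//.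
  apply: (le_trans (ler_wpM2l (expR_ge0 _) (bde k k1n))).
  (* The exponential in the defect bound supplies the one step missing from the exponent of
     U_(m-k-1). *)
  rewrite [leLHS]mulrA -expRD -mulrDr.
  have -> // : (m - k).-1%:R * tau + tau = (m - k)%:R * tau.
  by rewrite -{2}(prednK (_ : 0 < m - k)%N) ?subn_gt0// tS.
pose th := tau * Num.sqrt LH.
have th0 : 0 <= th by rewrite mulr_ge0// sqrtr_ge0.
have th2 : th ^+ 2 = LH * tau ^+ 2 by rewrite exprMn sqr_sqrtr// mulrC.
(* Damping by e^(-kappa t_k / 2): the exponents for (m - k) tau and k tau add up to that for m tau,
   so the exponentials leave the recursion. *)
pose a k := `|e k| * expR (- (kappa / 2 * (k%:R * tau))).
have k20 : 0 <= kappa / 2 by rewrite divr_ge0.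
have c1 : 0 <= tau ^+ 3 * Einit by apply: mulr_ge0 => //; exact: exprn_ge0.
have c2 : 0 <= M * tau ^+ 4 / 12.
  by apply: divr_ge0 => //; apply: mulr_ge0 => //; exact: exprn_ge0.
have a_rec m : (1 <= m <= n)%N -> a m <= m%:R * (tau ^+ 3 * Einit) +
    \sum_(1 <= k < m) (m - k)%:R * (th ^+ 2 * a k + M * tau ^+ 4 / 12).
  move=> mn; have := ler_wpM2r (expR_ge0 (- (kappa / 2 * (m%:R * tau)))) (be m mn).
  rewrite -/(a m) => /le_trans; apply; rewrite mulrDl lerD//.
    rewrite -[leLHS]mulrA ler_wpM2l// mulrAC -expRD ler_piMl//.
    rewrite expR_le1 -mulrN -mulrDr -mulNr -mulrDl.
    rewrite mulr_ge0_le0// mulr_le0_ge0// subr_le0 ler_nat; exact: leq_pred.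
  rewrite mulr_suml ler_sum_nat// => k /andP[k1 km].
  rewrite -[leLHS]mulrA ler_wpM2l// mulrAC -expRD -mulrN -mulrDr -mulNr -mulrDl.
  have -> : (m - k)%:R - m%:R = - k%:R :> R.
    by rewrite natrB ?(ltnW km)// addrAC subrr add0r.
  rewrite mulNr mulrN mulrDr lerD//.
    by rewrite th2 /a le_eqVlt; apply/orP; left; apply/eqP; ring.
  rewrite ler_piMl//.
  by rewrite expR_le1 oppr_le0 mulr_ge0.
have nn : (1 <= n <= n)%N by rewrite n0 leqnn.
have an := discrete_gronwall th0 c1 c2 a_rec nn.
have tn0 : 0 <= tn by exact: tk0.
have L0 : LH <= expR (kappa * tn) * LH.
  by rewrite ler_peMl// -expR0 ler_expR mulr_ge0.
have -> : `|un n - j (u tn)| = a n * expR (kappa / 2 * tn).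
  by rewrite /a -mulrA -expRD addNr expR0 mulr1.
apply: (le_trans (ler_wpM2r (expR_ge0 _) an)).
have -> : n%:R * (tau ^+ 3 * Einit) + n%:R ^+ 2 * (M * tau ^+ 4 / 12) =
    tau ^+ 2 * tn * (Einit + tn * (M / 12)) by rewrite /tn; ring.
have t2 : 0 <= tau ^+ 2 * tn by rewrite mulr_ge0// sqr_ge0.
(* The recursion yields M / 12, the rate kappa / 2 and sqrt(LH); each factor is now enlarged to the
   one in the statement. *)
have hE : Einit + tn * (M / 12) <= Einit + tn * M.
  by rewrite lerD2l ler_wpM2l//; lra.
have hE0 : 0 <= Einit + tn * (M / 12).
  by apply: addr_ge0 => //; apply: mulr_ge0 => //; exact: divr_ge0.
have hc : cosh (n%:R * th) <= cosh (tn * Num.sqrt (expR (kappa * tn) * LH)).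
  apply: ler_cosh; first by rewrite mulr_ge0.
  by rewrite /th mulrA ler_wpM2l// ler_wsqrtr.
have c0 := le_trans ler01 (cosh_ge1 (n%:R * th)).
have hx : expR (kappa / 2 * tn) <= expR (kappa * tn).
  by rewrite ler_expR ler_wpM2r//; lra.
have reorder (p x c z x' c' z' : R) :
    p * (x * c * z) <= p * (x' * c' * z') -> p * x * c * z <= p * z' * c' * x'.
  have -> : p * x * c * z = p * (x * c * z) by ring.
  by have -> : p * z' * c' * x' = p * (x' * c' * z') by ring.
apply: reorder; apply: ler_wpM2l => //.
by apply: ler_pM => //; [exact: mulr_ge0|exact: ler_pM].
Qed.

End gautschi_error.

(** The continuity constants are given only through their inequalities; a single nonzero vector
    forces them to be nonnegative. *)
Lemma bound_constant_ge0 (R : realType) (E F : normedModType R) (h : E -> F) (C : R) (v : E) :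
  v != 0 -> `|h v| <= C * `|v| -> 0 <= C.
Proof. by move=> v0 hC; rewrite -(@pmulr_lge0 _ `|v|) ?normr_gt0// (le_trans _ hC). Qed.

Theorem theorem4p4 (R : realType) (V H Q : completeNormedModType R)
  (dotV : {dot V for (@idfun R)}) (dotH : {dot H for (@idfun R)})
  (dotQ : {dot Q for (@idfun R)})
  (hilV : hilbert_dot dotV) (hilH : hilbert_dot dotH) (hilQ : hilbert_dot dotQ)
  (j : {linear V -> H}) (gelfand : gelfand_triple j)
  (CVH : R) (hCVH : forall v, `|j v| <= CVH * `|v|)
  (B : {linear V -> dual Q}) (contB : continuous B)
  (beta : R) (beta0 : 0 < beta) (infsupB : inf_sup B beta)
  (A A1 : {linear V -> dual V}) (A2 : {linear V -> H}) (contA : continuous A)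
  (mu : R) (mu0 : 0 < mu) (ellA : elliptic_on_Vker B mu A)
  (splitA : forall v w, A v w = A1 v w + dotH (A2 v) (j w))
  (symA1 : forall v w, Vker B v -> Vker B w -> A1 v w = A1 w v)
  (mu1 : R) (mu10 : 0 < mu1) (ellA1 : elliptic_on_Vker B mu1 A1)
  (C2 : R) (hC2 : forall v, `|A2 v| <= C2 * `|v|)
  (Bm : {linear dual Q -> V}) (invB : is_right_inverse A B Bm)
  (CBm : R) (hCBm : forall q, `|Bm q| <= CBm * `|q|)
  (pi : H -> H) (projpi : is_projection_Hker dotH j B pi)
  (cosK : R -> H -> H) (hcosK : is_operator_cosine dotH j A B cosK)
  (T : R) (T0 : 0 < T)
  (f : R -> H -> H) (caraf : caratheodory `[0, T] f)
  (LH : R) (lipf : forall t x z, t \in `[0, T] -> `|f t x - f t z| <= LH * `|x - z|)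
  (g : R -> dual Q) (u0 : V) (w0 : H) (consistent0 : consistent j B Bm T g u0 w0)
  (u : R -> V) (solu : pdae_solution dotH j A B T f g u0 w0 u)
  (C2f : C_on `[0, T] 2 (fun t => f t (j (u t)))) (C4g : C_on `[0, T] 4 g)
  (Einit : R) :
  let kappa := C2 / Num.sqrt mu1 in
  let L := fun t => expR (kappa * t) * LH in
  let Cfg := fun t =>
    Linfty_norm t (derive_onn `[0, T] 2 (fun s => f s (j (u s))))
    + CVH * CBm * Linfty_norm t (derive_onn `[0, T] 4 g) in
  let numerical := fun (N : nat) (un : nat -> H) =>
    [/\ un 0%N = j u0,
        `|un 1%N - j (u (T / N%:R))| <= (T / N%:R) ^+ 3 * Einit &
        gautschi dotH j A B Bm pi cosK T f g N un] in
  (exists K, forall N un, (0 < N)%N -> numerical N un ->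
     forall n, (n <= N)%N ->
     let tau := T / N%:R in
     `|un n - j (u (n%:R * tau))| <= K * tau ^+ 2)
  /\
  (exists K, forall N un, (0 < N)%N -> numerical N un ->
     forall n, (n <= N)%N ->
     let tau := T / N%:R in
     let tn := n%:R * tau in
     `|un n - j (u tn)| <=
       tau ^+ 2 * tn * expR (kappa * tn) * cosh (tn * Num.sqrt (L tn))
         * (Einit + tn * Cfg tn)
       + K * tau ^+ 3).
Proof.
move=> kappa L Cfg numerical.
pose F2 := derive_onn `[0, T]%classic 2 (fun s => f s (j (u s))).
pose G4 := derive_onn `[0, T]%classic 4 g.
have tnT N n : (0 < N)%N -> (n <= N)%N -> 0 <= n%:R * (T / N%:R) <= T.
  move=> N0 nN; have N0' : 0 < N%:R :> R by rewrite ltr0n.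
  apply/andP; split; first by apply: mulr_ge0 => //; apply: divr_ge0 => //; exact: ltW.
  by rewrite mulrA ler_pdivrMr// mulrC ler_wpM2l ?(ltW T0)// ler_nat.
have Einit_ge0 N un : (0 < N)%N -> numerical N un -> 0 <= Einit.
  move=> N0 [_ un1 _].
  rewrite -(pmulr_rge0 _ (_ : 0 < (T / N%:R) ^+ 3)) ?(le_trans _ un1)//.
  by rewrite exprn_gt0// divr_gt0// ltr0n.
(* When V = 0 the constants have no sign, but density gives H = 0 and surjectivity of [B] makes the
   dual of Q trivial; the error is 0 and only the sign of the right-hand side is to be checked. *)
have [[v0 v00]|noV] := pselect (exists v0 : V, v0 != 0); last first.
  have trivV (v : V) : v = 0 by apply/eqP/negPn/negP => v0; apply: noV; exists v.
  have trivH (x : H) : x = 0.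
    have [_ _ dj] := gelfand; apply/eqP/negPn/negP => x0.
    have x1 : 0 < `|x| by rewrite normr_gt0.
    have ne : ball x `|x| !=set0 by exists x; exact: ballxx.
    have op : open (ball x `|x|) by exact: ball_open.
    have [x' [hx [v _ vx]]] := dj _ ne op.
    have {}hx : ball x `|x| (j v) by rewrite vx.
    by move: hx; rewrite -ball_normE /= (trivV v) linear0 subr0 ltxx.
  have trivQ (q : dual Q) : q = 0.
    by have [_ Br _] := invB; rewrite -(Br q) (trivV (Bm q)) linear0.
  have H0 (x : H) : `|x| = 0 by rewrite (trivH x) normr0.
  split; exists 0 => N un N0 num n nN /=; rewrite H0 mul0r// addr0.
  have /andP[t0 _] := tnT N n N0 nN.
  apply: mulr_ge0.
    apply: mulr_ge0; last exact: le_trans ler01 (cosh_ge1 _).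
    by apply: mulr_ge0; [apply: mulr_ge0 => //; exact: sqr_ge0|exact: expR_ge0].
  apply: addr_ge0; first exact: Einit_ge0 num.
  apply: mulr_ge0 => //; apply: addr_ge0; first exact: Linfty_norm_ge0.
  by rewrite (@Linfty_norm0 _ _ _ G4) ?mulr0// => s; rewrite (trivQ (G4 s)) normr0.
have C20 : 0 <= C2 := bound_constant_ge0 v00 (hC2 v0).
have CVH0 : 0 <= CVH := bound_constant_ge0 v00 (hCVH v0).
have LH0 : 0 <= LH.
  have jv0 : j v0 != 0.
    have [_ ij _] := gelfand; apply: contra_neq v00 => h.
    by apply: ij; rewrite h linear0.
  have T0T : (0 : R) \in `[0, T] by rewrite in_itv/= lexx ltW.
  apply: (@bound_constant_ge0 _ _ _ (fun x => f 0 x - f 0 0) _ (j v0) jv0).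
  by have := lipf 0 (j v0) 0 T0T; rewrite subr0.
have k0 : 0 <= kappa by rewrite divr_ge0// sqrtr_ge0.
have cF2 : {within `[0, T], continuous F2} by exact: (C2f.2 2%N isT).
have cG4 : {within `[0, T], continuous G4} by exact: (C4g.2 4%N isT).
have err N un n M : (0 < N)%N -> numerical N un -> (n <= N)%N -> 0 <= M ->
    (forall s, 0 < s < n%:R * (T / N%:R) -> `|F2 s - j (Bm (G4 s))| <= M) ->
    `|un n - j (u (n%:R * (T / N%:R)))| <=
      (T / N%:R) ^+ 2 * (n%:R * (T / N%:R)) * expR (kappa * (n%:R * (T / N%:R)))
      * cosh (n%:R * (T / N%:R) * Num.sqrt (L (n%:R * (T / N%:R))))
      * (Einit + n%:R * (T / N%:R) * M).
  move=> N0 [un0 un1 hun] nN M0 hM.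
  exact: (gautschi_error hilV hilH hCVH contB contA splitA symA1 mu10 ellA1 C20 hC2
    invB hCBm projpi hcosK T0 LH0 lipf solu C2f C4g).
split.
  (* For the uniform order, [M] bounds the second derivative of the reduced source over all of
     [0, T], and every factor, nondecreasing in time, is evaluated at T. *)
  have cH : {within `[0, T], continuous (fun s => F2 s - j (Bm (G4 s)))}.
    have := within_continuous_comp_bounded hCVH (within_continuous_comp_bounded hCBm cG4).
    move=> /subspace_continuousP cj; move/subspace_continuousP : cF2 => cF2.
    by apply/subspace_continuousP => t Dt; apply: cvgB; [exact: cF2|exact: cj].
  have [M hM] := continuous_norm_bounded (ltW T0) cH.
  exists (T * expR (kappa * T) * cosh (T * Num.sqrt (L T)) * (`|Einit| + T * `|M|)).
  move=> N un N0 num n nN /=.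
  have /andP[t0 tT] := tnT N n N0 nN.
  have := err N un n `|M| N0 num nN (normr_ge0 _).
  move: t0 tT; set t := n%:R * _ => t0 tT h.
  apply: (le_trans (h _)) => [s /andP[s0 st]|].
    rewrite (le_trans _ (ler_norm M))// hM// (ltW s0)/=.
    by rewrite (le_trans (ltW st)).
  have E0 := Einit_ge0 N un N0 num.
  have Lt : L t <= L T.
    by rewrite ler_wpM2r// ler_expR ler_wpM2l.
  have c1 : 0 <= cosh (t * Num.sqrt (L t)) := le_trans ler01 (cosh_ge1 _).
  have c2 : cosh (t * Num.sqrt (L t)) <= cosh (T * Num.sqrt (L T)).
    apply: ler_cosh; first by rewrite mulr_ge0// sqrtr_ge0.
    by apply: ler_pM => //; exact: ler_wsqrtr.
  have e2 : expR (kappa * t) <= expR (kappa * T) by rewrite ler_expR ler_wpM2l.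
  have mono (p a b c d a' b' c' d' : R) : 0 <= p -> 0 <= a -> 0 <= b -> 0 <= c -> 0 <= d ->
      a <= a' -> b <= b' -> c <= c' -> d <= d' ->
      p * a * b * c * d <= a' * b' * c' * d' * p.
    move=> p0 a0 b0 c0 d0 aa bb cc dd.
    have -> : p * a * b * c * d = a * b * c * d * p by ring.
    by rewrite ler_wpM2r// !ler_pM ?mulr_ge0.
  apply: mono => //; [exact: sqr_ge0| |].
    by apply: addr_ge0 => //; exact: mulr_ge0.
  by apply: lerD; [exact: ler_norm|exact: ler_wpM2r].
(* The O(tau^3) term is met with K = 0. *)
exists 0; move=> N un N0 num n nN; cbv zeta; rewrite mul0r addr0.
set tau := T / N%:R; set tn := n%:R * tau.
have /andP[t0 tT] := tnT N n N0 nN.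
have [CB0 hG] : 0 <= CVH * CBm * Linfty_norm tn G4 /\
    forall s, 0 < s < tn -> CVH * CBm * `|G4 s| <= CVH * CBm * Linfty_norm tn G4.
  (* [CBm] has a sign as soon as the dual of Q contains a nonzero element; otherwise the fourth
     derivative of [g] is zero and both sides vanish. *)
  have [[q q0]|noq] := pselect (exists q : dual Q, q != 0).
    have CB0 : 0 <= CVH * CBm.
      by apply: mulr_ge0 => //; exact: bound_constant_ge0 q0 (hCBm q).
    split; first by apply: mulr_ge0 => //; exact: Linfty_norm_ge0.
    by move=> s st; apply: ler_wpM2l => //; exact: Linfty_norm_ge st tT cG4.
  have q0 (q : dual Q) : `|q| = 0.
    by apply/eqP; rewrite normr_eq0; apply/negPn/negP => q0; apply: noq; exists q.
  rewrite (@Linfty_norm0 _ _ _ G4) ?mulr0//; split => // s _.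
  by rewrite q0 mulr0.
apply: err => //; first by apply: addr_ge0 => //; exact: Linfty_norm_ge0.
move=> s st; rewrite (le_trans (ler_normB _ _))// lerD//.
  exact: Linfty_norm_ge st tT cF2.
apply: le_trans (hG s st); apply: (le_trans (hCVH _)).
by rewrite -mulrA ler_wpM2l.
Qed.
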